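(* Let $\alpha<0$, let $B$ be a measure on $]0,1[$ with $\int_0^1 y(1-y)B(dy)<\infty$ and $B(]0,1[)>0$, let $\mu_0$ be a measure on $]0,\infty[$ with $\int_0^\infty x\mu_0(dx)=1$ whose support is bounded with supremum equal to $1$, and let $(\mu_t,t\ge0)$ be the unique solution of the fragmentation equation with parameters $(\alpha,B)$ starting from $\mu_0$. Let $m(t)=\int_0^\infty x\,\mu_t(dx)$. Suppose that $\mu_0(\{1\})>0$ and set $\phi(\infty):=\int_0^1x\,B(dx)\in\,]0,\infty]$. Then, for all $t\ge0$, $$\mu_t(\{1\})=\exp(-t\phi(\infty))\,\mu_0(\{1\}).$$ If, further, $u\in\,]0,1[\,\mapsto\int_0^{1-u}x\,B(dx)$ varies regularly at $0$ with some index $-\beta\in\,]-1,0]$, $\int_0^1|\ln(x)|\,x\,B(dx)<\infty$ and $\phi(\infty)<\infty$, then $$\frac{\mu_t(\{1\})}{m(t)}\ \longrightarrow\ \phi(\infty)^{1/|\alpha|}\,\mu_\infty\big(\{\phi(\infty)^{1/|\alpha|}\}\big)\qquad(t\to\infty),$$ and this limit is nonzero if and only if $\int_{1/2}^1\frac{B(dx)}{1-x}<\infty$.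
   Context: A solution of the fragmentation equation with parameters $(\alpha,B)$ starting from $\mu_0$ is any family of measures $(\mu_t,t\ge0)$ on $]0,\infty[$, equal to $\mu_0$ at $t=0$, such that: (a) for every real-valued continuously differentiable function $f$ on $]0,\infty[$ with compact support, $\partial_t\int f\,d\mu_t=\int_0^\infty x^\alpha\big(\int_0^1(f(yx)-f(x)y)B(dy)\big)\mu_t(dx)$; (b) $\int_0^\infty x\,\mu_t(dx)\le\int_0^\infty x\,\mu_0(dx)=1$ for all $t\ge0$; (c) if $\mu_0([M,\infty[)=0$ for some $M>0$, then $\mu_t([M,\infty[)=0$ for all $t\ge 0$. When $\alpha<0$ and $\mu_0$ has bounded support, such a solution exists and is unique. The supremum of the support of $\mu_0$ is the real $s$ such that $\mu_0(]s,\infty[)=0$ and $\mu_0(]s-\varepsilon,s])>0$ for all $0<\varepsilon<s$. With $\phi(t)=\int_0^1(1-x^t)\,x\,B(dx)$, $\mu_\infty$ is the unique measure on $]0,\infty[$ such that $x\mu_\infty(dx)$ is a probability measure with $\int_0^\infty x^{|\alpha|n}x\,\mu_\infty(dx)=\phi(|\alpha|)\phi(2|\alpha|)\cdots\phi(n|\alpha|)$ for all integers $n\ge1$ (existence and uniqueness are known). *)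

(* Defs.v *)
From mathcomp Require Import all_boot all_order all_algebra.
From mathcomp Require Import all_classical all_reals all_analysis.

Set Implicit Arguments.
Unset Strict Implicit.
Unset Printing Implicit Defensive.

Import Order.TTheory GRing.Theory Num.Theory.
Import numFieldNormedType.Exports.

Local Open Scope classical_set_scope.
Local Open Scope ring_scope.

(* All measures are Borel measures on the line, not assumed finite or
   sigma-finite; a measure "on D" is one that gives no mass to the complement
   of D. *)
Notation borel_measure R := {measure set (measurableTypeR R) -> \bar R}.

Definition measure_on (R : realType) (D : set R) (mu : borel_measure R) : Prop :=
  mu (~` D) = 0%E.

Definition total_mass (R : realType) (mu : borel_measure R) : \bar R :=
  (\int[mu]_(x in `]0%R, +oo[%classic) x%:E)%E.

(* Compact support is meant inside ]0, +oo[: the support stays away from both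
   0 and +oo.  The values of f outside ]0, +oo[ play no role. *)
Definition test_function (R : realType) (f : R -> R) : Prop :=
  [/\ (forall x : R, 0 < x -> derivable f x 1),
      (forall x : R, 0 < x -> {for x, continuous (derive1 f)}) &
      exists K : set R, [/\ compact K, K `<=` `]0, +oo[ &
        forall x : R, 0 < x -> ~ K x -> f x = 0]].

(* For alpha < 0, \int y (1 - y) B(dy) finite and f a test function, this
   integral converges absolutely, and so does that of the result against any mu
   with \int x mu(dx) finite: real-valued integrals then take no default value. *)
Definition fragmentation_operator (R : realType) (alpha : R)
    (B : borel_measure R) (f : R -> R) (x : R) : R :=
  x `^ alpha * \int[B]_(y in `]0, 1[) (f (y * x) - f x * y).

(* The time derivative is taken along times s >= 0; at t = 0 it is thus the
   right derivative. *)
Definition fragmentation_solution (R : realType) (alpha : R)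
    (B mu0 : borel_measure R) (mu : R -> borel_measure R) : Prop :=
  [/\ (forall t : R, 0 <= t -> measure_on `]0, +oo[ (mu t)),
      (forall A : set (measurableTypeR R), measurable A -> mu 0 A = mu0 A),
      (forall f : R -> R, test_function f -> forall t : R, 0 <= t ->
         ((\int[mu s]_(x in `]0, +oo[) f x) - (\int[mu t]_(x in `]0, +oo[) f x))
           / (s - t)
         @[s --> within [set s : R | 0 <= s] t^'] -->
         \int[mu t]_(x in `]0, +oo[) fragmentation_operator alpha B f x),
      (total_mass mu0 = 1%E /\
       forall t : R, 0 <= t -> (total_mass (mu t) <= total_mass mu0)%E) &
      (forall M : R, 0 < M -> mu0 `[M, +oo[%classic = 0%E ->
         forall t : R, 0 <= t -> mu t `[M, +oo[%classic = 0%E)].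

Definition is_sup_support (R : realType) (mu : borel_measure R) (s : R) : Prop :=
  mu `]s, +oo[%classic = 0%E /\
  forall eps : R, 0 < eps < s -> (0 < mu `](s - eps)%R, s]%classic)%E.

Definition frag_phi (R : realType) (B : borel_measure R) (t : R) : R :=
  \int[B]_(x in `]0, 1[) ((1 - x `^ t) * x).

Definition frag_phi_infty (R : realType) (B : borel_measure R) : \bar R :=
  (\int[B]_(x in `]0%R, 1%R[%classic) x%:E)%E.

Definition is_mu_infty (R : realType) (alpha : R) (B : borel_measure R)
    (mu : borel_measure R) : Prop :=
  [/\ measure_on `]0, +oo[ mu,
      total_mass mu = 1%E &
      forall n : nat, (1 <= n)%N ->
        (\int[mu]_(x in `]0%R, +oo[%classic) (x `^ (`|alpha| * n%:R) * x)%:E)%E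
        = (\prod_(1 <= k < n.+1) frag_phi B (k%:R * `|alpha|))%:E].

Definition regularly_varying_at0 (R : realType) (f : R -> R) (rho : R) : Prop :=
  (exists2 d : R, 0 < d &
     measurable_fun (`]0, d[ : set R) f /\ forall u : R, 0 < u < d -> 0 < f u) /\
  forall lambda : R, 0 < lambda ->
    f (lambda * u) / f u @[u --> 0^'+] --> lambda `^ rho.

(* Main.v *)
Require Import Defs.
From HB Require Import structures.
From mathcomp Require Import all_boot all_order all_algebra.
From mathcomp Require Import all_classical all_reals all_analysis.
From mathcomp Require Import measurable_realfun.
From mathcomp Require Import ring lra.

(* With x mu_t(dx) = sigma_t, a measure on ]0,1] of mass m(t), the equation says
   that the integral of g against sigma_t has derivative the integral of
   x^alpha \int (g(yx) - g(x)) y B(dy).  Taking for g smooth approximations of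
   the indicator of {1}, Gronwall gives sigma_t{1} = e^{-t phi} sigma_0{1} where
   phi = phi(oo).

   Let phi < oo and a = |alpha|.  The equation turns the moments of orders ak
   into a chain of differential relations; the mixtures
   Q_k(t) = \int x^{ak} N_k(t x^{-a}) tau(dx) / (phi(a)...phi(ka)), N_k(t) being
   the moment of order ak of sigma_t and tau = x mu_oo(dx), and
   P_k(t) = \int x^{ak} e^{-t x^{-a}} sigma_0(dx) satisfy the same relations
   Q_{k+1}' = -Q_k and agree at 0.  A bounded chain is determined by its initial
   values (a Laplace transform argument), so that
   \int m(t x^{-a}) tau(dx) = \int e^{-t x^{-a}} sigma_0(dx).  The moments of
   tau show that tau lives on ]0,c], c = phi^{1/a}, with atom
   p = tau{c} = lim phi(a)...phi(na) / phi^n, and comparing the two sides of the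
   identity as t -> oo gives p e^{phi t} m(t) -> sigma_0{1} if p > 0.  If
   \int_{1/2}^1 B(dx)/(1-x) is finite, then p > 0 by the product formula.  If it
   is infinite, then the mass of the fragments created from {1} by a single
   dislocation already makes e^{phi t} m(t) tend to infinity, and then the
   identity forces p = 0. *)

Set Implicit Arguments.
Unset Strict Implicit.
Unset Printing Implicit Defensive.

Import Order.TTheory GRing.Theory Num.Theory.
Import numFieldNormedType.Exports.

Local Open Scope classical_set_scope.
Local Open Scope ring_scope.

(** Origin of the mixture: for sigma_0 the point mass at 1, m(t) is the probability that I > t,
    where I is the exponential functional of a subordinator, with moments n!/(phi(a)...phi(na));
    under tau, x^a has the moments phi(a)...phi(na). Independent variables with these two laws have
    a standard exponential product, and the identity for m is this factorization: it trades the
    unknown decay of m for explicit exponentials. Two obstacles shape the proof. Since x^alpha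
    explodes at 0, only functions vanishing near 0 can be tested; the mass is reached as a limit and
    its continuity is unknown. Derivatives of moments are therefore replaced by two-sided bounds on
    increments, and the identity is used with a strict delay between its two sides. Moreover, equal
    initial values do not determine a chain: its level 0 can be chosen freely, the other levels
    being iterated primitives. Only a bound uniform in level and time closes it. Dividing moments by
    phi(a)...phi(ka) could destroy this bound; the moments of tau restore it. *)

(** * Calculus *)

(* As in the definition of solutions, the derivative at 0 is one-sided. *)
Definition has_rderiv (R : realType) (u u' : R -> R) : Prop :=
  forall t : R, 0 <= t ->
    (u s - u t) / (s - t) @[s --> within [set s : R | 0 <= s] t^'] --> u' t.

Lemma has_rderiv_dist (R : realType) (u u' : R -> R) (t e : R) :
  has_rderiv u u' -> 0 <= t -> 0 < e ->
  exists2 d : R, 0 < d & forall s : R, `|t - s| < d -> s != t -> 0 <= s ->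
    `|u' t - (u s - u t) / (s - t)| < e.
Proof.
move=> hu t0 e0; move/cvgrPdist_lt : (hu _ t0) => /(_ _ e0).
by move=> [d /= d0 H]; exists d.
Qed.

Lemma has_rderiv_is_derive (R : realType) (u u' : R -> R) (t : R) :
  has_rderiv u u' -> 0 < t -> is_derive t 1 u (u' t).
Proof.
move=> hu t0.
have H : h^-1 *: (u (h *: (1:R) + t) - u t) @[h --> 0^'] --> u' t.
  apply/cvgrPdist_lt => e e0.
  have [d d0 H] := has_rderiv_dist hu (ltW t0) e0.
  near=> h.
  have -> : h^-1 *: (u (h *: (1 : R) + t) - u t) = (u (h + t) - u t) / (h + t - t).
    by rewrite addrK mulrC /GRing.scale/= mulr1.
  apply: H.
  - rewrite opprD addrCA subrr addr0 normrN; near: h; exact: dnbhs0_lt.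
  - rewrite -subr_eq0 addrK; near: h; exact: nbhs_dnbhs_neq.
  - have : `|h| < t by near: h; apply: dnbhs0_lt.
    by rewrite ltr_norml => /andP[+ _]; rewrite -subr_gt0 opprK => /ltW.
split; first by apply/cvg_ex; exists (u' t).
by apply/cvg_lim => //.
Unshelve. all: by end_near. Qed.

Lemma has_rderiv_continuous (R : realType) (u u' : R -> R) (a b : R) :
  has_rderiv u u' -> 0 <= a -> {within `[a, b], continuous u}.
Proof.
move=> hu a0.
apply: (@continuous_subspaceW _ _ _ [set s : R | 0 <= s]).
  by move=> x /=; rewrite in_itv/= => /andP[/(le_trans a0)].
apply/subspace_continuousP => t t0.
apply/cvgrPdist_lt => e e0.
have [d d0 H] := has_rderiv_dist hu t0 ltr01.
rewrite /within/= !near_withinE.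
have K0 : 0 < `|u' t| + 1 by rewrite ltr_wpDl.
have eK0 : 0 < e / (`|u' t| + 1) by rewrite divr_gt0.
near=> s => s0.
have [->|st] := eqVneq s t; first by rewrite subrr normr0.
have := H s _ st s0.
have -> : `|t - s| < d.
  by near: s; exact: cvgr_dist_lt.
move=> /(_ isT) {}H.
have : `|(u s - u t) / (s - t)| < `|u' t| + 1.
  have := ler_normB (u' t) (u' t - (u s - u t) / (s - t)).
  by rewrite subKr => /le_lt_trans; apply; rewrite ltrD2l.
rewrite normrM normfV ltr_pdivrMr ?normr_gt0 ?subr_eq0// distrC => /lt_le_trans; apply.
rewrite mulrC -ler_pdivlMr //.
Unshelve. all: by end_near. Qed.

(** Mean value theorem for [u * E + F], with [E] an integrating factor and [F] a primitive of the
    source: the differential inequalities below are reduced to this one. A sign condition on the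
    open interval suffices, [u] being continuous up to the endpoints, 0 included. *)
Lemma has_rderiv_mono (R : realType) (u u' E E' F F' : R -> R) (s t : R) :
  has_rderiv u u' ->
  (forall x, is_derive x (1 : R) E (E' x)) ->
  (forall x, is_derive x (1 : R) F (F' x)) ->
  0 <= s -> s <= t ->
  (forall x, s < x -> x < t -> 0 <= u' x * E x + u x * E' x + F' x) ->
  u s * E s + F s <= u t * E t + F t.
Proof.
move=> hu hE hF s0; rewrite le_eqVlt => /predU1P[->//|st] H.
have cts (G G' : R -> R) : (forall x, is_derive x (1 : R) G (G' x)) ->
    {within `[s, t], continuous G}.
  move=> hG; apply: derivable_within_continuous => x _.
  by have [] := hG x.
have [||c] := @MVT R (u * E + F) (fun x => u' x * E x + u x * E' x + F' x) s t st.
- move=> x; rewrite in_itv/= => /andP[sx xt].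
  have x0 : 0 < x by apply: le_lt_trans sx.
  have := has_rderiv_is_derive hu x0 => hux.
  have hEx := hE x; have hFx := hF x.
  apply: is_derive_eq; rewrite /GRing.scale/=.
  by rewrite [E x * _]mulrC [X in X + _ = _]addrC.
- move=> x; apply: continuousD; last exact: (cts _ _ hF).
  apply: continuousM; last exact: (cts _ _ hE).
  exact: (has_rderiv_continuous hu s0).
rewrite in_itv/= => /andP[sc ct] e.
rewrite -subr_ge0 -[X in 0 <= X]/((u * E + F) t - (u * E + F) s) e.
by rewrite mulr_ge0 ?H// subr_ge0 ltW.
Qed.

(** The square of the positive part, the simplest C^1 function vanishing on a half-line; the
    admissible cut-offs below are built from it. *)
Definition sqp (R : realType) (v : R) : R := Num.max v 0 ^+ 2.

Lemma maxr0_lip (R : realType) (u v : R) :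
  `|Num.max u 0 - Num.max v 0| <= `|u - v|.
Proof.
case: (leP u 0) => u0; case: (leP v 0) => v0; rewrite ?subrr ?normr0//.
- by rewrite sub0r normrN gtr0_norm// ler0_norm; lra.
- by rewrite subr0 gtr0_norm// ger0_norm; lra.
Qed.

Lemma continuous_maxr0 (R : realType) : continuous (fun v : R => Num.max v 0).
Proof.
move=> v; apply/cvgrPdist_lt => e e0; near=> w.
by apply: le_lt_trans (maxr0_lip _ _) _; near: w; exact: cvgr_dist_lt.
Unshelve. all: by end_near. Qed.

Lemma is_derive_sqp (R : realType) (v : R) :
  is_derive v 1 (@sqp R) (2 * Num.max v 0).
Proof.
have B (h : R) : `|sqp (h + v) - sqp v - 2 * Num.max v 0 * h| <= h ^+ 2.
  rewrite /sqp ler_norml; case: (leP v 0) => v0; case: (leP (h + v) 0) => hv0.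
  - by rewrite expr0n/=; nra.
  - by rewrite expr0n/=; nra.
  - by rewrite expr0n/=; nra.
  - by nra.
have H : h^-1 *: (sqp (h *: (1:R) + v) - sqp v) @[h --> 0^'] --> 2 * Num.max v 0.
  apply/cvgrPdist_le => e e0; near=> h.
  have h0 : h != 0 by near: h; exact: nbhs_dnbhs_neq.
  rewrite /GRing.scale/= mulr1 distrC.
  have -> : h^-1 * (sqp (h + v) - sqp v) - 2 * Num.max v 0 =
      h^-1 * (sqp (h + v) - sqp v - 2 * Num.max v 0 * h).
    by rewrite [in RHS]mulrBr [X in _ = _ - X]mulrC mulfK.
  rewrite normrM normfV.
  rewrite ler_pdivrMl ?normr_gt0//; apply: le_trans (B h) _.
  rewrite -real_normK ?num_real// expr2 ler_wpM2l//.
  by near: h; apply: dnbhs0_le.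
split; first by apply/cvg_ex; exists (2 * Num.max v 0).
by apply/cvg_lim => //.
Unshelve. all: by end_near. Qed.

(** * Functions of class C^1 on ]0,+oo[ and cut-offs *)

Definition C1pos (R : realType) (g : R -> R) : Prop :=
  exists g' : R -> R, forall x : R, 0 < x ->
    is_derive x 1 g (g' x) /\ {for x, continuous g'}.

Lemma is_derive_continuous (R : realType) (f : R -> R) (x df : R) :
  is_derive x 1 f df -> {for x, continuous f}.
Proof. by case=> + _ => /derivable1_diffP /differentiable_continuous. Qed.

Lemma C1posM (R : realType) (f g : R -> R) :
  C1pos f -> C1pos g -> C1pos (fun x => f x * g x).
Proof.
move=> [f' hf] [g' hg]; exists (fun x => f x * g' x + g x * f' x) => x x0.
have [fx cf'] := hf _ x0; have [gx cg'] := hg _ x0; split.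
  by have := is_deriveM fx gx.
have cf := is_derive_continuous fx; have cg := is_derive_continuous gx.
by apply: cvgD; apply: cvgM.
Qed.

Lemma C1pos_comp (R : realType) (f f' g : R -> R) :
  (forall x, is_derive x (1 : R) f (f' x)) -> continuous f' ->
  C1pos g -> C1pos (fun x => f (g x)).
Proof.
move=> hf cf' [g' hg]; exists (fun x => f' (g x) * g' x) => x x0.
have [gx cg'] := hg _ x0; split.
  have hfg := hf (g x).
  have := @is_derive1_comp R f g x _ _ hfg gx.
  by [].
apply: cvgM => //.
by apply: continuous_comp; [exact: is_derive_continuous gx | exact: cf'].
Qed.

Lemma C1pos_sqp (R : realType) (g : R -> R) :
  C1pos g -> C1pos (fun x => sqp (g x)).
Proof.
apply: C1pos_comp; first exact: is_derive_sqp.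
move=> x; apply: cvgM; first exact: cvg_cst.
exact: continuous_maxr0.
Qed.

Lemma is_derive_affine (R : realType) (b c x : R) :
  is_derive x 1 (fun x : R => b * x + c) b.
Proof.
have H := @is_deriveD R R R (b \*: (@id R)) (cst c) x 1 _ _
   (is_deriveZ b (is_derive_id x 1)) (is_derive_cst c x 1).
by apply: (is_derive_eq H); rewrite /GRing.scale/= mulr1 addr0.
Qed.

Lemma C1pos_affine (R : realType) (b c : R) : C1pos (fun x : R => b * x + c).
Proof.
by exists (fun=> b) => x _; split; [exact: is_derive_affine | exact: cvg_cst].
Qed.

Lemma continuous_powR_pos (R : realType) (q x : R) :
  0 < x -> {for x, continuous (fun x : R => x `^ q)}.
Proof. by move=> x0; exact: is_derive_continuous (is_derive1_powR q x0). Qed.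

Lemma C1pos_powR (R : realType) (q : R) : C1pos (fun x : R => x `^ q).
Proof.
exists (fun x => q * x `^ (q - 1)) => x x0; split; first exact: is_derive1_powR.
by apply: cvgM; [exact: cvg_cst | exact: continuous_powR_pos].
Qed.

Lemma eq_C1pos (R : realType) (f g : R -> R) :
  f =1 g -> C1pos f -> C1pos g.
Proof. by move=> /funext ->. Qed.

(* A C^1 transition from 0 (for v <= 0) to 1 (for v >= 1). *)
Definition smooth_step (R : realType) (v : R) : R := sqp (1 - sqp (1 - v)).

Lemma C1pos_step (R : realType) (b c : R) :
  C1pos (fun x : R => smooth_step (b * x + c)).
Proof.
apply: C1pos_sqp.
apply: (@eq_C1pos R (fun x => (-1) * sqp (- b * x + (1 - c)) + 1)).
  by move=> x; rewrite mulN1r addrC; congr (1 - sqp _); lra.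
apply: (@C1pos_comp R (fun v => (-1) * v + 1) (fun=> -1)).
- exact: is_derive_affine.
- by move=> x; exact: cvg_cst.
- exact/C1pos_sqp/C1pos_affine.
Qed.

Lemma sqp_ge0 (R : realType) (v : R) : 0 <= sqp v.
Proof. exact: sqr_ge0. Qed.

Lemma sqp_le (R : realType) (u v : R) : u <= v -> sqp u <= sqp v.
Proof.
have M (w : R) : 0 <= Num.max w 0 by rewrite le_max lexx orbT.
move=> uv; rewrite /sqp ler_sqr ?nnegrE ?M//.
by rewrite ge_max M le_max uv.
Qed.

Lemma sqp0 (R : realType) (v : R) : v <= 0 -> sqp v = 0.
Proof. by move=> v0; rewrite /sqp max_r// expr0n. Qed.

Lemma step_eq0 (R : realType) (v : R) : v <= 0 -> smooth_step v = 0.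
Proof.
move=> v0; have v1 : 0 <= 1 - v by lra.
by apply: sqp0; rewrite subr_le0 /sqp max_l// expr2; nra.
Qed.

Lemma step_eq1 (R : realType) (v : R) : 1 <= v -> smooth_step v = 1.
Proof.
by move=> v1; rewrite /smooth_step (@sqp0 _ (1 - v)) ?subr_le0// subr0 /sqp max_l// expr1n.
Qed.

Lemma step_le (R : realType) (u v : R) : u <= v -> smooth_step u <= smooth_step v.
Proof. by move=> uv; apply: sqp_le; rewrite lerD2l lerN2; apply: sqp_le; lra. Qed.

Lemma step_ge0 (R : realType) (v : R) : 0 <= smooth_step v.
Proof. exact: sqp_ge0. Qed.

Lemma step_le1 (R : realType) (v : R) : smooth_step v <= 1.
Proof.
have [v1|/ltW v1] := leP v 1; last by rewrite step_eq1.
by rewrite -(@step_eq1 _ 1)// step_le.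
Qed.

(** * Size biasing *)

Section size_biased.
Context {R : realType} (mu : borel_measure R).
Local Open Scope ereal_scope.

Let w (x : measurableTypeR R) : \bar R := (Num.max x 0)%:E.

Let w0 x : 0 <= w x.
Proof. by rewrite lee_fin le_max lexx orbT. Qed.

Let mw : measurable_fun setT w.
Proof.
apply/measurable_EFinP; apply: continuous_measurable_fun => x.
exact: continuous_maxr0.
Qed.

(* [w] is x on ]0,+oo[ ; the truncation at 0 only serves to make it nonnegative. *)
Definition size_biased : set (measurableTypeR R) -> \bar R :=
  fun A => \int[mu]_(x in A) w x.

Let sb0 : size_biased set0 = 0. Proof. by rewrite /size_biased integral_set0. Qed.
Let sb_ge0 A : 0 <= size_biased A.
Proof. by apply: integral_ge0 => x _; exact: w0. Qed.
Let sb_sigma : semi_sigma_additive size_biased.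
Proof. exact: semi_sigma_additive_nng_induced. Qed.

HB.instance Definition _ := isMeasure.Build _ _ _ size_biased sb0 sb_ge0 sb_sigma.

Import HBNNSimple.

(** Standard extension from simple functions by monotone convergence; it holds for an arbitrary
    Borel measure [mu], sigma-finite or not. *)
Lemma ge0_integral_size_biased (f : R -> \bar R) (E : set (measurableTypeR R)) :
  (forall x, E x -> 0 <= f x) ->
  measurable E -> measurable_fun E f ->
  \int[size_biased]_(x in E) f x = \int[mu]_(x in E) (f x * (Num.max x 0)%:E).
Proof.
move=> f0 mE mf; pose h := nnsfun_approx mE mf; rewrite -[fun x => _ * _]/(f \* w).
have -> : \int[size_biased]_(x in E) f x =
    lim (\int[size_biased]_(x in E) (EFin \o h n) x @[n --> \oo]).
  have fE x : E x -> f x = lim ((EFin \o h n) x @[n --> \oo]).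
    by move=> Ex; apply/esym/cvg_lim => //; exact: cvg_nnsfun_approx.
  under eq_integral => x /[!inE] /fE -> //.
  apply: monotone_convergence => //.
  - move=> n; apply/measurable_EFinP.
    by apply: (measurable_funS measurableT) => //; exact/measurable_funP.
  - by move=> n x Ex //=; rewrite lee_fin.
  - by move=> x Ex a b ab; rewrite lee_fin; exact/lefP/nd_nnsfun_approx.
have -> : \int[mu]_(x in E) (f \* w) x =
    lim (\int[mu]_(x in E) ((EFin \o h n) \* w) x @[n --> \oo]).
  have fg x : E x -> f x * w x = lim (((EFin \o h n) \* w) x @[n --> \oo]).
    by move=> Ex; apply/esym/cvg_lim => //; apply: cvgeZr;
      [by []|exact: cvg_nnsfun_approx].
  under eq_integral => x /[!inE] /fg -> //.
  apply: monotone_convergence => [//| | |].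
  - move=> n; apply/emeasurable_funM; apply/measurable_funTS => //.
    exact/measurable_EFinP.
  - by move=> n x Ex /=; rewrite mule_ge0 ?lee_fin ?w0// le_max lexx orbT.
  - move=> x Ex a b ab/=; rewrite lee_wpmul2r// lee_fin.
    exact/lefP/nd_nnsfun_approx.
suff suf n : \int[mu]_(x in E) ((EFin \o h n) x * w x) =
    \int[size_biased]_(x in E) (EFin \o h n) x.
  by under [in RHS]eq_fun do rewrite suf.
transitivity (\int[size_biased]_(x in E)
   (\sum_(y \in range (h n)) (y * \1_(h n @^-1` [set y]) x)%:E)); last first.
  by apply: eq_integral => t tE; rewrite /= fimfunE -fsumEFin.
have indich m r : measurable_fun E (fun x => (r * \1_(h m @^-1` [set r]) x)%:E).
  by apply: (measurable_comp measurableT) => //; exact: measurable_funM.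
rewrite ge0_integral_fsum//; last by move=> m y Ey; exact: nnfun_muleindic_ge0.
transitivity (\int[mu]_(x in E) (\sum_(y \in range (h n))
    (y * \1_(h n @^-1` [set y]) x)%:E * w x)).
  under [RHS]eq_integral => x xE.
    rewrite -ge0_mule_fsuml => [|y]; last exact: nnfun_muleindic_ge0.
    rewrite fsumEFin // -(fimfunE _ x); over.
  by [].
rewrite ge0_integral_fsum//; last 2 first.
  - move=> y; apply: emeasurable_funM => //.
    exact: (measurable_funTS mw).
  - by move=> m y Ey; rewrite mule_ge0// nnfun_muleindic_ge0.
apply: eq_fsbigr => r rhn.
under [RHS]eq_integral do rewrite EFinM.
rewrite integralZl_indic_nnsfun => //.
under eq_integral do rewrite EFinM -muleA.
rewrite ge0_integralZl//.
- under eq_integral do rewrite muleC.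
  rewrite (eq_integral (w \_ (h n @^-1` [set r]))); last first.
    by move=> x xE; rewrite epatch_indic.
  by rewrite -integral_mkcondr integral_indic// setIC.
- apply: emeasurable_funM; first exact/measurable_EFinP.
  exact: measurable_funTS.
- by move=> t Et; rewrite mule_ge0 ?w0// lee_fin.
- by move: rhn; rewrite inE => -[t _ <-]; rewrite lee_fin.
Qed.

Lemma integral_size_biased (f : R -> R) (E : set (measurableTypeR R)) :
  measurable E -> measurable_fun E f -> E `<=` `]0%R, +oo[%classic ->
  \int[size_biased]_(x in E) (f x)%:E = \int[mu]_(x in E) (f x * x)%:E.
Proof.
move=> mE mf E0.
have P x : x \in E -> Num.max x 0%R = x.
  rewrite inE => /E0; rewrite /= in_itv/= andbT => x0; by rewrite max_l// ltW.
have P0 x : x \in E -> (0 <= x)%R.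
  by rewrite inE => /E0; rewrite /= in_itv/= andbT => /ltW.
rewrite integralE [RHS]integralE; congr (_ - _).
- rewrite ge0_integral_size_biased//; last first.
    by apply: measurable_funepos; exact/measurable_EFinP.
  apply: eq_integral => x xE; rewrite P// !funeposE -[0]/(0%R%:E) -!EFin_max -EFinM.
  by rewrite maxr_pMl ?P0// mul0r.
- rewrite ge0_integral_size_biased//; last first.
    by apply: measurable_funeneg; exact/measurable_EFinP.
  apply: eq_integral => x xE; rewrite P// !funenegE -!EFinN -[0]/(0%R%:E) -!EFin_max -EFinM.
  by rewrite maxr_pMl ?P0// mul0r mulNr.
Qed.

End size_biased.

(** * Bounded functions on a set of finite measure *)

Section finite_measure.
Context {R : realType} (nu : borel_measure R).
Variable D : set (measurableTypeR R).
Hypotheses (mD : measurable D) (fD : (nu D < +oo)%E).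

Lemma bounded_integrable (f : R -> R) (C : R) :
  measurable_fun D f -> (forall x, D x -> `|f x| <= C) ->
  nu.-integrable D (EFin \o f).
Proof.
move=> mf fC; apply: measurable_bounded_integrable => //.
exists C; split; first exact: num_real.
by move=> y Cy x Dx; exact: (le_trans (fC x Dx) (ltW Cy)).
Qed.

Lemma Rintegral_bounded_cvg (f_ : nat -> R -> R) (f : R -> R) (C : R) :
  (forall n, measurable_fun D (f_ n)) ->
  (forall n x, D x -> `|f_ n x| <= C) ->
  (forall x, D x -> f_ n x @[n --> \oo] --> f x) ->
  \int[nu]_(x in D) f_ n x @[n --> \oo] --> \int[nu]_(x in D) f x.
Proof.
move=> mf_ f_C f_f.
have mf : measurable_fun D f by apply: measurable_fun_cvg f_f.
have fC x : D x -> `|f x| <= C.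
  move=> Dx; have := f_f x Dx => /(cvg_norm) H.
  apply: (cvgr_to_le H).
  by apply: nearW => n; exact: f_C.
have := @dominated_convergence _ _ _ nu D mD (fun n x => (f_ n x)%:E)
  (fun x => (f x)%:E) (fun=> C%:E).
move=> [].
- by move=> n; apply/measurable_EFinP.
- by apply/measurable_EFinP.
- apply: aeW => x Dx; apply: cvg_EFin; first exact: nearW.
  exact: f_f.
- by apply: (@bounded_integrable (cst C) `|C|).
- by apply: aeW => x n Dx; rewrite lee_fin f_C.
move=> i _ H; apply: fine_cvg; rewrite fineK//.
exact: integrable_fin_num.
Qed.

End finite_measure.

(** * The generator of the size-biased evolution *)

Lemma le0_ler_powR (R : realType) (r x y : R) :
  r <= 0 -> 0 < x -> x <= y -> y `^ r <= x `^ r.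
Proof.
move=> r0 x0 xy; have y0 := lt_le_trans x0 xy.
have H : x `^ (- r) <= y `^ (- r).
  by apply: ge0_ler_powR; rewrite ?nnegrE ?oppr_ge0// ltW.
by rewrite -(opprK r) !(powRN _ (- r)) lef_pV2// posrE powR_gt0.
Qed.

(** The functions [g] for which [x * g x], cut off beyond 1, is a test function. Vanishing near 0
    tames x^alpha; nothing is imposed at infinity, as the solution does not charge ]1,+oo[. *)
Definition admissible (R : realType) (g : R -> R) : Prop :=
  C1pos g /\ exists2 d : R, 0 < d & forall x : R, 0 < x -> x <= d -> g x = 0.

Lemma C1pos_continuous (R : realType) (g : R -> R) (x : R) :
  C1pos g -> 0 < x -> {for x, continuous g}.
Proof. by move=> [g' hg] /hg[/is_derive_continuous]. Qed.

(** The derivative is bounded on [[d, b]] and [g] vanishes below [d]. A Lipschitz bound is what the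
    dislocation integral needs, as only [y * (1 - y)] is integrable against [B]. *)
Lemma admissible_lip (R : realType) (g : R -> R) (b : R) : admissible g ->
  exists2 C : R, 0 <= C & forall u v : R, 0 < u -> u <= v -> v <= b ->
    `|g v - g u| <= C * (v - u).
Proof.
move=> [Cg [d d0 gd]]; have [g' hg] := Cg.
have [bd|db] := leP b d.
  exists 0 => // u v u0 uv vb; rewrite !gd ?subrr ?normr0 ?mul0r//.
  - exact: le_trans (le_trans uv vb) bd.
  - exact: lt_le_trans uv.
  - exact: le_trans bd.
have [c /[!in_itv]/= /andP[dc cb] hc] : exists2 c, c \in `[d, b]%R &
    forall t, t \in `[d, b]%R -> `|g' t| <= `|g' c|.
  apply: (@EVT_max R (fun t => `|g' t|) d b (ltW db)).
  apply: continuous_in_subspaceT => x; rewrite inE/= in_itv/= => /andP[dx _].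
  have [_ c'] := hg x (lt_le_trans d0 dx).
  exact: cvg_norm.
exists `|g' c| => // u v u0 uv vb.
have M (p q : R) : d <= p -> p <= q -> q <= b -> `|g q - g p| <= `|g' c| * (q - p).
  move=> dp; rewrite le_eqVlt => /predU1P[->|pq qb].
    by rewrite !subrr normr0 mulr0.
  have [||x] := @MVT R g g' p q pq.
  - move=> x; rewrite in_itv/= => /andP[px _].
    by have [] := hg x (lt_trans (lt_le_trans d0 dp) px).
  - apply: derivable_within_continuous => x; rewrite in_itv/= => /andP[px _].
    by have [[]] := hg x (lt_le_trans (lt_le_trans d0 dp) px).
  rewrite in_itv/= => /andP[px xq] ->.
  have qp0 : 0 <= q - p by rewrite subr_ge0 ltW.
  rewrite normrM (ger0_norm qp0) ler_wpM2r// hc// in_itv/=.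
  by rewrite (le_trans dp (ltW px)) (le_trans (ltW xq) qb).
have [du|ud] := leP d u; first exact: M.
have [dv|vd] := leP d v.
  rewrite (gd u) ?(ltW ud)// -(gd d)//.
  apply: le_trans (M _ _ (lexx _) dv vb) _.
  by rewrite ler_wpM2l// lerD2l lerN2 ltW.
rewrite !gd ?subrr ?normr0 ?mulr_ge0 ?subr_ge0// ?ltW//.
exact: lt_le_trans uv.
Qed.

(** The fragmentation operator on [x * g x], divided by [x]: the generator of a tagged fragment,
    which jumps from x to yx at rate x^alpha y B(dy). *)
Definition frag_gen (R : realType) (alpha : R) (B : borel_measure R)
    (g : R -> R) (x : R) : R :=
  x `^ alpha * \int[B]_(y in `]0, 1[) ((g (y * x) - g x) * y).

Section generator.
Context {R : realType} (alpha : R) (B : borel_measure R).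
Hypothesis B_fin : (\int[B]_(y in `]0%R, 1%R[%classic) (y * (1 - y))%:E < +oo)%E.
Variable g : R -> R.
Hypothesis ag : admissible g.

Lemma integrable_dislocation :
  B.-integrable `]0%R, 1%R[%classic (EFin \o (fun y : R => y * (1 - y))).
Proof.
apply/integrableP; split.
  apply/measurable_EFinP; apply: measurable_funM => //.
  exact: measurable_funB.
apply: le_lt_trans B_fin; rewrite le_eqVlt; apply/orP; left; apply/eqP.
apply: eq_integral => x; rewrite inE/= in_itv/= => /andP[x0 x1].
by rewrite ger0_norm// mulr_ge0 ?ltW// subr_gt0.
Qed.

Lemma continuous_scaled (x y : R) : 0 < x -> 0 < y ->
  {for y, continuous (fun y : R => g (y * x))}.
Proof.
move=> x0 y0; apply: continuous_comp.
  by apply: cvgM; [exact: cvg_id|exact: cvg_cst].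
by apply: (C1pos_continuous (proj1 ag)); rewrite mulr_gt0.
Qed.

Lemma measurable_increment (x : R) : 0 < x ->
  measurable_fun (`]0%R, 1%R[%classic : set R) (fun y : R => (g (y * x) - g x) * y).
Proof.
move=> x0; apply: subspace_continuous_measurable_fun => //.
apply: continuous_in_subspaceT => y; rewrite inE/= in_itv/= => /andP[y0 _].
apply: cvgM; last exact: cvg_id.
apply: cvgB; last exact: cvg_cst.
exact: continuous_scaled.
Qed.

Lemma increment_le (b : R) : exists2 C : R, 0 <= C &
  forall x y : R, 0 < x -> x <= b -> 0 < y -> y < 1 ->
    `|(g (y * x) - g x) * y| <= C * x * (y * (1 - y)).
Proof.
have [C C0 hC] := admissible_lip b ag.
exists C => // x y x0 xb y0 y1.
have yx0 : 0 < y * x by rewrite mulr_gt0.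
have yxx : y * x <= x by rewrite ler_piMl// ltW.
have := hC _ _ yx0 yxx xb; rewrite normrM distrC (gtr0_norm y0) => h.
apply: le_trans (ler_wpM2r (ltW y0) h) _.
by rewrite le_eqVlt; apply/orP; left; apply/eqP; ring.
Qed.

Lemma integrable_increment (x : R) : 0 < x ->
  B.-integrable `]0%R, 1%R[%classic (EFin \o (fun y : R => (g (y * x) - g x) * y)).
Proof.
move=> x0; have [C C0 hC] := increment_le x.
have mI : measurable (`]0%R, 1%R[%classic : set (measurableTypeR R)) by [].
apply: (le_integrable mI _ _
  (integrableZl mI (C * x) integrable_dislocation)).
- by apply/measurable_EFinP; exact: measurable_increment.
- move=> y /=; rewrite in_itv/= => /andP[y0 y1].
  by rewrite lee_fin (le_trans (hC x y x0 (lexx _) y0 y1))// ler_norm.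
Qed.

Lemma continuous_increment_integral (x : R) : 0 < x ->
  {for x, continuous (fun x => \int[B]_(y in `]0, 1[) ((g (y * x) - g x) * y))}.
Proof.
move=> x0; have [C C0 hC] := increment_le (x + 1).
have := @continuity_under_integral R _ _ B (fun x y => (g (y * x) - g x) * y)
  `]0%R, 1%R[%classic _ 0 (x + 1) _ _ (fun y => C * (x + 1) * (y * (1 - y))) _ _.
apply => //.
- by move=> z /=; rewrite in_itv/= => /andP[z0 _]; exact: integrable_increment.
- apply: aeW => y /=; rewrite in_itv/= => /andP[y0 y1] z.
  rewrite inE/= in_itv/= => /andP[z0 _].
  apply: cvgM; last exact: cvg_cst.
  apply: cvgB; last exact: (C1pos_continuous (proj1 ag)).
  under eq_fun do rewrite mulrC.
  by rewrite mulrC; exact: continuous_scaled.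
- have := @integrableZl _ _ _ B _ _ (C * (x + 1)) _ integrable_dislocation.
  exact.
- move=> z /=; rewrite in_itv/= => /andP[z0 zx].
  apply: aeW => y /=; rewrite in_itv/= => /andP[y0 y1].
  apply: le_trans (hC z y z0 (ltW zx) y0 y1) _.
  have yy0 : 0 <= y * (1 - y) by rewrite mulr_ge0 ?subr_ge0 ?ltW.
  by rewrite ler_wpM2r// ler_wpM2l// ltW.
- by rewrite inE/= in_itv/= x0/= ltrDl.
Qed.

Lemma measurable_frag_gen :
  measurable_fun (`]0%R, +oo[%classic : set R) (frag_gen alpha B g).
Proof.
apply: subspace_continuous_measurable_fun => //.
apply: continuous_in_subspaceT => x; rewrite inE/= in_itv/= => /andP[x0 _].
by apply: cvgM; [exact: continuous_powR_pos|exact: continuous_increment_integral].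
Qed.

(** Below [d] all fragments yx stay where [g] vanishes; above it, x^alpha is at most d^alpha. *)
Lemma bounded_frag_gen : alpha <= 0 ->
  exists M : R, forall x : R, 0 < x -> x <= 1 -> `|frag_gen alpha B g x| <= M.
Proof.
move=> al0; have [C C0 hC] := increment_le 1.
have [d d0 gd] := proj2 ag.
pose K := \int[B]_(y in `]0, 1[) (y * (1 - y)).
have K0 : 0 <= K.
  apply: Rintegral_ge0 => y /=; rewrite in_itv/= => /andP[y0 y1].
  by rewrite mulr_ge0 ?subr_ge0 ?ltW.
exists (d `^ alpha * (C * K)) => x x0 x1; rewrite /frag_gen.
have [xd|dx] := leP x d.
  rewrite (_ : \int[B]_(y in _) _ = 0).
    by rewrite mulr0 normr0 !mulr_ge0 ?powR_ge0.
  rewrite (@eq_Rintegral _ _ _ B _ (fun=> 0)); first by rewrite Rintegral_cst ?mul0r.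
  move=> y; rewrite inE/= in_itv/= => /andP[y0 y1].
  have yxx : y * x <= x by rewrite ler_piMl// ltW.
  by rewrite !gd ?subrr ?mul0r ?mulr_gt0// (le_trans yxx).
rewrite normrM ger0_norm ?powR_ge0// ler_pM ?powR_ge0 ?normr_ge0//.
  by rewrite le0_ler_powR// ltW.
apply: le_trans (le_normr_Rintegral _ _) _ => //; first exact: integrable_increment.
rewrite -RintegralZl//; last exact: integrable_dislocation.
apply: le_Rintegral => //.
- by apply: integrable_norm; exact: integrable_increment.
- have := @integrableZl _ _ _ B _ _ C _ integrable_dislocation; exact.
- move=> y /=; rewrite in_itv/= => /andP[y0 y1].
  apply: le_trans (hC x y x0 x1 y0 y1) _.
  have yy0 : 0 <= y * (1 - y) by rewrite mulr_ge0 ?subr_ge0 ?ltW.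
  by rewrite ler_wpM2r// ler_piMr.
Qed.

End generator.

Lemma C1pos_derive1 (R : realType) (f : R -> R) (x : R) : C1pos f -> 0 < x ->
  derivable f x 1 /\ {for x, continuous (derive1 f)}.
Proof.
move=> [f' hf] x0; have [[dfx dfe] cf'] := hf x x0; split; first exact: dfx.
have E y : 0 < y -> derive1 f y = f' y.
  by move=> /hf[[_ <-] _]; rewrite derive1E.
rewrite /prop_for/continuous_at (E x x0); apply: cvg_trans cf'; apply: near_eq_cvg.
near=> y; rewrite E//; near: y; exact: lt_nbhsr.
Unshelve. all: by end_near. Qed.

Lemma integral_null_tail (R : realType) (b : R) (mu : borel_measure R) (f : R -> \bar R) :
  mu `]b, +oo[%classic = 0%E ->
  measurable_fun (`]0%R, +oo[%classic : set R) f ->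
  (\int[mu]_(x in `]0%R, +oo[%classic) f x = \int[mu]_(x in `]0%R, b]%classic) f x)%E.
Proof.
move=> mub mf.
have -> : `]0%R, b]%classic =
   (`]0%R, +oo[ `&` `]0%R, b] : set (measurableTypeR R))%classic.
  by apply/esym/setIidr => x /=; rewrite !in_itv/= andbT => /andP[].
rewrite integral_mkcondr; apply: ae_eq_integral => //.
  apply/measurable_restrict => //.
  by apply: measurable_funS mf => //; exact: subIsetl.
exists `]b, +oo[%classic; split => // x H.
rewrite /= in_itv/= andbT ltNge; apply/negP => xb; apply: H.
by rewrite /= in_itv/= andbT => x0; rewrite patchE mem_set//= in_itv/= x0.
Qed.

(** * The size-biased form of the equation *)

Section evolution.
Context {R : realType} (alpha : R) (B mu0 : borel_measure R)
  (mu : R -> borel_measure R).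
Hypothesis alpha_lt0 : alpha < 0.
Hypothesis B_fin : (\int[B]_(y in `]0%R, 1%R[%classic) (y * (1 - y))%:E < +oo)%E.
Hypothesis mu0_sup : is_sup_support mu0 1.
Hypothesis mu_sol : fragmentation_solution alpha B mu0 mu.

Let I01 : set (measurableTypeR R) := `]0%R, 1%R]%classic.

(** Condition (c) concerns closed half-lines and cannot be applied at M = 1, which [mu0] may charge;
    it is applied at M = 1 + 1/(n+1), followed by a countable union. *)
Lemma solution_gt1 (t : R) : 0 <= t -> mu t `]1%R, +oo[%classic = 0%E.
Proof.
move=> t0; have [_ _ _ _ H] := mu_sol.
have Hn (n : nat) : mu t `[1 + n.+1%:R^-1, +oo[%classic = 0%E.
  apply: H => //.
  apply/eqP; rewrite -measure_le0 -(proj1 mu0_sup); apply: le_measure;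
    rewrite ?inE//= => x /=; rewrite !in_itv/= !andbT.
  by apply: lt_le_trans; rewrite ltrDl.
have N : (mu t).-negligible (\bigcup_n `[1 + n.+1%:R^-1, +oo[%classic).
  apply: negligible_bigcup => n.
  have mI : measurable (`[1 + n.+1%:R^-1, +oo[%classic : set (measurableTypeR R)) by [].
  exact: (proj2 (negligibleP (mu t) mI) (Hn n)).
apply/negligibleP => //; apply: negligibleS N.
move=> x /=; rewrite in_itv/= andbT => x1.
have [n hn] := ltr_add_invr x1.
by exists n => //=; rewrite in_itv/= andbT ltW.
Qed.

Lemma total_mass_size_biased (nu : borel_measure R) :
  nu `]1%R, +oo[%classic = 0%E -> total_mass nu = size_biased nu I01.
Proof.
move=> nu1; have mi : measurable_fun (`]0%R, +oo[%classic : set R) (fun x : R => x%:E).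
  by apply/measurable_EFinP.
rewrite /total_mass (integral_null_tail nu1)//.
apply: eq_integral => x; rewrite inE/= in_itv/= => /andP[x0 _].
by rewrite max_l// ltW.
Qed.

Lemma size_biased_le1 (t : R) : 0 <= t -> (size_biased (mu t) I01 <= 1)%E.
Proof.
move=> t0; have [_ _ _ [<- H] _] := mu_sol.
by rewrite -total_mass_size_biased ?H//; exact: solution_gt1.
Qed.

Lemma Rintegral_pos_size_biased (t : R) (f g : R -> R) : 0 <= t ->
  measurable_fun (`]0%R, +oo[%classic : set R) g ->
  (forall x, 0 < x -> f x = g x * x) ->
  \int[mu t]_(x in `]0, +oo[) f x = \int[size_biased (mu t)]_(x in I01) g x.
Proof.
move=> t0 mg fg; rewrite /Rintegral; congr fine.
have sI : I01 `<=` `]0%R, +oo[%classic.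
  by move=> x; rewrite /I01/= !in_itv/= andbT => /andP[].
have mgI : measurable_fun I01 g by apply: measurable_funS mg.
have mgx : measurable_fun (`]0%R, +oo[%classic : set R) (fun x => (g x * x)%:E).
  by apply/measurable_EFinP; apply: measurable_funM.
transitivity (\int[mu t]_(x in `]0%R, +oo[%classic) (g x * x)%:E)%E.
  by apply: eq_integral => x; rewrite inE/= in_itv/= andbT => /fg ->.
rewrite (integral_null_tail (solution_gt1 t0) mgx).
by rewrite integral_size_biased//; exact: measurable_itv.
Qed.

(* [g x * x] is not compactly supported, but [mu t] does not charge ]1,+oo[, so
   that [g] can be cut off between 1 and 2. *)
Theorem solution_rderiv (g : R -> R) : admissible g ->
  has_rderiv (fun t => \int[size_biased (mu t)]_(x in I01) g x)
             (fun t => \int[size_biased (mu t)]_(x in I01) frag_gen alpha B g x).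
Proof.
move=> [Cg [d d0 gd]].
pose h x := g x * smooth_step (-1 * x + 2).
have Ch : C1pos h by apply: C1posM => //; exact: C1pos_step.
have ah : admissible h.
  by split => //; exists d => // x x0 xd; rewrite /h gd// mul0r.
have hg x : x <= 1 -> h x = g x.
  by move=> x1; rewrite /h step_eq1 ?mulr1//; lra.
pose f x := h x * x.
have Cf : C1pos f.
  by apply: C1posM => //; apply: (eq_C1pos _ (C1pos_affine 1 0)) => x; lra.
have tf : test_function f.
  split; [|move=> x x0..|].
  - by move=> x x0; have [] := C1pos_derive1 Cf x0.
  - by have [] := C1pos_derive1 Cf x0.
  exists `[d, 2]%classic; split.
  - exact: segment_compact.
  - move=> x /=; rewrite !in_itv/= andbT => /andP[dx _].
    exact: lt_le_trans dx.
  - move=> x x0; rewrite /f /h /= => /negP.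
    rewrite in_itv/= negb_and -!ltNge => /orP[xd|x2].
      by rewrite gd ?mul0r// ltW.
    by rewrite step_eq0 ?mulr0 ?mul0r//; lra.
have opf x : 0 < x -> fragmentation_operator alpha B f x = frag_gen alpha B h x * x.
  move=> x0; rewrite /fragmentation_operator /frag_gen -mulrA; congr (_ * _).
  rewrite mulrC -RintegralZl//; last exact: integrable_increment.
  by apply: eq_Rintegral => y _; rewrite /f; ring.
have mh : measurable_fun (`]0%R, +oo[%classic : set R) h.
  apply: subspace_continuous_measurable_fun => //.
  apply: continuous_in_subspaceT => x; rewrite inE/= in_itv/= andbT => x0.
  exact: C1pos_continuous.
have [_ _ H _ _] := mu_sol.
have hE s : 0 <= s -> \int[mu s]_(x in `]0, +oo[) f x =
    \int[size_biased (mu s)]_(x in I01) g x.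
  move=> s0; rewrite (Rintegral_pos_size_biased s0 mh)//.
  by apply: eq_Rintegral => x; rewrite inE /I01/= in_itv/= => /andP[_ /hg].
have genE s : 0 <= s ->
    \int[mu s]_(x in `]0, +oo[) fragmentation_operator alpha B f x =
    \int[size_biased (mu s)]_(x in I01) frag_gen alpha B g x.
  move=> s0; rewrite (Rintegral_pos_size_biased s0 (measurable_frag_gen alpha B_fin ah)); last by [].
  apply: eq_Rintegral => x; rewrite inE /I01/= in_itv/= => /andP[x0 x1].
  rewrite /frag_gen; congr (_ * _); apply: eq_Rintegral => y.
  rewrite inE/= in_itv/= => /andP[y0 y1]; rewrite !hg//.
  by rewrite (le_trans _ x1)// ler_piMl// ltW.
move=> t t0; have := H f tf t t0; rewrite genE//; apply: cvg_trans.
apply: near_eq_cvg; rewrite /within/= near_withinE; near=> s => s0.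
by rewrite !hE.
Unshelve. all: by end_near. Qed.

End evolution.

(** * The atom at 1 *)

Lemma is_derive_expR_scale (R : realType) (k c x : R) :
  is_derive x (1 : R) (fun x => k * expR (c * x)) (k * (c * expR (c * x))).
Proof.
have h1 : is_derive x (1 : R) (fun x : R => c * x + 0) c by exact: is_derive_affine.
have h2 := @is_derive1_comp R expR (fun x : R => c * x + 0) x _ _
  (is_derive_expR (c * x + 0)) h1.
have h3 : is_derive x (1 : R) (fun x => expR (c * x)) (c * expR (c * x)).
  have -> : (fun x => expR (c * x)) = expR \o (fun x : R => c * x + 0).
    by apply/funext => y /=; rewrite addr0.
  by apply: (is_derive_eq h2); rewrite addr0 mulrC.
exact: (is_deriveZ k h3).
Qed.

Lemma gronwall_le (R : realType) (u u' : R -> R) (c : R) : has_rderiv u u' ->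
  (forall t, 0 <= t -> u' t <= c * u t) ->
  forall t, 0 <= t -> u t <= u 0 * expR (c * t).
Proof.
move=> hu H t t0.
(* The factor carries the sign -1, as [has_rderiv_mono] produces nondecreasing quantities: it is
   applied to -u(t) exp(-ct). *)
have := @has_rderiv_mono R u u' _ _ (cst 0) (cst 0) 0 t hu
  (is_derive_expR_scale (-1) (- c)) (fun x => is_derive_cst (0:R) x 1) (lexx _) t0.
rewrite /= !mulr0 expR0 !mulN1r !addr0 mulrN1 mulrN lerN2.
move=> h; rewrite -ler_pdivrMr ?expR_gt0// -expRN -mulNr; apply: h => x x0 _.
have := H x (ltW x0); have := expR_gt0 (- c * x); move: (expR _) => E E0 h.
by rewrite addr0; nra.
Qed.

Lemma gronwall_ge (R : realType) (u u' : R -> R) (c : R) : has_rderiv u u' ->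
  (forall t, 0 <= t -> c * u t <= u' t) ->
  forall t, 0 <= t -> u 0 * expR (c * t) <= u t.
Proof.
move=> hu H t t0.
have := @has_rderiv_mono R u u' _ _ (cst 0) (cst 0) 0 t hu
  (is_derive_expR_scale 1 (- c)) (fun x => is_derive_cst (0:R) x 1) (lexx _) t0.
rewrite /= !mulr0 expR0 !mul1r !addr0 mulr1.
move=> h; rewrite -ler_pdivlMr ?expR_gt0// -expRN -mulNr; apply: h => x x0 _.
have := H x (ltW x0); have := expR_gt0 (- c * x); move: (expR _) => E E0 h.
by rewrite addr0 mul1r; nra.
Qed.

Lemma admissible_bounded (R : realType) (g : R -> R) : admissible g ->
  exists M : R, forall x, 0 < x -> x <= 1 -> `|g x| <= M.
Proof.
move=> ag; have [d d0 gd] := proj2 ag; have [C C0 hC] := admissible_lip 1 ag.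
exists C => x x0 x1; have [xd|dx] := leP x d.
  by rewrite gd// normr0.
have := hC d x d0 (ltW dx) x1; rewrite (gd d)// subr0 => /le_trans; apply.
by rewrite ler_piMr//; lra.
Qed.

Lemma admissible_step (R : realType) (b c : R) : 0 < b -> c < 0 ->
  admissible (fun x : R => smooth_step (b * x + c)).
Proof.
move=> b0 c0; split; first exact: C1pos_step.
exists (- c / b); first by rewrite divr_gt0 ?oppr_gt0.
move=> x _ xd; apply: step_eq0.
by move: xd; rewrite ler_pdivlMr// mulrC; lra.
Qed.

(** What the sections below use of the solution: a mass at most 1 on ]0,1] and the weak equation. *)
Definition evolves (R : realType) (alpha : R) (B : borel_measure R)
    (sigma : R -> borel_measure R) : Prop :=
  (forall t : R, 0 <= t -> (sigma t `]0%R, 1%R]%classic <= 1)%E) /\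
  (forall g : R -> R, admissible g ->
    has_rderiv (fun t => \int[sigma t]_(x in `]0, 1]) g x)
               (fun t => \int[sigma t]_(x in `]0, 1]) frag_gen alpha B g x)).

Section atom.
Context {R : realType} (alpha : R) (B : borel_measure R)
  (sigma : R -> borel_measure R).
Hypothesis alpha_lt0 : alpha < 0.
Hypothesis B_fin : (\int[B]_(y in `]0%R, 1%R[%classic) (y * (1 - y))%:E < +oo)%E.
Hypothesis ev : evolves alpha B sigma.

Lemma mI01 : measurable (`]0%R, 1%R]%classic : set (measurableTypeR R)).
Proof. exact: measurable_itv. Qed.

Lemma evolves_lty (t : R) : 0 <= t -> (sigma t `]0%R, 1%R]%classic < +oo)%E.
Proof. by move=> t0; apply: le_lt_trans (proj1 ev t t0) _; rewrite ltry. Qed.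

Lemma measurable_admissible (g : R -> R) : admissible g ->
  measurable_fun (`]0%R, 1%R]%classic : set R) g.
Proof.
move=> ag; apply: subspace_continuous_measurable_fun => //.
apply: continuous_in_subspaceT => x; rewrite inE/= in_itv/= => /andP[x0 _].
by apply: C1pos_continuous x0; exact: (proj1 ag).
Qed.

Lemma integrable_admissible (t : R) (g : R -> R) : 0 <= t -> admissible g ->
  (sigma t).-integrable `]0%R, 1%R]%classic (EFin \o g).
Proof.
move=> t0 ag; have [M hM] := admissible_bounded ag.
apply: (bounded_integrable mI01 (evolves_lty t0) (measurable_admissible ag) (C:=M)).
by move=> x; rewrite /= in_itv/= => /andP[/hM].
Qed.

Lemma integrable_frag_gen (t : R) (g : R -> R) : 0 <= t -> admissible g ->
  (sigma t).-integrable `]0%R, 1%R]%classic (EFin \o frag_gen alpha B g).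
Proof.
move=> t0 ag; have [M hM] := bounded_frag_gen B_fin ag (ltW alpha_lt0).
apply: (bounded_integrable mI01 (evolves_lty t0) (C:=M)).
  apply: measurable_funS (measurable_frag_gen alpha B_fin ag) => //.
  by move=> x; rewrite /= !in_itv/= andbT => /andP[].
by move=> x; rewrite /= in_itv/= => /andP[/hM].
Qed.

(** Ramps from 0 at 1 - 1/(n+2) up to 1 at the point 1; with n+2 instead of n+1, the foot of the
    ramp is positive for every n, as admissibility demands. *)
Let gn (n : nat) (x : R) := smooth_step (n.+2%:R * x + (1 - n.+2%:R)).

Let agn n : admissible (gn n).
Proof. by apply: admissible_step; rewrite ?subr_lt0 ?ltr1n. Qed.

Let gn_mono n x y : x <= y -> gn n x <= gn n y.
Proof. by move=> xy; apply: step_le; rewrite lerD2r ler_wpM2l. Qed.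

Let gn0 n x : x <= 1 - n.+2%:R^-1 -> gn n x = 0.
Proof.
move=> xn; apply: step_eq0.
have : n.+2%:R * x <= n.+2%:R * (1 - n.+2%:R^-1) by rewrite ler_wpM2l.
by rewrite mulrBr mulfV// mulr1; lra.
Qed.

Let s t := fine (sigma t [set 1]).

Let gn_cvg t : 0 <= t ->
  \int[sigma t]_(x in `]0, 1]) gn n x @[n --> \oo] --> s t.
Proof.
move=> t0.
have -> : s t = \int[sigma t]_(x in `]0, 1]) (\1_[set 1] x : R).
  have m1 : measurable ([set 1] : set (measurableTypeR R)) by [].
  rewrite /s /Rintegral (integral_indic (sigma t) mI01 m1).
  congr (fine (sigma t _)); apply/esym/setIidl => x ->.
  by rewrite /= in_itv/= ltr01 lexx.
apply: (Rintegral_bounded_cvg mI01 (evolves_lty t0) (C:=1)).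
- by move=> n; exact: measurable_admissible.
- by move=> n x _; rewrite ger0_norm ?step_ge0 ?step_le1.
move=> x; rewrite /= in_itv/= => /andP[x0]; rewrite le_eqVlt => /predU1P[->|x1].
  rewrite indicE mem_set//= ; apply: cvg_near_cst; apply: nearW => n.
  by rewrite /gn step_eq1//; lra.
rewrite indicE memNset/=; last by move=> x1E; rewrite x1E ltxx in x1.
apply: cvg_near_cst; have [k hk] := ltr_add_invr x1.
exists k => // n /= kn; apply: gn0.
have : (n.+2%:R : R)^-1 <= k.+1%:R^-1 by rewrite lef_pV2 ?posrE// ler_nat ltnW// ltnS ltnS.
by move=> h; rewrite lerBrDr (le_trans _ (ltW hk))// lerD2l.
Qed.

Lemma integrable_restricted_id (e : R) : 0 < e ->
  B.-integrable `]0%R, (1 - e)%R]%classic (EFin \o (fun y : R => y)).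
Proof.
move=> e0.
have mE : measurable (`]0%R, (1 - e)%R]%classic : set (measurableTypeR R)).
  exact: measurable_itv.
have i1 : B.-integrable `]0%R, (1 - e)%R]%classic (EFin \o (fun y : R => y * (1 - y))).
  apply: integrableS (integrable_dislocation B_fin) => //.
  by move=> x; rewrite /= !in_itv/= => /andP[-> /=]; lra.
apply: (le_integrable mE _ _ (integrableZl mE e^-1 i1)).
  by apply/measurable_EFinP.
move=> x; rewrite /= in_itv/= => /andP[x0 xe]; rewrite lee_fin.
rewrite gtr0_norm// ger0_norm ?mulr_ge0 ?invr_ge0//; try by lra.
by rewrite -ler_pdivrMl ?invr_gt0// invrK mulrC ler_wpM2l//; lra.
Qed.

(** Once 1/(n+2) <= e, a fragment yx with y <= 1 - e falls where [gn n] vanishes: mass is lost at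
    least at the rate of the truncated integral, which is finite even if phi(oo) is not. The factor
    x^alpha >= 1 only speeds up the loss. *)
Let atom_le (e t : R) : 0 < e -> e < 1 -> 0 <= t ->
  s t <= s 0 * expR (- (\int[B]_(y in `]0, (1 - e)]) y) * t).
Proof.
move=> e0 e1 t0; set f := \int[B]_(y in _) _.
have f0 : 0 <= f.
  by apply: Rintegral_ge0 => y /=; rewrite in_itv/= => /andP[/ltW].
have key n : n.+2%:R^-1 <= e ->
   \int[sigma t]_(x in `]0, 1]) gn n x <=
   \int[sigma 0]_(x in `]0, 1]) gn n x * expR (- f * t).
  move=> ne; apply: (gronwall_le (proj2 ev _ (agn n))) => // {}t {}t0.
  rewrite -RintegralZl; [|exact: mI01|exact: integrable_admissible].
  apply: le_Rintegral.
  - exact: mI01.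
  - exact: integrable_frag_gen.
  - exact: (integrableZl mI01 (- f) (integrable_admissible t0 (agn n))).
  move=> x /=; rewrite in_itv/= => /andP[x0 x1]; rewrite /frag_gen.
  have g0 : 0 <= gn n x by exact: step_ge0.
  set J := \int[B]_(y in _) _.
  have HJ : J <= - f * gn n x.
    have mE : measurable (`]0%R, (1 - e)%R]%classic : set (measurableTypeR R)).
      exact: measurable_itv.
    have mO : measurable (`]0%R, 1%R[%classic : set (measurableTypeR R)).
      exact: measurable_itv.
    have sEO : `]0%R, (1 - e)%R]%classic `<=` (`]0%R, 1%R[%classic : set R).
      by move=> z; rewrite /= !in_itv/= => /andP[-> /=]; lra.
    have ie := integrable_restricted_id e0.
    rewrite mulNr mulrC -mulNr -RintegralZl//.
    rewrite -(setIidr sEO) Rintegral_mkcondr.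
    apply: le_Rintegral => //.
    - exact: integrable_increment.
    - rewrite -restrict_EFin; apply/integrable_restrict => //.
      by rewrite (setIidr sEO); exact: (integrableZl mE (- gn n x) ie).
    move=> y /=; rewrite in_itv/= => /andP[y0 y1].
    have yxx : y * x <= x by rewrite ler_piMl// ltW.
    rewrite patchE; case: ifPn => [|_].
      rewrite inE/= in_itv/= => /andP[_ ye].
      have yxn : y * x <= 1 - n.+2%:R^-1.
        apply: le_trans (ler_piMr (ltW y0) x1) _; apply: le_trans ye _.
        by rewrite lerD2l lerN2.
      by rewrite (gn0 yxn) sub0r.
    by rewrite mulr_le0_ge0 ?(ltW y0)// subr_le0 gn_mono.
  have xa1 : 1 <= x `^ alpha.
    by have := le0_ler_powR (ltW alpha_lt0) x0 x1; rewrite powR1.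
  have J0 : J <= 0 by apply: le_trans HJ _; rewrite mulNr oppr_le0 mulr_ge0.
  by apply: le_trans HJ; nra.
have H0 := gn_cvg t0.
have H1 : \int[sigma 0]_(x in `]0, 1]) gn n x * expR (- f * t) @[n --> \oo] -->
    s 0 * expR (- f * t).
  by apply: cvgM; [exact: gn_cvg|exact: cvg_cst].
apply: (ler_cvg_to H0 H1).
have [k _ hk] := near_infty_natSinv_lt (PosNum e0).
exists k => // n /= kn; apply: key; apply/ltW/(le_lt_trans _ (hk n kn)).
by rewrite lef_pV2 ?posrE// ler_nat.
Qed.

Lemma integrable_id_dislocation : (frag_phi_infty B < +oo)%E ->
  B.-integrable `]0%R, 1%R[%classic (EFin \o (fun y : R => y)).
Proof.
move=> hB; apply/integrableP; split; first exact/measurable_EFinP.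
apply: le_lt_trans hB; rewrite le_eqVlt; apply/orP; left; apply/eqP.
by apply: eq_integral => x; rewrite inE/= in_itv/= => /andP[x0 _]; rewrite gtr0_norm.
Qed.

Let phi := fine (frag_phi_infty B).

(** The gain [g (y * x)] is dropped and only the loss is kept. *)
Lemma increment_integral_ge (g : R -> R) (x : R) :
  (frag_phi_infty B < +oo)%E -> admissible g -> (forall x, 0 < x -> 0 <= g x) -> 0 < x ->
  - phi * g x <= \int[B]_(y in `]0, 1[) ((g (y * x) - g x) * y).
Proof.
move=> hB ag g0 x0; have mO : measurable (`]0%R, 1%R[%classic : set (measurableTypeR R)).
  exact: measurable_itv.
have ii := integrable_id_dislocation hB.
rewrite mulNr mulrC -mulNr /phi -[fine _]/(\int[B]_(y in `]0, 1[) y) -RintegralZl//.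
apply: le_Rintegral => //.
- exact: (integrableZl mO (- g x) ii).
- exact: integrable_increment.
move=> y /=; rewrite in_itv/= => /andP[y0 y1].
by rewrite ler_wpM2r ?(ltW y0)// -[X in X <= _]add0r lerD2r g0 ?mulr_gt0.
Qed.

(** Where [gn n] is nonzero, x > 1 - 1/(n+2), so that x^alpha is at most [z n]: the loss rate is at
    most [phi * z n], and [z n] tends to 1. *)
Let atom_ge (t : R) : (frag_phi_infty B < +oo)%E -> 0 <= t ->
  s 0 * expR (- phi * t) <= s t.
Proof.
move=> hB t0.
have phi0 : 0 <= phi.
  by apply: Rintegral_ge0 => y /=; rewrite in_itv/= => /andP[/ltW].
pose z n : R := (1 - n.+2%:R^-1) `^ alpha.
have key n : \int[sigma 0]_(x in `]0, 1]) gn n x * expR (- phi * z n * t) <=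
   \int[sigma t]_(x in `]0, 1]) gn n x.
  apply: (gronwall_ge (proj2 ev _ (agn n))) => // {}t {}t0.
  rewrite -RintegralZl; [|exact: mI01|exact: integrable_admissible].
  apply: le_Rintegral.
  - exact: mI01.
  - exact: (integrableZl mI01 (- phi * z n) (integrable_admissible t0 (agn n))).
  - exact: integrable_frag_gen.
  move=> x /=; rewrite in_itv/= => /andP[x0 x1]; rewrite /frag_gen.
  have g0 : 0 <= gn n x by exact: step_ge0.
  have [xz|zx] := leP x (1 - n.+2%:R^-1).
    rewrite gn0// mulr0 (@eq_Rintegral _ _ _ B _ (fun=> 0)).
      by rewrite Rintegral_cst// mul0r mulr0.
    move=> y; rewrite inE/= in_itv/= => /andP[y0 y1].
    have yxx : y * x <= x by rewrite ler_piMl// ltW.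
    by rewrite gn0 ?subrr ?mul0r// (le_trans yxx).
  have z0 : 0 < 1 - (n.+2%:R : R)^-1 by rewrite subr_gt0 invf_lt1// ltr1n.
  have xz : x `^ alpha <= z n by apply: le0_ler_powR; rewrite ?ltW.
  have := increment_integral_ge hB (agn n) (fun x _ => step_ge0 _) x0.
  have xa := powR_ge0 x alpha.
  set J := \int[B]_(y in _) _ => HJ.
  apply: (@le_trans _ _ (x `^ alpha * (- phi * gn n x))); last exact: ler_wpM2l.
  have : x `^ alpha * (phi * gn n x) <= z n * (phi * gn n x).
    by rewrite ler_wpM2r// mulr_ge0.
  by lra.
have z1 : z n @[n --> \oo] --> (1:R).
  rewrite -[X in _ --> X](_ : (1 - 0) `^ alpha = 1); last by rewrite subr0 powR1.
  apply: (@cvg_comp _ _ _ (fun n => 1 - n.+2%:R^-1) (fun x => x `^ alpha) _ (nbhs (1 - 0 : R))).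
    apply: cvgB; first exact: cvg_cst.
    by have := @cvg_harmonic R; rewrite -(cvg_shiftn 1)/=; under eq_fun do rewrite addn1.
  by apply: continuous_powR_pos; rewrite subr0.
have H1 : \int[sigma 0]_(x in `]0, 1]) gn n x * expR (- phi * z n * t) @[n --> \oo] -->
    s 0 * expR (- phi * 1 * t).
  apply: cvgM; first exact: gn_cvg.
  apply: (@continuous_cvg _ _ _ _ _ _ (fun x : R => expR (- phi * x * t))) z1.
  apply: continuous_comp; last exact: continuous_expR.
  by apply: cvgM; [apply: cvgM; [exact: cvg_cst|exact: cvg_id]|exact: cvg_cst].
rewrite -[- phi]mulr1.
by apply: (ler_cvg_to H1 (gn_cvg t0)); apply: nearW.
Qed.

Lemma atom_fin_num (t : R) : 0 <= t -> sigma t [set 1] \is a fin_num.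
Proof.
move=> t0; rewrite ge0_fin_numE//; apply: le_lt_trans (evolves_lty t0).
apply: le_measure; rewrite ?inE//.
by move=> x ->; rewrite /= in_itv/= ltr01 lexx.
Qed.

Theorem atom_evolution (t : R) : 0 <= t ->
  sigma t [set 1] = (expeR (- (t%:E * frag_phi_infty B)) * sigma 0 [set 1%R])%E.
Proof.
move=> t0; have fp : (0 <= frag_phi_infty B)%E.
  apply: integral_ge0 => x; rewrite /= in_itv/= => /andP[x0 _].
  by rewrite lee_fin ltW.
(* Truncated rates, finite by [integrable_restricted_id] and increasing to phi(oo), be it finite or
   not. *)
pose f n := \int[B]_(y in `]0, (1 - n.+2%:R^-1)]) y.
have ub n : s t <= s 0 * expR (- f n * t).
  by apply: atom_le => //; rewrite invf_lt1// ltr1n.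
have fcvg : (f n)%:E @[n --> \oo] --> frag_phi_infty B.
  have := @ge0_nondecreasing_set_cvg_integral _ _ R
    (fun n : nat => `]0%R, (1 - n.+2%:R^-1)%R]%classic : set (measurableTypeR R))
    (fun y => y%:E) B.
  have U : \bigcup_n `]0, (1 - n.+2%:R^-1)]%classic = `]0, 1[%classic :> set R.
    apply/seteqP; split => x /=.
      move=> [n _] /=; rewrite !in_itv/= => /andP[-> /=] /le_lt_trans; apply.
      by rewrite ltrBlDr ltrDl.
    rewrite in_itv/= => /andP[x0 x1]; have [k hk] := ltr_add_invr x1.
    exists k => //=; rewrite in_itv/= x0/=.
    have : (k.+2%:R : R)^-1 <= k.+1%:R^-1 by rewrite lef_pV2 ?posrE// ler_nat.
    by move=> h; rewrite lerBrDr (le_trans _ (ltW hk))// lerD2l.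
  rewrite U => H; have {}H := H _ _ _ _.
  apply: cvg_trans (H _ _ _ _).
  - apply: near_eq_cvg; apply: nearW => n; rewrite /f /Rintegral fineK//.
    apply: integrable_fin_num => //; exact: integrable_restricted_id.
  - move=> m n mn; apply/subsetPset => x /=; rewrite !in_itv/= => /andP[-> /=].
    move=> /le_trans; apply; rewrite lerD2l lerN2 lef_pV2 ?posrE// ler_nat.
    by rewrite !ltnS.
  - by move=> n; exact: measurable_itv.
  - by move=> n; apply/measurable_EFinP.
  - by move=> n x; rewrite /= in_itv/= => /andP[x0 _]; rewrite lee_fin ltW.
rewrite -(fineK (atom_fin_num t0)) -/(s t) -(fineK (atom_fin_num (lexx 0))) -/(s 0).
have [hB|] := ltP (frag_phi_infty B) +oo%E.
  have fn : frag_phi_infty B \is a fin_num by rewrite ge0_fin_numE.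
  rewrite -(fineK fn) -/phi -EFinM /= mulrC -[t * _]mulrC -mulNr.
  congr (_%:E); apply/eqP; rewrite eq_le atom_ge// andbT.
  have fc : f n @[n --> \oo] --> phi.
    by apply: (@fine_cvg _ _ _ _ (fun n => (f n)%:E)); rewrite fineK.
  apply: (cvgr_to_ge (_ : s 0 * expR (- f n * t) @[n --> \oo] --> _)); last first.
    by apply: nearW => n; exact: ub.
  apply: cvgM; first exact: cvg_cst.
  apply: (@continuous_cvg _ _ _ _ _ _ (fun x : R => expR (- x * t))) fc.
  apply: continuous_comp; last exact: continuous_expR.
  by apply: cvgM; [apply: cvgN; exact: cvg_id|exact: cvg_cst].
(* Infinite phi(oo): at t = 0 the convention 0 * oo = 0 makes the exponential 1, and for t > 0 the
   truncated upper bounds alone force the atom to vanish. *)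
rewrite leye_eq => /eqP phioo; rewrite phioo in fcvg *.
have s0 : 0 <= s 0 by rewrite fine_ge0.
move: t0; rewrite le_eqVlt => /predU1P[<-|t0].
  by rewrite mul0e oppe0 /= expR0 mul1e.
rewrite gt0_muley ?lte_fin//= mul0e; congr (_%:E).
have st0 : 0 <= s t by rewrite fine_ge0.
apply/eqP; rewrite eq_le st0 andbT.
have fc : f n @[n --> \oo] --> +oo by apply/cvgeryP.
apply: (cvgr_to_ge (_ : s 0 * expR (- (f n * t)) @[n --> \oo] --> _)); last first.
  by apply: nearW => n; rewrite -mulNr; exact: ub.
rewrite -[X in _ --> X](mulr0 (s 0)); apply: cvgM; first exact: cvg_cst.
apply: (@cvg_comp _ _ _ (fun n => f n * t) (fun x => expR (- x)) _ +oo).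
  apply/cvgryPge => A; move/cvgryPge : fc => /(_ (A / t)).
  by apply: filterS => n; rewrite ler_pdivrMr.
exact: cvgr_expR.
Qed.

End atom.

(** * Laplace integrals *)

Lemma Rintegral_dominated_cvg d (T : measurableType d) (R : realType)
    (nu : {measure set T -> \bar R}) (D : set T)
    (f_ : nat -> T -> R) (f g : T -> R) :
  measurable D ->
  (forall n, measurable_fun D (f_ n)) -> measurable_fun D f ->
  {ae nu, forall x, D x -> f_ n x @[n --> \oo] --> f x} ->
  nu.-integrable D (EFin \o g) ->
  (forall n x, D x -> `|f_ n x| <= g x) ->
  \int[nu]_(x in D) f_ n x @[n --> \oo] --> \int[nu]_(x in D) f x.
Proof.
move=> mD mf_ mf f_f ig fg.
have := @dominated_convergence _ _ _ nu D mD (fun n x => (f_ n x)%:E)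
  (fun x => (f x)%:E) (EFin \o g).
move=> [].
- by move=> n; apply/measurable_EFinP.
- by apply/measurable_EFinP.
- apply: filterS f_f => x h Dx; apply: cvg_EFin; first exact: nearW.
  exact: h.
- exact: ig.
- by apply: aeW => x n Dx; rewrite lee_fin fg.
move=> i _ H; apply: fine_cvg; rewrite fineK//.
exact: integrable_fin_num.
Qed.

Lemma is_derive_quadratic (R : realType) (f : R -> R) (x l r C : R) : 0 < r -> 0 <= C ->
  (forall h, `|h| < r -> `|f (h + x) - f x - l * h| <= C * h ^+ 2) ->
  is_derive x 1 f l.
Proof.
move=> r0 C0 B.
have H : h^-1 *: (f (h *: (1:R) + x) - f x) @[h --> 0^'] --> l.
  apply/cvgrPdist_le => e e0.
  have eC : 0 < e / (C + 1) by rewrite divr_gt0// ltr_wpDl.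
  near=> h.
  have h0 : h != 0 by near: h; exact: nbhs_dnbhs_neq.
  rewrite /GRing.scale/= mulr1 distrC.
  have -> : h^-1 * (f (h + x) - f x) - l = h^-1 * (f (h + x) - f x - l * h).
    by rewrite [in RHS]mulrBr [X in _ = _ - X]mulrC mulfK.
  have hr : `|h| < r by near: h; exact: dnbhs0_lt.
  rewrite normrM normfV ler_pdivrMl ?normr_gt0//; apply: le_trans (B h hr) _.
  rewrite -real_normK ?num_real// expr2 mulrA [_ * e]mulrC ler_wpM2r//.
  have : `|h| <= e / (C + 1) by near: h; exact: dnbhs0_le.
  rewrite ler_pdivlMr ?ltr_wpDl//.
  by have := normr_ge0 h; nra.
split; first by apply/cvg_ex; exists l.
by apply/cvg_lim => //.
Unshelve. all: by end_near. Qed.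

Section exponential_weights.
Context {R : realType}.
Local Notation leb := (@lebesgue_measure R).

Definition J0y : set (measurableTypeR R) := `[0%R, +oo[%classic.

Lemma mJ0y : measurable J0y. Proof. exact: measurable_itv. Qed.

Lemma J0yP (x : R) : J0y x <-> 0 <= x.
Proof. by rewrite /J0y /= in_itv/= andbT. Qed.

Definition expw (i : nat) (l s : R) : R := s ^+ i * expR (- l * s).

Lemma is_derive_exp_scale (l x : R) :
  is_derive x (1 : R) (fun s => expR (- l * s)) (- l * expR (- l * x)).
Proof.
have := is_derive_expR_scale 1 (- l) x; rewrite mul1r.
by under eq_fun do rewrite mul1r.
Qed.

Lemma continuous_expw i l : continuous (expw i l).
Proof.
move=> x; apply: cvgM; first exact: exprn_continuous.
exact: (is_derive_continuous (is_derive_exp_scale l x)).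
Qed.

Lemma measurable_continuous (f : R -> R) : continuous f -> measurable_fun J0y f.
Proof.
move=> cf; apply: subspace_continuous_measurable_fun; first exact: mJ0y.
exact: continuous_subspaceT.
Qed.

Lemma expw_ge0 i l x : J0y x -> 0 <= expw i l x.
Proof. by move=> /J0yP x0; rewrite mulr_ge0 ?exprn_ge0 ?expR_ge0. Qed.

Lemma expr_le_expR i (c x : R) : 0 < c -> 0 <= x ->
  x ^+ i <= i`!%:R / c ^+ i * expR (c * x).
Proof.
move=> c0 x0; have cx0 : 0 <= c * x by rewrite mulr_ge0// ltW.
have H : (c * x) ^+ i <= i`!%:R * expR (c * x).
  rewrite [X in _ <= X]mulrC -ler_pdivrMr ?ltr0n ?fact_gt0//; case: i => [|i].
    rewrite expr0 fact0 divr1; apply: le_trans (expR_ge1Dx _).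
    by rewrite lerDl.
  by apply: le_trans (expR_ge1Dxn i cx0); rewrite lerDr.
by rewrite mulrAC ler_pdivlMr ?exprn_gt0// mulrC -exprMn.
Qed.

(** Half of the exponent absorbs the power of s. *)
Lemma expw_le i l s : 0 < l -> 0 <= s ->
  expw i l s <= i`!%:R / (l / 2) ^+ i * expR (- (l / 2) * s).
Proof.
move=> l0 s0; have l2 : 0 < l / 2 by rewrite divr_gt0.
rewrite /expw.
have -> : - l * s = l / 2 * - s + - (l / 2) * s by field.
rewrite expRD mulrA ler_wpM2r ?expR_ge0// mulrN expRN ler_pdivrMr ?expR_gt0//.
exact: expr_le_expR.
Qed.

Lemma expw_cvg0 i l : 0 < l -> expw i l n%:R @[n --> \oo] --> (0 : R).
Proof.
move=> l0; have l2 : 0 < l / 2 by rewrite divr_gt0.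
apply: (@squeeze_cvgr _ _ _ _ (cst 0)
  (fun n => i`!%:R / (l / 2) ^+ i * expR (- (l / 2)) ^+ n)).
- apply: nearW => n; rewrite expw_ge0/=; last exact/J0yP.
  by rewrite -expRM_natr expw_le.
- exact: cvg_cst.
rewrite -[X in _ --> X](mulr0 (i`!%:R / (l / 2) ^+ i)); apply: cvgM; first exact: cvg_cst.
by apply: cvg_expr; rewrite ger0_norm ?expR_ge0// expR_lt1 oppr_lt0.
Qed.

Lemma integrable_exp c : 0 < c -> leb.-integrable J0y (EFin \o (fun s => expR (- c * s))).
Proof.
move=> c0; have ce : continuous (fun s : R => expR (- c * s)).
  by move=> x; exact: (is_derive_continuous (is_derive_exp_scale c x)).
have cF : continuous (fun s : R => - c^-1 * expR (- c * s)).
  by move=> x; apply: cvgM; [exact: cvg_cst|exact: ce].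
apply/integrableP; split; first by apply/measurable_EFinP; exact: measurable_continuous.
have dF x : is_derive x (1 : R) (fun s => - c^-1 * expR (- c * s)) (expR (- c * x)).
  apply: (is_derive_eq (is_derive_expR_scale (- c^-1) (- c) x)).
  by rewrite mulrA mulrNN mulVf ?mul1r// gt_eqF.
have -> : (\int[leb]_(x in J0y) `|(EFin \o (fun s => expR (- c * s))) x| =
    \int[leb]_(x in J0y) (expR (- c * x))%:E)%E.
  by apply: eq_integral => x _ /=; rewrite ger0_norm// expR_ge0.
rewrite /J0y (@ge0_continuous_FTC2y R _ (fun s => - c^-1 * expR (- c * s)) 0 0).
- by rewrite ltry.
- by move=> x _; exact: expR_ge0.
- exact: continuous_subspaceT.
- rewrite -[X in _ --> X](mulr0 (- c^-1)); apply: cvgM; first exact: cvg_cst.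
  under eq_fun do rewrite mulNr.
  apply: (@cvg_comp _ _ _ (fun s => c * s) (fun x => expR (- x)) _ +oo).
    by apply/cvgryPge => A; near=> s; rewrite -ler_pdivrMl.
  exact: cvgr_expR.
- by move=> x _; have [] := dF x.
- by apply: cvg_at_right_filter; exact: cF.
- by move=> x _; rewrite derive1E; have [_ ->] := dF x.
Unshelve. all: by end_near. Qed.

Lemma integrable_expw i l : 0 < l -> leb.-integrable J0y (EFin \o expw i l).
Proof.
move=> l0; have l2 : 0 < l / 2 by rewrite divr_gt0.
apply: (le_integrable mJ0y _ _
  (integrableZl mJ0y (i`!%:R / (l / 2) ^+ i) (integrable_exp l2))).
  by apply/measurable_EFinP; exact: (measurable_continuous (@continuous_expw i l)).
move=> x /[dup] Jx /J0yP x0; rewrite lee_fin ger0_norm ?expw_ge0//.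
by apply: le_trans (expw_le i l0 x0) _; rewrite ler_norm.
Qed.

Lemma integrable_expw_bounded i l (D : R -> R) : 0 < l -> continuous D ->
  (forall s, 0 <= s -> `|D s| <= 1) ->
  leb.-integrable J0y (EFin \o (fun s => expw i l s * D s)).
Proof.
move=> l0 cD D1; apply: (le_integrable mJ0y _ _ (integrable_expw i l0)).
  have c : continuous (fun s : R => expw i l s * D s).
    by move=> x; apply: cvgM; [exact: continuous_expw|exact: cD].
  by apply/measurable_EFinP; exact: (measurable_continuous c).
move=> x Jx; rewrite lee_fin normrM [leRHS]ger0_norm ?expw_ge0//.
rewrite (ger0_norm (expw_ge0 i l Jx)) ler_piMr ?expw_ge0// D1//.
exact/J0yP.
Qed.

(** The sign of [f] being arbitrary, the half-line is reached from [0,n+1] by domination, hence a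
    limit of [F] along the integers only. *)
Lemma Rintegral_derive_vanish (F f : R -> R) :
  continuous F -> continuous f -> (forall x : R, 0 < x -> is_derive x 1 F (f x)) ->
  leb.-integrable J0y (EFin \o f) -> F n%:R @[n --> \oo] --> (0 : R) ->
  \int[leb]_(x in J0y) f x = - F 0.
Proof.
move=> cF cf dF jf F0.
pose fn (n : nat) (x : R) := f x * \1_(`[0, n.+1%:R]%classic : set R) x.
have mi (n : nat) : measurable (`[0%R, n.+1%:R]%classic : set (measurableTypeR R)).
  exact: measurable_itv.
have H : \int[leb]_(x in J0y) fn n x @[n --> \oo] --> \int[leb]_(x in J0y) f x.
  apply: (@Rintegral_dominated_cvg _ _ _ leb _ _ _ (fun x => `|f x|) mJ0y).
  - move=> n; apply: measurable_funM; first exact: measurable_continuous.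
    exact: measurable_indic.
  - exact: measurable_continuous.
  - apply: aeW => x /J0yP x0; apply: cvg_near_cst.
    near=> n; rewrite /fn indicE mem_set ?mulr1//= in_itv/= x0/=.
    near: n; have [k _ hk] := nbhs_infty_ger x.
    by exists k => // n /= kn; apply: le_trans (hk n kn) _; rewrite ler_nat.
  - exact: integrable_norm.
  - move=> n x _; rewrite /fn normrM ler_piMr// indicE.
    by case: (_ \in _); rewrite ?normr1 ?normr0.
have E n : \int[leb]_(x in J0y) fn n x = F n.+1%:R - F 0.
  rewrite /fn; transitivity (\int[leb]_(x in `[0, n.+1%:R]) f x).
    have JI : J0y `&` `[0%R, n.+1%:R]%classic = `[0%R, n.+1%:R]%classic.
      by apply/setIidr => x; rewrite /= in_itv/= => /andP[x0 _]; exact/J0yP.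
    rewrite -[in RHS]JI Rintegral_mkcondr; apply: eq_Rintegral => x _.
    by rewrite patchE indicE; case: (_ \in _); rewrite ?mulr1 ?mulr0.
  rewrite /Rintegral (@continuous_FTC2 R f F 0 n.+1%:R)//.
  - exact: continuous_subspaceT.
  - split.
    + by move=> x; rewrite in_itv/= => /andP[/dF[]].
    + by apply: cvg_at_right_filter; exact: cF.
    + by apply: cvg_at_left_filter; exact: cF.
  - by move=> x; rewrite in_itv/= => /andP[/dF[_ <-] _]; rewrite derive1E.
have H2 : \int[leb]_(x in J0y) fn n x @[n --> \oo] --> 0 - F 0.
  under eq_fun do rewrite E; apply: cvgB; last exact: cvg_cst.
  by rewrite -(cvg_shiftn 1) in F0; under eq_fun do rewrite -addn1.
by rewrite (cvg_unique _ H H2)// sub0r.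
Unshelve. all: by end_near. Qed.

End exponential_weights.

(** * Uniqueness of bounded chains *)

(* An integrated form of [Q k.+1' = - Q k] with [Q k] nonincreasing, in which no
   continuity of [Q 0] is required. *)
Definition decay_chain (R : realType) (Q : nat -> R -> R) : Prop :=
  (forall k (t : R), 0 <= t -> 0 <= Q k t <= 1) /\
  (forall k (s t : R), 0 <= s -> s <= t ->
    (t - s) * Q k t <= Q k.+1 s - Q k.+1 t <= (t - s) * Q k s).

Lemma decay_chain_lip (R : realType) (Q : nat -> R -> R) k (s t : R) :
  decay_chain Q -> 0 <= s -> 0 <= t -> `|Q k.+1 s - Q k.+1 t| <= `|s - t|.
Proof.
move=> [Q01 Qc]; wlog st : s t / s <= t => [H|s0 t0].
  move=> s0 t0; have [st|/ltW ts] := leP s t; first exact: H.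
  by rewrite distrC [leRHS]distrC; exact: H.
have /andP[a1 a2] := Qc k s t s0 st.
have /andP[b1 b2] := Q01 k s s0; have /andP[c1 c2] := Q01 k t t0.
have ts0 : 0 <= t - s by rewrite subr_ge0.
by rewrite distrC [leRHS]distrC (ger0_norm ts0) ler_norml; nra.
Qed.

(** The increment of level k+2 lies between multiples of values of level k+1, which is 1-Lipschitz
    because level k is bounded by 1. Hence differentiability from level 2 on; level 1 may have
    corners where level 0 jumps. *)
Lemma decay_chain_quadratic (R : realType) (Q : nat -> R -> R) k (t h : R) :
  decay_chain Q -> `|h| < t ->
  `|Q k.+2 (h + t) - Q k.+2 t + Q k.+1 t * h| <= h ^+ 2.
Proof.
move=> cQ; rewrite ltr_norml => /andP[th ht].
have t0 : 0 <= t by lra.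
have ht0 : 0 <= h + t by lra.
have L := decay_chain_lip k cQ ht0 t0; rewrite addrK in L.
have [h0|/ltW h0] := leP 0 h.
- have tht : t <= h + t by rewrite lerDr.
  have /andP[a1 a2] := (proj2 cQ) k.+1 t (h + t) t0 tht.
  rewrite addrK in a1 a2; rewrite (ger0_norm h0) ler_norml in L.
  by move/andP : L => [l1 l2]; rewrite ler_norml; nra.
- have tht : h + t <= t by rewrite gerDr.
  have /andP[a1 a2] := (proj2 cQ) k.+1 (h + t) t ht0 tht.
  rewrite opprD addrCA subrr addr0 in a1 a2.
  rewrite (ler0_norm h0) ler_norml in L.
  by move/andP : L => [l1 l2]; rewrite ler_norml; nra.
Qed.

(** Bernoulli's inequality (1 - u)^m >= 1 - mu, with u = y^n, m = 2^n and 2y < 1. *)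
Lemma pow_step_cvg1 (R : realType) (y : R) : 0 <= y -> y < 2^-1 ->
  (1 - y ^+ n) ^+ (2 ^ n) @[n --> \oo] --> (1 : R).
Proof.
move=> y0 y2.
have y1 n : 0 <= 1 - y ^+ n by rewrite subr_ge0 exprn_ile1//; lra.
apply: (@squeeze_cvgr _ _ _ _ (fun n => 1 - (2 * y) ^+ n) (cst 1)).
- apply: nearW => n; apply/andP; split; last first.
    by rewrite exprn_ile1// lerBlDr lerDl exprn_ge0.
  have H (u : R) m : 0 <= 1 - u -> 0 <= u -> 1 - m%:R * u <= (1 - u) ^+ m.
    move=> u1 u0; elim: m => [|m IH]; first by rewrite mul0r subr0 expr0.
    rewrite exprSr -natr1; have := ler_wpM2r u1 IH.
    have mu : 0 <= m%:R * (u * u) by rewrite !mulr_ge0.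
    by apply: le_trans; lra.
  by rewrite exprMn -natrX; apply: H; rewrite // exprn_ge0.
- rewrite -[X in _ --> X]subr0; apply: cvgB; first exact: cvg_cst.
  by apply: cvg_expr; rewrite ger0_norm; lra.
- exact: cvg_cst.
Qed.

(** Here (1 - u)^m <= exp(-mu), with mu = (2y)^n tending to infinity, and exp(-v) <= 1/v. *)
Lemma pow_step_cvg0 (R : realType) (y : R) : 2^-1 < y -> y <= 1 ->
  (1 - y ^+ n) ^+ (2 ^ n) @[n --> \oo] --> (0 : R).
Proof.
move=> y2 y1; have y0 : 0 < y by lra.
have y21 : 1 < 2 * y by lra.
have yn n : 0 <= 1 - y ^+ n by rewrite subr_ge0 exprn_ile1// ltW.
apply: (@squeeze_cvgr _ _ _ _ (cst 0) (fun n => ((2 * y)^-1) ^+ n)).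
- apply: nearW => n; rewrite exprn_ge0//= exprVn.
  have p0 : 0 < (2 * y) ^+ n by rewrite exprn_gt0//; lra.
  apply: (@le_trans _ _ (expR (- (2 * y) ^+ n))); last first.
    rewrite expRN lef_pV2 ?posrE ?expR_gt0//.
    by apply: le_trans (expR_ge1Dx _); rewrite lerDr.
  rewrite exprMn -natrX -mulrN expRM_natl.
  apply: lerXn2r; rewrite ?nnegrE ?expR_ge0//.
  exact: expR_ge1Dx.
- exact: cvg_cst.
- by apply: cvg_expr; rewrite ger0_norm ?invr_ge0 ?invf_lt1//; lra.
Qed.

Lemma series_exp_coeff_le (R : realType) (x : R) n :
  `|series (exp_coeff x) n| <= expR `|x|.
Proof.
apply: (@le_trans _ _ (series (exp_coeff `|x|) n)).
  rewrite -(normed_series_exp_coeff x); exact: ler_norm_sum.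
apply: nondecreasing_cvgn_le; last exact: is_cvg_series_exp_coeff.
by apply: nondecreasing_series => k _ _; exact: exp_coeff_ge0.
Qed.

Section chain_uniqueness.
Context {R : realType} (Q P : nat -> R -> R).
Hypotheses (cQ : decay_chain Q) (cP : decay_chain P).
Hypothesis QP0 : forall k, Q k 0 = P k 0.
Local Notation leb := (@lebesgue_measure R).

(** The index starts at level 1, the lowest one known to be continuous; the maximum extends the
    difference continuously to negative times. *)
Let D k (s : R) := Q k.+1 (Num.max s 0) - P k.+1 (Num.max s 0).

Let max0 (s : R) : 0 <= Num.max s 0. Proof. by rewrite le_max lexx orbT. Qed.

Let cD k : continuous (D k).
Proof.
have C (F : nat -> R -> R) : decay_chain F -> continuous (fun s : R => F k.+1 (Num.max s 0)).
  move=> cF s; apply/cvgrPdist_lt => e e0; near=> w.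
  apply: le_lt_trans (decay_chain_lip k cF (max0 _) (max0 _)) _.
  by apply: le_lt_trans (maxr0_lip _ _) _; near: w; exact: cvgr_dist_lt.
by move=> s; apply: cvgB; [exact: (C _ cQ)|exact: (C _ cP)].
Unshelve. all: by end_near. Qed.

Let D1 k s : `|D k s| <= 1.
Proof.
have /andP[a1 a2] := (proj1 cQ) k.+1 _ (max0 s).
have /andP[b1 b2] := (proj1 cP) k.+1 _ (max0 s).
by rewrite ler_norml /D; lra.
Qed.

Let D0 k : D k 0 = 0.
Proof. by rewrite /D maxxx QP0 subrr. Qed.

Let dD k (x : R) : 0 < x -> is_derive x 1 (D k.+1) (- D k x).
Proof.
move=> x0; apply: (@is_derive_quadratic R (D k.+1) x _ x 2) => // h hx.
have /andP[hx1 hx2] : - x < h < x by rewrite -ltr_norml.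
have q := decay_chain_quadratic k cQ hx; have p := decay_chain_quadratic k cP hx.
have E : D k.+1 (h + x) - D k.+1 x - - D k x * h =
   (Q k.+2 (h + x) - Q k.+2 x + Q k.+1 x * h) -
   (P k.+2 (h + x) - P k.+2 x + P k.+1 x * h).
  by rewrite /D !max_l ?(ltW x0)//; first ring; lra.
rewrite E; apply: le_trans (ler_normB _ _) _.
by rewrite mulr_natl mulr2n lerD.
Qed.

Let I i l k := \int[leb]_(s in J0y) (expw i l s * D k s).

Let iI i l k : 0 < l -> leb.-integrable J0y (EFin \o (fun s => expw i l s * D k s)).
Proof. by move=> l0; apply: integrable_expw_bounded => // s _. Qed.

Let is_derive_expw i l (x : R) :
  is_derive x 1 (expw i l) (i%:R * expw i.-1 l x - l * expw i l x).
Proof.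
have h1 := @is_deriveX R R id i x 1 _ (is_derive_id x 1).
have h2 := is_derive_exp_scale l x.
have h3 := is_deriveM h1 h2.
have -> : expw i l = id ^+ i * (fun s => expR (- l * s)).
  by apply/funext => s; rewrite /expw !fctE.
apply: (is_derive_eq h3); rewrite /GRing.scale/= /expw !fctE.
by ring.
Qed.

(** Integration by parts. The boundary term at 0 vanishes by the equality of initial values, the one
    at infinity by the exponential weight; for [i = 0] the truncated predecessor comes with
    coefficient 0. *)
Let I_parts i l k : 0 < l -> I i l k = i%:R * I i.-1 l k.+1 - l * I i l k.+1.
Proof.
move=> l0.
pose f s := i%:R * (expw i.-1 l s * D k.+1 s) - l * (expw i l s * D k.+1 s)
   - expw i l s * D k s.
have i1 := iI i.-1 k.+1 l0; have i2 := iI i k.+1 l0; have i3 := iI i k l0.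
have z1 := integrableZl mJ0y i%:R i1; have z2 := integrableZl mJ0y l i2.
have b12 := integrableB mJ0y z1 z2.
have b123 := integrableB mJ0y b12 i3.
have E : \int[leb]_(s in J0y) f s =
    i%:R * I i.-1 l k.+1 - l * I i l k.+1 - I i l k.
  rewrite /f RintegralB//; [|exact: mJ0y].
  rewrite RintegralB//; [|exact: mJ0y].
  by rewrite !RintegralZl//; exact: mJ0y.
have cw j : continuous (fun s : R => expw j l s * D k.+1 s).
  by move=> x; apply: cvgM; [exact: continuous_expw|exact: cD].
have : \int[leb]_(s in J0y) f s = - (expw i l 0 * D k.+1 0).
  apply: (@Rintegral_derive_vanish R (fun s => expw i l s * D k.+1 s)).
  - exact: cw.
  - move=> x; apply: cvgB.
      by apply: cvgB; apply: cvgM; [exact: cvg_cst|exact: cw|exact: cvg_cst|exact: cw].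
    by apply: cvgM; [exact: continuous_expw|exact: cD].
  - move=> x x0; have h := is_deriveM (is_derive_expw i l x) (dD k x0).
    apply: (is_derive_eq h); rewrite /GRing.scale/= /f.
    by ring.
  - exact: b123.
  apply/cvgr0Pnorm_le => e e0; have := expw_cvg0 i l0.
  move/cvgr0Pnorm_le => /(_ e e0); apply: filterS => n.
  by apply: le_trans; rewrite normrM ler_piMr.
by rewrite E D0 mulr0 oppr0 => /eqP; rewrite subr_eq0 => /eqP.
Qed.

Let I_bound i l k : 0 < l -> `|I i l k| <= \int[leb]_(s in J0y) expw i l s.
Proof.
move=> l0; apply: le_trans (le_normr_Rintegral mJ0y (iI i k l0)) _.
apply: le_Rintegral; [exact: mJ0y| |exact: integrable_expw|].
  by apply: integrable_norm; exact: iI.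
move=> s Js; rewrite normrM ger0_norm ?expw_ge0//.
by rewrite ler_piMr ?expw_ge0.
Qed.

(* Iterating [I_parts] makes the factor [l ^ n] appear in front of a bounded
   integral. *)
Let I_contract i l : 0 < l -> l < 1 ->
  (forall k, I i l k = - l * I i l k.+1) -> forall k, I i l k = 0.
Proof.
move=> l0 l1 S k; set K := \int[leb]_(s in J0y) expw i l s.
have S' n : `|I i l k| <= l ^+ n * K.
  have -> : `|I i l k| = l ^+ n * `|I i l (k + n)|.
    elim: n => [|n ->]; first by rewrite mul1r addn0.
    by rewrite S normrM normrN (gtr0_norm l0) mulrA -exprSr addnS.
  by rewrite ler_wpM2l ?exprn_ge0 ?(ltW l0)// I_bound.
have H : l ^+ n * K @[n --> \oo] --> 0 * K.
  apply: cvgM; last exact: cvg_cst.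
  by apply: cvg_expr; rewrite gtr0_norm.
apply/eqP; rewrite -normr_le0 -[X in _ <= X](mul0r K).
by apply: (cvgr_to_ge H); apply: nearW.
Qed.

(** Induction on the power: once [i] is settled at all levels, the first term of [I_parts]
    disappears at [i.+1] and the contraction applies again. *)
Let I_small i l k : 0 < l -> l < 1 -> I i l k = 0.
Proof.
move=> l0 l1; elim: i k => [|i IH]; apply: I_contract => // k.
  by rewrite I_parts// mul0r sub0r mulNr.
by rewrite I_parts//= IH mulr0 sub0r mulNr.
Qed.

Let J i l := \int[leb]_(s in J0y) (expw i l s * D 0 s).

(* Dominated convergence for the exponential series of [e^{-m s}], which is
   dominated by [e^{m s}]; the vanishing thus propagates from [l < 1] to all [l]. *)
Let J_step l m : 2^-1 <= l -> 0 <= m -> m <= 4^-1 ->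
  (forall i, J i l = 0) -> forall i, J i (l + m) = 0.
Proof.
move=> l2 m0 m4 Jl i; have l0 : 0 < l by lra.
pose f n s := series (exp_coeff (- m * s)) n * (expw i l s * D 0 s).
have key n : leb.-integrable J0y (EFin \o f n) /\ \int[leb]_(s in J0y) f n s = 0.
  elim: n => [|n [IH1 IH2]].
    have -> : f 0%N = cst 0.
      by apply/funext => s; rewrite /f /series/= big_geq// mul0r.
    by split; [exact: integrable0|rewrite Rintegral_cst ?mul0r//; exact: mJ0y].
  have fS s : f n.+1 s = f n s + (- m) ^+ n / n`!%:R * (expw (i + n) l s * D 0 s).
    rewrite /f /series/= big_nat_recr//= mulrDl; congr (_ + _).
    by rewrite /exp_coeff/= /expw exprMn exprD; ring.
  have i1 := iI (i + n) 0 l0.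
  have i2 := integrableZl mJ0y ((- m) ^+ n / n`!%:R) i1.
  have -> : f n.+1 = fun s => f n s + (- m) ^+ n / n`!%:R * (expw (i + n) l s * D 0 s).
    exact/funext.
  split; first exact: (integrableD mJ0y IH1 i2).
  rewrite RintegralD//; last exact: mJ0y.
  rewrite IH2 add0r RintegralZl//; last exact: mJ0y.
  by rewrite -/(J (i + n) l) Jl mulr0.
have H : \int[leb]_(s in J0y) f n s @[n --> \oo] --> J i (l + m).
  apply: (@Rintegral_dominated_cvg _ _ _ leb _ _ _ (expw i 4^-1) mJ0y).
  - by move=> n; have [/measurable_int/measurable_EFinP] := key n.
  - apply: measurable_continuous => x.
    by apply: cvgM; [exact: continuous_expw|exact: cD].
  - apply: aeW => s _.
    have -> : expw i (l + m) s * D 0 s = expR (- m * s) * (expw i l s * D 0 s).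
      rewrite /expw opprD mulrDl expRD; ring.
    by apply: cvgM; [exact: is_cvg_series_exp_coeff|exact: cvg_cst].
  - by apply: integrable_expw; rewrite invr_gt0.
  - move=> n s /[dup] Js /J0yP s0; rewrite /f 2!normrM (ger0_norm (expw_ge0 i l Js)).
    apply: (@le_trans _ _ (expR (m * s) * expw i l s)).
      apply: ler_pM => //; first by rewrite mulr_ge0 ?expw_ge0.
        have ms : `|- m * s| = m * s by rewrite mulNr normrN ger0_norm// mulr_ge0.
        by have := series_exp_coeff_le (- m * s) n; rewrite ms.
      by rewrite ler_piMr ?expw_ge0.
    rewrite /expw mulrCA ler_wpM2l ?exprn_ge0// -expRD ler_expR.
    by nra.
have : \int[leb]_(s in J0y) f n s @[n --> \oo] --> (0 : R).
  by under eq_fun do rewrite (proj2 (key _)); exact: cvg_cst.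
by move/(cvg_unique _ H) => ->.
Qed.

(** Steps of length at most 1/4 climb from 1/2, where [I_small] applies. The domination in [J_step]
    dictates this length: for l >= 1/2 and m <= 1/4 it leaves the integrable weight s^i
    exp(-s/4). *)
Let J_all l : 2^-1 <= l -> forall i, J i l = 0.
Proof.
have A n : forall l, 2^-1 <= l -> l <= 2^-1 + n%:R / 4 -> forall i, J i l = 0.
  elim: n => [|n IH] {}l l1 l2 i.
    rewrite mul0r addr0 in l2.
    have -> : l = 2^-1 by apply/le_anti; rewrite l2.
    by apply: (I_small i 0); rewrite ?invr_gt0// invf_lt1// ltr1n.
  have [ln|nl] := leP l (2^-1 + n%:R / 4); first exact: IH.
  have nS : n.+1%:R = n%:R + 1 :> R by rewrite natr1.
  rewrite nS in l2.
  have n0 : 0 <= n%:R :> R by [].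
  have [l3|l3] := leP (2^-1) (l - 4^-1).
    have -> : l = (l - 4^-1) + 4^-1 by lra.
    by apply: J_step => //; apply: IH; lra.
  have -> : l = 2^-1 + (l - 2^-1) by lra.
  by apply: J_step => //; [lra|lra|apply: IH; lra].
move=> l1; have [n hn] : exists n : nat, l <= n%:R.
  by exists (Num.trunc l).+1; apply/ltW/truncnS_gt.
by apply: (A (4 * n)%N) => //; rewrite natrM; lra.
Qed.

(** Splitting off one factor 1 - exp(-cs) gives the difference of the integrals at rates l and l +
    c, both at least 1/2; induction on [m] replaces the binomial expansion. *)
Let J_cut (c : R) m l : 0 <= c -> 2^-1 <= l ->
  \int[leb]_(s in J0y) (expw 0 l s * ((1 - expR (- c * s)) ^+ m * D 0 s)) = 0.
Proof.
move=> c0; elim: m l => [|m IH] l l2.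
  by rewrite -[RHS](J_all l2 0); apply: eq_Rintegral => s _; rewrite expr0 mul1r.
have lc : 2^-1 <= l + c by lra.
pose w s := (1 - expR (- c * s)) ^+ m * D 0 s.
have cw : continuous w.
  move=> x; apply: cvgM; last exact: cD.
  apply: (@continuous_cvg _ _ _ _ _ _ (fun x : R => x ^+ m)); first exact: exprn_continuous.
  apply: cvgB; first exact: cvg_cst.
  exact: (is_derive_continuous (is_derive_exp_scale c x)).
have w1 s : 0 <= s -> `|w s| <= 1.
  move=> s0; rewrite normrM mulr_ile1// normrX exprn_ile1//.
  have e1 : expR (- c * s) <= 1 by rewrite expR_le1 mulNr oppr_le0 mulr_ge0.
  by have := expR_ge0 (- c * s); rewrite ger0_norm; lra.
have l0 : 0 < l by lra.
have lc0 : 0 < l + c by lra.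
have i1 := integrable_expw_bounded 0 l0 cw w1.
have i2 := integrable_expw_bounded 0 lc0 cw w1.
transitivity (\int[leb]_(s in J0y) (expw 0 l s * w s - expw 0 (l + c) s * w s)).
  apply: eq_Rintegral => s _.
  have E : expR (- (l + c) * s) = expR (- l * s) * expR (- c * s).
    by rewrite -expRD; congr expR; ring.
  by rewrite /w exprS /expw E; ring.
by rewrite RintegralB ?IH ?subrr//; exact: mJ0y.
Qed.

(* With [y = 2^{-s/T}], the functions [(1 - y^n)^(2^n)] tend to the indicator of
   [y < 1/2], that is [T < s]. *)
Let J_tail (T : R) : 0 < T ->
  \int[leb]_(s in J0y) (expw 0 2^-1 s * D 0 s * \1_(`]T, +oo[%classic : set R) s) = 0.
Proof.
move=> T0; have ln20 : 0 < ln 2 :> R by rewrite ln_gt0// ltr1n.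
pose th := ln 2 / T; have th0 : 0 < th by rewrite divr_gt0.
pose f n s := expw 0 2^-1 s * ((1 - expR (- (n%:R * th) * s)) ^+ (2 ^ n) * D 0 s).
have cf n : continuous (f n).
  move=> x; apply: cvgM; first exact: continuous_expw.
  apply: cvgM; last exact: cD.
  apply: (@continuous_cvg _ _ _ _ _ _ (fun x : R => x ^+ (2 ^ n))); first exact: exprn_continuous.
  apply: cvgB; first exact: cvg_cst.
  exact: (is_derive_continuous (is_derive_exp_scale _ x)).
have H : \int[leb]_(s in J0y) f n s @[n --> \oo] -->
    \int[leb]_(s in J0y) (expw 0 2^-1 s * D 0 s * \1_(`]T, +oo[%classic : set R) s).
  apply: (@Rintegral_dominated_cvg _ _ _ leb _ _ _ (expw 0 2^-1) mJ0y).
  - by move=> n; exact: measurable_continuous.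
  - apply: measurable_funM; last exact: measurable_indic.
    apply: measurable_continuous => x.
    by apply: cvgM; [exact: continuous_expw|exact: cD].
  - exists [set T]; split; [by []|exact: lebesgue_measure_set1|].
    move=> s /= /not_implyP[/J0yP s0 nc]; apply: contrapT => sT; apply: nc.
    rewrite -mulrA [D 0 s * _]mulrC; apply: cvgM; first exact: cvg_cst.
    apply: cvgM; last exact: cvg_cst.
    have E n : expR (- (n%:R * th) * s) = expR (- th * s) ^+ n.
      by rewrite -expRM_natl; congr expR; ring.
    under eq_fun do rewrite E.
    have y1 : expR (- th * s) <= 1 by rewrite expR_le1 mulNr oppr_le0 mulr_ge0// ltW.
    have ET (u v : R) : (u < v) -> expR (- th * v) < expR (- th * u).
      by move=> uv; rewrite ltr_expR ltr_nM2l// oppr_lt0.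
    have E2 : expR (- th * T) = 2^-1.
      by rewrite mulNr /th divfK ?gt_eqF// expRN lnK// posrE.
    have [Ts|sT'] := ltP T s.
      rewrite indicE mem_set/=; last by rewrite in_itv/= Ts.
      by apply: pow_step_cvg1; rewrite ?expR_ge0// -E2 ET.
    rewrite indicE memNset/=; last by rewrite in_itv/= andbT; apply/negP; rewrite -leNgt.
    apply: pow_step_cvg0 => //; rewrite -E2 ET// lt_neqAle sT' andbT.
    by apply/eqP.
  - by apply: integrable_expw; rewrite invr_gt0.
  - move=> n s /[dup] Js /J0yP s0; rewrite /f normrM (ger0_norm (expw_ge0 _ _ Js)).
    rewrite ler_piMr ?expw_ge0// normrM mulr_ile1// normrX exprn_ile1//.
    have e1 : expR (- (n%:R * th) * s) <= 1.
      by rewrite expR_le1 mulNr oppr_le0 mulr_ge0// mulr_ge0// ltW.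
    by have := expR_ge0 (- (n%:R * th) * s); rewrite ger0_norm; lra.
have : \int[leb]_(s in J0y) f n s @[n --> \oo] --> (0 : R).
  have f0 n : \int[leb]_(s in J0y) f n s = 0 by apply: J_cut => //; rewrite mulr_ge0// ltW.
  by under eq_fun do rewrite f0; exact: cvg_cst.
by move/(cvg_unique _ H) => ->.
Qed.

(** By [J_tail], exp(-s/2) D 0 s has integral zero over every ]T,+oo[ with T > 0, hence over every
    [a,x] with a > 0; being continuous, it vanishes. *)
Theorem decay_chain_unique (t : R) : 0 <= t -> Q 1 t = P 1 t.
Proof.
rewrite le_eqVlt => /predU1P[<-|t0]; first exact: QP0.
pose w s := expw 0 2^-1 s * D 0 s.
have cw : continuous w.
  by move=> x; apply: cvgM; [exact: continuous_expw|exact: cD].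
have iw : leb.-integrable J0y (EFin \o w) by apply: iI; rewrite invr_gt0.
have tail (T : R) : 0 < T -> \int[leb]_(s in `]T, +oo[) w s = 0.
  move=> T0; rewrite -[RHS](J_tail T0).
  have JI : J0y `&` `]T, +oo[%classic = `]T, +oo[%classic.
    apply/setIidr => x; rewrite /= in_itv/= andbT => Tx; apply/J0yP.
    exact: ltW (lt_trans T0 Tx).
  rewrite -[in LHS]JI Rintegral_mkcondr; apply: eq_Rintegral => x _.
  by rewrite patchE indicE; case: (_ \in _); rewrite ?mulr1 ?mulr0.
pose a := t / 2.
have a0 : 0 < a by rewrite divr_gt0.
have at' : a < t by rewrite /a; lra.
have sub (b : R) : `[a, b]%classic `<=` J0y.
  move=> x; rewrite /= in_itv/= => /andP[ax _]; apply/J0yP.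
  exact: ltW (lt_le_trans a0 ax).
have F0 (x : R) : a < x -> \int[leb]_(s in `[a, x]) w s = 0.
  move=> ax.
  have mI : measurable (`[a, x]%classic : set (measurableTypeR R)) by exact: measurable_itv.
  have mT : measurable (`]a, +oo[%classic : set (measurableTypeR R)) by exact: measurable_itv.
  rewrite -Rintegral_itv_obnd_cbnd; last first.
    apply: integrableS iw => //; first exact: measurable_itv.
    by apply: subset_trans (sub x); exact: subset_itv_oc_cc.
  have iT : leb.-integrable [set` Interval (BRight a) (BInfty R false)] (EFin \o w).
    apply: integrableS iw => //; first exact: mJ0y.
    by move=> y; rewrite /= in_itv/= andbT => ay; apply/J0yP; exact: ltW (lt_trans a0 ay).
  have := Rintegral_itvB iT (_ : (BRight a <= BRight x)%O) (_ : (BRight x <= BInfty R false)%O).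
  rewrite bnd_simp => /(_ (ltW ax) isT).
  rewrite !tail//; last exact: lt_trans ax.
  by move/eqP; rewrite sub0r oppr_eq0 => /eqP.
have it : leb.-integrable `[a, t + 1] (EFin \o w).
  apply: integrableS iw; [exact: mJ0y|exact: measurable_itv|exact: sub].
have [_ ] := @continuous_FTC1_closed R w a t (t + 1) (ltr_pwDr ltr01 (lexx t)) it at' (cw t).
have : is_derive t 1 (fun x => \int[leb]_(s in `[a, x]) w s) 0.
  apply: near_eq_is_derive (is_derive_cst (0 : R) t (1 : R)).
  by near=> x; rewrite F0//; near: x; exact: lt_nbhsr.
rewrite derive1E => -[_ ->] /esym/eqP.
rewrite /w mulf_eq0 /expw mul1r => /orP[|].
  by rewrite expR_eq0.
by rewrite subr_eq0 max_l ?(ltW t0)// => /eqP.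
Unshelve. all: by end_near. Qed.

End chain_uniqueness.

(** * Decay of the moments *)

Lemma integral_pos (R : realType) (nu : borel_measure R) (D : set (measurableTypeR R))
    (f : R -> R) : measurable D -> measurable_fun D f -> (forall x, D x -> 0 < f x) ->
  (0 < nu D)%E -> (0 < \int[nu]_(x in D) (f x)%:E)%E.
Proof.
move=> mD mf f0 D0; rewrite lt_neqAle integral_ge0 ?andbT; last first.
  by move=> x /f0/ltW; rewrite lee_fin.
apply/eqP => /esym E.
have mef : measurable_fun D (EFin \o f) by apply/measurable_EFinP.
have E' : (\int[nu]_(x in D) `|(EFin \o f) x| = 0)%E.
  rewrite -[RHS]E; apply: eq_integral => x; rewrite inE => /f0 fx /=.
  by rewrite gtr0_norm.
have [N [mN N0 sN]] := (ae_eq_integral_abs nu mD mef).1 E'.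
suff : nu D = 0%E by move=> D00; rewrite D00 ltxx in D0.
apply/eqP; rewrite -measure_le0 -N0; apply: le_measure; rewrite ?inE//.
move=> x Dx; apply: sN => /= /(_ Dx) [fx].
by have := f0 x Dx; rewrite fx ltxx.
Qed.

Section moments.
Context {R : realType} (alpha : R) (B : borel_measure R)
  (sigma : R -> borel_measure R).
Hypothesis alpha_lt0 : alpha < 0.
Hypothesis B_fin : (\int[B]_(y in `]0%R, 1%R[%classic) (y * (1 - y))%:E < +oo)%E.
Hypothesis ev : evolves alpha B sigma.
Hypothesis hB : (frag_phi_infty B < +oo)%E.

Let mO : measurable (`]0%R, 1%R[%classic : set (measurableTypeR R)).
Proof. exact: measurable_itv. Qed.

Lemma measurable_powR_on (D : set (measurableTypeR R)) (q : R) :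
  measurable_fun D (fun x : measurableTypeR R => x `^ q).
Proof.
have m : measurable_fun (setT : set (measurableTypeR R))
    (fun x : measurableTypeR R => x `^ q) by exact: measurable_powR.
exact: measurable_funTS m.
Qed.

Lemma powR_le1 (q x : R) : 0 <= q -> 0 < x -> x <= 1 -> x `^ q <= 1.
Proof.
move=> q0 x0 x1; have := ge0_ler_powR q0 _ _ x1; rewrite powR1; apply.
  by rewrite nnegrE ltW.
by rewrite nnegrE.
Qed.

Lemma integrable_phi (q : R) : 0 <= q ->
  B.-integrable `]0%R, 1%R[%classic (EFin \o (fun x : R => (1 - x `^ q) * x)).
Proof.
move=> q0; apply: (le_integrable mO _ _ (integrable_id_dislocation hB)).
  apply/measurable_EFinP; apply: measurable_funM => //.
  apply: measurable_funB => //.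
  exact: measurable_powR_on.
move=> x; rewrite /= in_itv/= => /andP[x0 x1]; rewrite lee_fin.
have xq := powR_le1 q0 x0 (ltW x1); have xq0 := powR_ge0 x q.
by rewrite ger0_norm ?mulr_ge0 ?subr_ge0 ?(ltW x0)// (gtr0_norm x0); nra.
Qed.

(* [x^p] cut off near 0, to make it admissible; for [p = q] and [z = x^q] it is
   [eta z = z ((1 - e/z)^+)^2], whose increments are dominated by those of [z]. *)
Let G (p q e x : R) := x `^ p * sqp (1 - e * x `^ (- q)).

Let aG (p q e : R) : 0 < q -> 0 < e -> admissible (G p q e).
Proof.
move=> q0 e0; split.
  apply: C1posM; first exact: C1pos_powR.
  apply: C1pos_sqp.
  have cc : continuous (fun _ : R => - e) by move=> x; exact: cvg_cst.
  have := @C1pos_comp R (fun v => - e * v + 1) (fun=> - e) _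
    (is_derive_affine (- e) 1) cc (C1pos_powR (- q)).
  by apply: eq_C1pos => x; rewrite mulNr addrC.
exists (e `^ q^-1); first exact: powR_gt0.
move=> x x0 xe; rewrite /G sqp0 ?mulr0// subr_le0 powRN ler_pdivlMr ?powR_gt0// mul1r.
have : x `^ q <= (e `^ q^-1) `^ q by apply: (ge0_ler_powR (ltW q0)); rewrite ?nnegrE ?powR_ge0// ltW.
by rewrite -powRrM mulVf ?gt_eqF// powRr1// ltW.
Qed.

Let chi_mono (q e x y : R) : 0 < q -> 0 < e -> 0 < x -> x <= y ->
  sqp (1 - e * x `^ (- q)) <= sqp (1 - e * y `^ (- q)).
Proof.
move=> q0 e0 x0 xy; apply: sqp_le; rewrite lerD2l lerN2 ler_wpM2l ?(ltW e0)//.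
by apply: le0_ler_powR => //; rewrite oppr_le0 ltW.
Qed.

Let chi_le1 (q e x : R) : 0 < e -> sqp (1 - e * x `^ (- q)) <= 1.
Proof.
move=> e0; rewrite -[leRHS](_ : sqp 1 = 1); last by rewrite /sqp max_l// expr1n.
by apply: sqp_le; rewrite lerBlDr lerDl mulr_ge0 ?powR_ge0// ltW.
Qed.

Let G_mono (p q e x y : R) : 0 <= p -> 0 < q -> 0 < e -> 0 < x -> x <= y ->
  G p q e x <= G p q e y.
Proof.
move=> p0 q0 e0 x0 xy; apply: ler_pM; rewrite ?powR_ge0 ?sqp_ge0//.
  by apply: ge0_ler_powR; rewrite ?nnegrE// ltW// (lt_le_trans x0).
exact: chi_mono.
Qed.

Let IG p q e t := \int[sigma t]_(x in `]0, 1]) G p q e x.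

Definition moment (q t : R) := \int[sigma t]_(x in `]0, 1]) x `^ q.

(** Fragmentation only shrinks: on a nondecreasing function the generator is nonpositive. *)
Let IG_nincr (p q e s t : R) : 0 <= p -> 0 < q -> 0 < e -> 0 <= s -> s <= t ->
  IG p q e t <= IG p q e s.
Proof.
move=> p0 q0 e0 s0 st.
have := @has_rderiv_mono R _ _ _ _ (cst 0) (cst 0) s t (proj2 ev _ (aG p q0 e0))
  (is_derive_affine 0 (-1)) (fun x => is_derive_cst (0:R) x 1) s0 st.
rewrite /= !mul0r !add0r !addr0 !mulrN1 lerN2; apply => x sx _.
rewrite !mul0r !mulr0 !addr0 add0r mulrN1 oppr_ge0.
have x0 : 0 <= x by apply/ltW/(le_lt_trans s0).
rewrite -[leRHS](_ : \int[sigma x]_(_ in `]0, 1]) (0:R) = 0); last first.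
  by rewrite Rintegral_cst ?mul0r//; exact: mI01.
have i1 := integrable_frag_gen alpha_lt0 B_fin ev x0 (aG p q0 e0).
have i2 : (sigma x).-integrable `]0%R, 1%R]%classic (EFin \o cst (0:R)).
  exact: integrable0.
apply: (le_Rintegral mI01 i1 i2) => y /=; rewrite in_itv/= => /andP[y0 y1].
rewrite /frag_gen.
rewrite mulr_ge0_le0 ?powR_ge0//.
rewrite -oppr_ge0 -mulN1r -RintegralZl//; last first.
  exact: (integrable_increment B_fin (aG p q0 e0) y0).
apply: Rintegral_ge0 => z /=; rewrite in_itv/= => /andP[z0 z1].
rewrite mulN1r -mulNr mulr_ge0 ?(ltW z0)// oppr_ge0 subr_le0.
by apply: G_mono; rewrite ?mulr_gt0// ler_piMl// ltW.
Qed.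

Let e_ (n : nat) : R := n.+1%:R^-1.

Let e_gt0 n : 0 < e_ n. Proof. by rewrite invr_gt0. Qed.

Let IG_cvg (p q t : R) : 0 <= p -> 0 < q -> 0 <= t ->
  IG p q (e_ n) t @[n --> \oo] --> moment p t.
Proof.
move=> p0 q0 t0; apply: (Rintegral_bounded_cvg mI01 (evolves_lty ev t0) (C:=1)).
- by move=> n; exact: (measurable_admissible (aG p q0 (e_gt0 n))).
- move=> n x /=; rewrite in_itv/= => /andP[x0 x1].
  have xp := powR_le1 p0 x0 x1; have chi1 := chi_le1 q x (e_gt0 n).
  rewrite ger0_norm; first by rewrite /G mulr_ile1 ?powR_ge0 ?sqp_ge0.
  by rewrite /G mulr_ge0 ?powR_ge0 ?sqp_ge0.
move=> x /=; rewrite in_itv/= => /andP[x0 x1].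
rewrite -[X in _ --> X]mulr1; apply: cvgM; first exact: cvg_cst.
rewrite -[X in _ --> X](_ : sqp (1 - 0 * x `^ (- q)) = 1); last first.
  by rewrite mul0r subr0 /sqp max_l// expr1n.
apply: (@continuous_cvg _ _ _ _ _ _ (@sqp R)).
  exact: is_derive_continuous (is_derive_sqp _).
apply: cvgB; first exact: cvg_cst.
by apply: cvgM; [exact: cvg_harmonic|exact: cvg_cst].
Qed.

(** The exponent of the cut-off is independent of [p]; it is set to 1, so that [p = 0], the total
    mass, is included. *)
Lemma moment_nincr (p s t : R) : 0 <= p -> 0 <= s -> s <= t -> moment p t <= moment p s.
Proof.
move=> p0 s0 st; have t0 := le_trans s0 st.
apply: (ler_cvg_to (IG_cvg p0 ltr01 t0) (IG_cvg p0 ltr01 s0)).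
by apply: nearW => n; exact: (IG_nincr p0 ltr01 (e_gt0 n)).
Qed.

Lemma moment_ge0 (p t : R) : 0 <= moment p t.
Proof. by apply: Rintegral_ge0 => x _; exact: powR_ge0. Qed.

Lemma integrable_powR (p t : R) : 0 <= p -> 0 <= t ->
  (sigma t).-integrable `]0%R, 1%R]%classic (EFin \o (fun x => x `^ p)).
Proof.
move=> p0 t0; apply: (bounded_integrable mI01 (evolves_lty ev t0) (C:=1)).
  exact: measurable_powR_on.
move=> x /=; rewrite in_itv/= => /andP[x0 x1].
by rewrite ger0_norm ?powR_ge0// powR_le1.
Qed.

Lemma moment_le1 (p t : R) : 0 <= p -> 0 <= t -> moment p t <= 1.
Proof.
move=> p0 t0; apply: (@le_trans _ _ (\int[sigma t]_(x in `]0, 1]) (1:R))).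
  apply: le_Rintegral; [exact: mI01|exact: integrable_powR| |].
    by apply: (bounded_integrable mI01 (evolves_lty ev t0) (C:=`|1|)).
  by move=> x /=; rewrite in_itv/= => /andP[x0 x1]; exact: powR_le1.
rewrite Rintegral_cst ?mul1r; last exact: mI01.
rewrite -lee_fin fineK; first exact: (proj1 ev).
by rewrite ge0_fin_numE// (evolves_lty ev).
Qed.

Let phi := frag_phi B.

Lemma frag_phi_ge0 (q : R) : 0 <= q -> 0 <= phi q.
Proof.
move=> q0; apply: Rintegral_ge0 => x /=; rewrite in_itv/= => /andP[x0 x1].
by rewrite mulr_ge0 ?subr_ge0 ?(ltW x0)// powR_le1// ltW.
Qed.

Let scaled_powR (x y q : R) : 0 < x -> 0 < y -> (y * x) `^ q = y `^ q * x `^ q.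
Proof. by move=> x0 y0; rewrite powRM ?ltW. Qed.

(** The cut-off factor being nondecreasing, its value at yx may be replaced by the one at x, which
    only increases the gain and leaves exactly phi(q). *)
Let gen_le (q e x : R) : 0 < q -> 0 < e -> 0 < x -> x <= 1 ->
  frag_gen alpha B (G q q e) x <= - phi q * G (q + alpha) q e x.
Proof.
move=> q0 e0 x0 x1; rewrite /frag_gen /G.
have -> : - phi q * (x `^ (q + alpha) * sqp (1 - e * x `^ (- q))) =
    x `^ alpha * (- (x `^ q * sqp (1 - e * x `^ (- q))) * phi q).
  by rewrite powRD; [ring|rewrite (gt_eqF x0) implybT].
rewrite ler_wpM2l ?powR_ge0// /phi /frag_phi -RintegralZl//; last first.
  by apply: integrable_phi; exact: ltW.
apply: le_Rintegral => //.
- exact: (integrable_increment B_fin (aG q q0 e0) x0).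
- exact: (integrableZl mO _ (integrable_phi (ltW q0))).
move=> y /=; rewrite in_itv/= => /andP[y0 y1].
rewrite [leRHS]mulrA ler_wpM2r ?(ltW y0)// scaled_powR//.
have yx : y * x <= x by rewrite ler_piMl// ltW.
have := chi_mono q0 e0 (mulr_gt0 y0 x0) yx; rewrite scaled_powR//.
set u := sqp _; set v := sqp _ => uv.
have a0 := powR_ge0 y q; have b0 := powR_ge0 x q.
have : y `^ q * x `^ q * u <= y `^ q * x `^ q * v by rewrite ler_wpM2l// mulr_ge0.
by lra.
Qed.

(** Above [e] the function is z - 2e + e^2/z, where e^2/z decreases; below [e] it is zero. *)
Let eta_lip (e z z' : R) : 0 < e -> 0 < z' -> z' <= z ->
  z * sqp (1 - e * z^-1) - z' * sqp (1 - e * z'^-1) <= z - z'.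
Proof.
move=> e0 z'0 zz; have z0 : 0 < z by exact: lt_le_trans zz.
have E w : 0 < w -> e < w -> w * sqp (1 - e * w^-1) = w - 2 * e + e ^+ 2 / w.
  move=> w0 ew; rewrite /sqp max_l; last by rewrite subr_ge0 ler_pdivrMr// mul1r ltW.
  by field; rewrite gt_eqF.
have E0 w : 0 < w -> w <= e -> w * sqp (1 - e * w^-1) = 0.
  by move=> w0 we; rewrite sqp0 ?mulr0// subr_le0 ler_pdivlMr// mul1r.
have [ze|ez] := leP z e.
  by rewrite !E0 ?subrr ?subr_ge0// (le_trans zz).
have H1 : e ^+ 2 / z <= e by rewrite expr2 ler_pdivrMr// ler_wpM2l// ltW.
have [z'e|ez'] := leP z' e.
  by rewrite E// (E0 z')// subr0; lra.
rewrite !E//.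
have : e ^+ 2 / z <= e ^+ 2 / z' by rewrite ler_wpM2l ?sqr_ge0// lef_pV2.
by lra.
Qed.

Let gen_ge (q e x : R) : 0 < q -> 0 < e -> 0 < x -> x <= 1 ->
  - phi q * x `^ (q + alpha) <= frag_gen alpha B (G q q e) x.
Proof.
move=> q0 e0 x0 x1; rewrite /frag_gen.
have -> : - phi q * x `^ (q + alpha) = x `^ alpha * (- x `^ q * phi q).
  by rewrite powRD; [ring|rewrite (gt_eqF x0) implybT].
rewrite ler_wpM2l ?powR_ge0// /phi /frag_phi -RintegralZl//; last first.
  by apply: integrable_phi; exact: ltW.
apply: le_Rintegral => //.
- exact: (integrableZl mO _ (integrable_phi (ltW q0))).
- exact: (integrable_increment B_fin (aG q q0 e0) x0).
move=> y /=; rewrite in_itv/= => /andP[y0 y1].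
rewrite [leLHS]mulrA ler_wpM2r ?(ltW y0)//.
have xq0 : 0 < x `^ q by exact: powR_gt0.
have yxq0 : 0 < (y * x) `^ q by rewrite powR_gt0// mulr_gt0.
have yxq : (y * x) `^ q <= x `^ q.
  by apply: ge0_ler_powR; rewrite ?nnegrE ?mulr_ge0 ?ler_piMl// ltW.
have := eta_lip e0 yxq0 yxq; rewrite /G !powRN [in X in _ <= X -> _]scaled_powR//.
by lra.
Qed.

(** Stated on increments because for q = -alpha the order q + alpha is 0, that of the mass, whose
    continuity is unknown. [gen_le] bounds the loss from below, [gen_ge] from above; monotonicity of
    the moment of order q + alpha makes the rates constant on [s,t], and the cut-off is then
    removed. *)
Theorem moment_decay (q s t : R) : - alpha <= q -> 0 <= s -> s <= t ->
  (t - s) * (phi q * moment (q + alpha) t) <= moment q s - moment q t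
    <= (t - s) * (phi q * moment (q + alpha) s).
Proof.
move=> aq s0 st; have t0 := le_trans s0 st.
have q0 : 0 < q by apply: lt_le_trans aq; rewrite oppr_gt0.
have qa : 0 <= q + alpha by rewrite -lerBlDr sub0r.
have p0 : 0 <= phi q by apply: frag_phi_ge0; exact: ltW.
apply/andP; split.
- have K n : IG q q (e_ n) t + (t - s) * (phi q * IG (q + alpha) q (e_ n) t) <= IG q q (e_ n) s.
    have e0 := e_gt0 n.
    (* The factor is the constant -1, and the slope of [F] is minus the loss rate at the final time,
       the smallest on the interval. *)
    have := @has_rderiv_mono R _ _ _ _ _ _ s t (proj2 ev _ (aG q q0 e0))
      (is_derive_affine 0 (-1))
      (is_derive_affine (- (phi q * IG (q + alpha) q (e_ n) t)) 0) s0 st.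
    rewrite -!/(IG _ _ _ _) !mul0r !add0r !addr0 => H.
    suff /H : forall x, s < x -> x < t ->
      0 <= \int[sigma x]_(y in `]0, 1]) frag_gen alpha B (G q q (e_ n)) y * (0 * x - 1) +
        IG q q (e_ n) x * 0 - phi q * IG (q + alpha) q (e_ n) t.
      by lra.
    move=> x sx xt; have x0 : 0 <= x by apply/ltW/(le_lt_trans s0).
    have : \int[sigma x]_(y in `]0, 1]) frag_gen alpha B (G q q (e_ n)) y <=
        - phi q * IG (q + alpha) q (e_ n) x.
      rewrite /IG -RintegralZl; [|exact: mI01|]; last first.
        by apply: (integrable_admissible ev x0); exact: aG.
      apply: le_Rintegral; [exact: mI01| | |].
      - by apply: (integrable_frag_gen alpha_lt0 B_fin ev x0); exact: aG.
      - exact: (integrableZl mI01 (- phi q) (integrable_admissible ev x0 (aG (q + alpha) q0 e0))).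
      - by move=> y /=; rewrite in_itv/= => /andP[y0 y1]; exact: gen_le.
    have := ler_wpM2l p0 (IG_nincr qa q0 e0 x0 (ltW xt)).
    by lra.
  have L : IG q q (e_ n) t + (t - s) * (phi q * IG (q + alpha) q (e_ n) t) @[n --> \oo] -->
      moment q t + (t - s) * (phi q * moment (q + alpha) t).
    apply: cvgD; first exact: IG_cvg (ltW q0) q0 t0.
    apply: cvgM; first exact: cvg_cst.
    by apply: cvgM; [exact: cvg_cst|exact: IG_cvg].
  have h : moment q t + (t - s) * (phi q * moment (q + alpha) t) <= moment q s.
    by apply: (ler_cvg_to L (IG_cvg (ltW q0) q0 s0)); exact: nearW.
  by lra.
- have K n : IG q q (e_ n) s <= IG q q (e_ n) t + (t - s) * (phi q * moment (q + alpha) s).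
    have e0 := e_gt0 n.
    have := @has_rderiv_mono R _ _ _ _ _ _ s t (proj2 ev _ (aG q q0 e0))
      (is_derive_affine 0 1)
      (is_derive_affine (phi q * moment (q + alpha) s) 0) s0 st.
    rewrite -!/(IG _ _ _ _) !mul0r !add0r !addr0 => H.
    suff /H : forall x, s < x -> x < t ->
      0 <= \int[sigma x]_(y in `]0, 1]) frag_gen alpha B (G q q (e_ n)) y * (0 * x + 1) +
        IG q q (e_ n) x * 0 + phi q * moment (q + alpha) s.
      by lra.
    move=> x sx xt; have x0 : 0 <= x by apply/ltW/(le_lt_trans s0).
    have : - phi q * moment (q + alpha) x <=
        \int[sigma x]_(y in `]0, 1]) frag_gen alpha B (G q q (e_ n)) y.
      rewrite /moment -RintegralZl; [|exact: mI01|exact: integrable_powR].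
      apply: le_Rintegral; [exact: mI01| | |].
      - exact: (integrableZl mI01 (- phi q) (integrable_powR qa x0)).
      - by apply: (integrable_frag_gen alpha_lt0 B_fin ev x0); exact: aG.
      - by move=> y /=; rewrite in_itv/= => /andP[y0 y1]; exact: gen_ge.
    have := ler_wpM2l p0 (moment_nincr qa s0 (ltW sx)).
    by lra.
  have L : IG q q (e_ n) t + (t - s) * (phi q * moment (q + alpha) s) @[n --> \oo] -->
      moment q t + (t - s) * (phi q * moment (q + alpha) s).
    by apply: cvgD; [exact: IG_cvg (ltW q0) q0 t0|exact: cvg_cst].
  have h : moment q s <= moment q t + (t - s) * (phi q * moment (q + alpha) s).
    by apply: (ler_cvg_to (IG_cvg (ltW q0) q0 s0) L); exact: nearW.
  by lra.
Qed.

End moments.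

(** * The mass created by one dislocation *)

(** Mean value theorem; 1/4 is the starting point of the dyadic intervals to which the bound is
    applied. *)
Lemma powR_sub1_le (R : realType) (alpha z : R) : alpha <= 0 -> 4^-1 <= z -> z <= 1 ->
  z `^ alpha - 1 <= - alpha * 4^-1 `^ (alpha - 1) * (1 - z).
Proof.
move=> al0 z4; rewrite le_eqVlt => /predU1P[->|z1].
  by rewrite powR1 !subrr mulr0.
have p4 : 0 < 4^-1 :> R by rewrite invr_gt0.
have z0 : 0 < z by exact: lt_le_trans z4.
have [||c] := @MVT R (fun x => x `^ alpha) (fun x => alpha * x `^ (alpha - 1)) z 1 z1.
- move=> x; rewrite in_itv/= => /andP[zx _].
  by apply: is_derive1_powR; exact: lt_trans zx.
- apply: derivable_within_continuous => x; rewrite in_itv/= => /andP[zx _].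
  by have [] := is_derive1_powR alpha (lt_le_trans z0 zx).
rewrite in_itv/= powR1 => /andP[zc c1] E.
have H : c `^ (alpha - 1) <= 4^-1 `^ (alpha - 1).
  apply: le0_ler_powR => //; first by rewrite subr_le0 (le_trans al0).
  exact: le_trans (ltW zc).
have := ler_wpM2l (mulr_ge0 (_ : 0 <= - alpha) (_ : 0 <= 1 - z)) H.
rewrite oppr_ge0 subr_ge0 => /(_ al0 (ltW z1)).
set u := c `^ _ in E *; set v := _ `^ _; set w := z `^ _ in E *.
by lra.
Qed.

Section one_jump.
Context {R : realType} (alpha : R) (B : borel_measure R)
  (sigma : R -> borel_measure R).
Hypothesis alpha_lt0 : alpha < 0.
Hypothesis B_fin : (\int[B]_(y in `]0%R, 1%R[%classic) (y * (1 - y))%:E < +oo)%E.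
Hypothesis B_gt0 : (0 < B `]0%R, 1%R[%classic)%E.
Hypothesis ev : evolves alpha B sigma.
Hypothesis hB : (frag_phi_infty B < +oo)%E.

Let mO : measurable (`]0%R, 1%R[%classic : set (measurableTypeR R)).
Proof. exact: measurable_itv. Qed.

Let phi := fine (frag_phi_infty B).
Let s0 := fine (sigma 0 [set 1]).

Lemma frag_phi_infty_gt0 : (0 < frag_phi_infty B)%E.
Proof.
apply: integral_pos => //.
by move=> x; rewrite /= in_itv/= => /andP[].
Qed.

Let phi_gt0 : 0 < phi.
Proof. by rewrite fine_gt0// frag_phi_infty_gt0 hB. Qed.

Let s0_ge0 : 0 <= s0. Proof. by rewrite fine_ge0. Qed.

Let atomE (t : R) : 0 <= t -> fine (sigma t [set 1]) = s0 * expR (- phi * t).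
Proof.
move=> t0; rewrite (atom_evolution alpha_lt0 B_fin ev t0).
have fn : frag_phi_infty B \is a fin_num by rewrite ge0_fin_numE// ltW// frag_phi_infty_gt0.
rewrite -(fineK fn) -/phi -(fineK (atom_fin_num ev (lexx 0))) -/s0 -EFinM /=.
by rewrite mulrC [t * _]mulrC mulNr.
Qed.

(** For z <= w, the indicator of ]z,w]; written as a difference, it telescopes over adjacent
    intervals. *)
Definition gap_ind (z w x : R) : R := (z < x)%R%:R - (w < x)%R%:R.

Let gap_le1 (z w x : R) : `|gap_ind z w x| <= 1.
Proof.
by rewrite /gap_ind; case: (z < x); case: (w < x); rewrite ?subrr ?subr0 ?sub0r ?normrN ?normr1 ?normr0.
Qed.

Let gap_ge0 (z w x : R) : z <= w -> 0 <= gap_ind z w x.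
Proof.
rewrite /gap_ind => zw; have [wx|_] := ltP w x; last by rewrite subr0.
by rewrite (le_lt_trans zw wx) subrr.
Qed.

Let measurable_gap (D : set (measurableTypeR R)) (z w : R) : measurable D ->
  measurable_fun D (gap_ind z w).
Proof.
have H (v : R) : measurable D -> measurable_fun D (fun x : measurableTypeR R => (v < x)%R%:R : R).
  move=> mD; have -> : (fun x : measurableTypeR R => (v < x)%R%:R : R) =
      \1_(`]v, +oo[%classic : set (measurableTypeR R)).
    apply/funext => x; rewrite indicE; congr (_%:R); congr nat_of_bool.
    by apply/idP/idP => [vx|/set_mem/=]; [rewrite inE/=|]; rewrite in_itv/= andbT.
  by apply: measurable_indic; exact: measurable_itv.
by move=> mD; apply: measurable_funB; exact: H.
Qed.

(** Two ramps of width 1/(n+1), rising to the right of [z] and falling to the right of [w]: for z <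
    w the limit is 0 at [z] and 1 at [w], whence the half-open intervals. *)
Let bump (z w : R) (n : nat) (x : R) : R :=
  smooth_step (n.+1%:R * x + (- n.+1%:R * z)) *
  smooth_step (- n.+1%:R * x + (n.+1%:R * w + 1)).

Let bump_admissible (z w : R) n : 0 < z -> admissible (bump z w n).
Proof.
move=> z0; split; first by apply: C1posM; exact: C1pos_step.
exists z => // x x0 xz; rewrite /bump step_eq0 ?mul0r//.
by rewrite mulNr -mulrBr mulr_ge0_le0// subr_le0.
Qed.

Let bump_ge0 z w n x : 0 <= bump z w n x.
Proof. by rewrite mulr_ge0 ?step_ge0. Qed.

Let bump_le1 z w n x : bump z w n x <= 1.
Proof. by rewrite mulr_ile1 ?step_ge0 ?step_le1. Qed.

Let bump0 (z w x : R) n : x <= z -> bump z w n x = 0.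
Proof.
move=> xz; rewrite /bump step_eq0 ?mul0r//.
by rewrite mulNr -mulrBr mulr_ge0_le0// subr_le0.
Qed.

Let bump_cvg (z w x : R) : z <= w -> bump z w n x @[n --> \oo] --> gap_ind z w x.
Proof.
move=> zw; rewrite /gap_ind.
have big (d : R) : 0 < d -> \forall n \near \oo, 1 <= n.+1%:R * d.
  move=> d0; have [k hk] : exists k : nat, d^-1 <= k%:R.
    by exists (Num.trunc d^-1).+1; apply/ltW/truncnS_gt.
  exists k => // n /= kn; rewrite -ler_pdivrMr// div1r (le_trans hk)// ler_nat.
  exact: leqW.
have [zx|xz] := ltP z x; last first.
  rewrite ltNge (le_trans xz zw)/= subrr.
  by apply: cvg_near_cst; apply: nearW => n; exact: bump0.
have [wx|xw] := ltP w x.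
  rewrite subrr; apply: cvg_near_cst.
  have := big (x - w); rewrite subr_gt0 => /(_ wx); apply: filterS => n nd.
  rewrite /bump [X in _ * X]step_eq0 ?mulr0//.
  by move: nd; rewrite mulrBr; lra.
rewrite subr0; apply: cvg_near_cst.
have := big (x - z); rewrite subr_gt0 => /(_ zx); apply: filterS => n nd.
rewrite /bump !step_eq1 ?mulr1//.
  have : n.+1%:R * x <= n.+1%:R * w by rewrite ler_wpM2l.
  by lra.
by move: nd; rewrite mulrBr; lra.
Qed.

(** The rate at which a unit mass at 1 feeds ]z,w] by a single dislocation. *)
Let kap (z w : R) := \int[B]_(y in `]0, 1[) (gap_ind z w y * y).

(* Solving the differential inequality satisfied by the mass of the fragments
   near ]z,w], with creation rate at least the one from the atom at 1 and
   destruction rate at most [phi z^alpha]. *)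
Let one_jump_bump (z w t : R) n : 0 < z -> z < 1 -> 0 <= t ->
  s0 * (\int[B]_(y in `]0, 1[) (bump z w n y * y)) / (phi * (z `^ alpha - 1)) *
    (1 - expR (- (phi * (z `^ alpha - 1)) * t))
  <= expR (phi * t) * \int[sigma t]_(x in `]0, 1]) bump z w n x.
Proof.
move=> z0 z1 t0; set K := \int[B]_(y in _) _.
have K0 : 0 <= K.
  apply: Rintegral_ge0 => y /=; rewrite in_itv/= => /andP[y0 _].
  by rewrite mulr_ge0// ltW.
pose za := z `^ alpha.
have za1 : 1 < za.
  have : z `^ (- alpha) < 1.
    have na : 0 < - alpha by rewrite oppr_gt0.
    have := gt0_ltr_powR na _ _ z1; rewrite powR1; apply; rewrite nnegrE//.
    exact: ltW.
  by rewrite powRN invf_lt1// powR_gt0.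
pose k := phi * (za - 1); have k0 : 0 < k by rewrite mulr_gt0// subr_gt0.
have ag := bump_admissible w n z0.
have ii := integrable_id_dislocation hB.
have ib : B.-integrable `]0%R, 1%R[%classic (EFin \o (fun y : R => bump z w n y * y)).
  apply: (le_integrable mO _ _ ii).
    apply/measurable_EFinP; apply: measurable_funM => //.
    apply: measurable_funS (measurable_admissible ag) => //.
    by move=> y; rewrite /= !in_itv/= => /andP[-> /ltW].
  move=> y; rewrite /= in_itv/= => /andP[y0 _].
  by rewrite lee_fin normrM ger0_norm// ler_piMl.
(* Only the gain coming from the point 1 is kept. Where the bump is nonzero x^alpha is at most [za],
   and [za > 1] covers the loss at 1 too. *)
have key x : 0 < x -> x <= 1 ->
    - (phi * za) * bump z w n x + K * (x == 1)%:R <= frag_gen alpha B (bump z w n) x.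
  move=> x0 x1; rewrite /frag_gen; have [->|xn1] := eqVneq x 1.
    rewrite powR1 mul1r mulr1.
    have -> : \int[B]_(y in `]0, 1[) ((bump z w n (y * 1) - bump z w n 1) * y) =
        K - bump z w n 1 * phi.
      rewrite /K /phi -[fine _]/(\int[B]_(y in `]0, 1[) y) -RintegralZl// -RintegralB//.
        by apply: eq_Rintegral => y _; rewrite mulr1 mulrBl.
      exact: (integrableZl mO (bump z w n 1) ii).
    have := mulr_ge0 (ltW phi_gt0) (bump_ge0 z w n 1).
    by nra.
  rewrite mulr0 addr0.
  have [xz|zx] := leP x z.
    rewrite (@eq_Rintegral _ _ _ B _ (fun=> 0)).
      by rewrite Rintegral_cst// mul0r mulr0 bump0// mulr0.
    move=> y; rewrite inE/= in_itv/= => /andP[y0 y1].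
    have yxx : y * x <= x by rewrite ler_piMl// ltW.
    by rewrite !bump0 ?subrr ?mul0r// (le_trans yxx).
  have H := increment_integral_ge B_fin hB ag (fun x _ => bump_ge0 z w n x) x0.
  rewrite -/phi in H.
  apply: le_trans (ler_wpM2l (powR_ge0 x alpha) H).
  have xza : x `^ alpha <= za by apply: le0_ler_powR; rewrite ?ltW.
  have := ler_wpM2r (mulr_ge0 (ltW phi_gt0) (bump_ge0 z w n x)) xza.
  by lra.
have HR := proj2 ev _ ag.
(* Under the integrating factor exp(phi za t), the creation term s0 K exp(-phi t) becomes s0 K
   exp(kt); the second function is minus a primitive of it. *)
have := @has_rderiv_mono R _ _ _ _ _ _ 0 t HR
  (is_derive_expR_scale 1 (phi * za)) (is_derive_expR_scale (- (s0 * K / k)) k) (lexx 0) t0.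
rewrite !mulr0 expR0 !mulr1 !mul1r => M.
have {}M : - (s0 * K / k) <= (\int[sigma t]_(x in `]0, 1]) bump z w n x) *
    expR (phi * za * t) - s0 * K / k * expR (k * t).
  rewrite mulNr in M.
  apply: le_trans (M _); last first.
    move=> x x0 xt; have x0' := ltW x0.
    have i1 := integrable_frag_gen alpha_lt0 B_fin ev x0' ag.
    have i2 := integrableZl mI01 (- (phi * za)) (integrable_admissible ev x0' ag).
    have m1 : measurable ([set 1] : set (measurableTypeR R)) by [].
    have mi : measurable_fun (`]0%R, 1%R]%classic : set (measurableTypeR R))
        (fun y : measurableTypeR R => (y == 1)%:R : R).
      have -> : (fun y : measurableTypeR R => (y == 1)%:R : R) = \1_([set 1] : set (measurableTypeR R)).
        apply/funext => y; rewrite indicE; congr (_%:R); congr nat_of_bool.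
        by apply/idP/idP => [/eqP ->|/set_mem/= ->//]; rewrite inE.
      exact: measurable_indic.
    have i3' : (sigma x).-integrable `]0%R, 1%R]%classic (EFin \o (fun y : R => (y == 1)%:R : R)).
      apply: (bounded_integrable mI01 (evolves_lty ev x0') mi (C:=1)) => y _.
      by case: (y == 1); rewrite ?normr1 ?normr0.
    have i3 := integrableZl mI01 K i3'.
    have : - (phi * za) * (\int[sigma x]_(y in `]0, 1]) bump z w n y) +
        K * (s0 * expR (- phi * x)) <=
        \int[sigma x]_(y in `]0, 1]) frag_gen alpha B (bump z w n) y.
      have -> : s0 * expR (- phi * x) = \int[sigma x]_(y in `]0, 1]) ((y == 1)%:R : R).
        rewrite -atomE// /Rintegral.
        have := integral_indic (sigma x) mI01 m1.
        have -> : [set 1] `&` `]0, 1]%classic = [set 1] :> set (measurableTypeR R).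
          by apply/setIidl => y ->; rewrite /= in_itv/= ltr01 lexx.
        move=> <-; congr fine; apply: eq_integral => y _.
        rewrite indicE; congr (_%:R%:E); congr nat_of_bool.
        by apply/idP/idP => [/set_mem/= ->//|/eqP ->]; rewrite inE.
      have ia := integrable_admissible ev x0' ag.
      rewrite -(RintegralZl (- (phi * za)) mI01 ia) -(RintegralZl K mI01 i3').
      rewrite -(RintegralD mI01 i2 i3).
      apply: le_Rintegral; [exact: mI01|exact: (integrableD mI01 i2 i3)|exact: i1|].
      by move=> y /=; rewrite in_itv/= => /andP[y0 y1]; exact: key.
    set F := \int[_]_(_ in _) frag_gen _ _ _ _; set U := \int[_]_(_ in _) bump _ _ _ _ => h.
    have kE : expR (k * x) = expR (phi * za * x) * expR (- phi * x).
      by rewrite -expRD; congr expR; rewrite /k; ring.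
    have -> : - (s0 * K / k) * (k * expR (k * x)) =
        - (s0 * K) * (expR (phi * za * x) * expR (- phi * x)).
      by rewrite kE; field; rewrite gt_eqF.
    by have := ler_wpM2l (expR_ge0 (phi * za * x)) h; lra.
  rewrite lerDr; apply: Rintegral_ge0 => y _; exact: bump_ge0.
rewrite -/za -/k.
set U := \int[_]_(_ in _) bump _ _ _ _ in M *.
have E1 : expR (phi * za * t) = expR (k * t) * expR (phi * t).
  by rewrite -expRD; congr expR; rewrite /k; ring.
rewrite E1 in M.
have E2 : expR (- k * t) * expR (k * t) = 1.
  by rewrite -expRD mulNr addNr expR0.
have := ler_wpM2l (expR_ge0 (- k * t)) M.
have -> : expR (- k * t) * (U * (expR (k * t) * expR (phi * t)) - s0 * K / k * expR (k * t)) =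
   (expR (- k * t) * expR (k * t)) * (U * expR (phi * t) - s0 * K / k) by ring.
rewrite E2 mul1r.
by lra.
Qed.

Lemma one_jump (z w t : R) : 0 < z -> z < 1 -> z <= w -> 0 <= t ->
  s0 * kap z w / (phi * (z `^ alpha - 1)) *
    (1 - expR (- (phi * (z `^ alpha - 1)) * t))
  <= expR (phi * t) * \int[sigma t]_(x in `]0, 1]) gap_ind z w x.
Proof.
move=> z0 z1 zw t0; set c := _ * (_ - 1).
have H1 : \int[sigma t]_(x in `]0, 1]) bump z w n x @[n --> \oo] -->
    \int[sigma t]_(x in `]0, 1]) gap_ind z w x.
  apply: (Rintegral_bounded_cvg mI01 (evolves_lty ev t0) (C:=1)).
  - by move=> n; exact: (measurable_admissible (bump_admissible w n z0)).
  - by move=> n x _; rewrite ger0_norm.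
  - by move=> x _; exact: bump_cvg.
have H2 : \int[B]_(y in `]0, 1[) (bump z w n y * y) @[n --> \oo] --> kap z w.
  have mb n : measurable_fun (`]0%R, 1%R[%classic : set R) (fun y : R => bump z w n y * y).
    apply: measurable_funM => //.
    apply: measurable_funS (measurable_admissible (bump_admissible w n z0)) => //.
    by move=> y; rewrite /= !in_itv/= => /andP[-> /ltW].
  apply: (@Rintegral_dominated_cvg _ _ _ B _ _ _ (fun y => y) mO).
  - exact: mb.
  - by apply: measurable_funM => //; exact: measurable_gap.
  - by apply: aeW => y _; apply: cvgM; [exact: bump_cvg|exact: cvg_cst].
  - exact: integrable_id_dislocation.
  - move=> n y; rewrite /= in_itv/= => /andP[y0 _].
    by rewrite normrM ger0_norm// (gtr0_norm y0) ler_piMl// ltW.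
have L1 : s0 * (\int[B]_(y in `]0, 1[) (bump z w n y * y)) / c * (1 - expR (- c * t))
    @[n --> \oo] --> s0 * kap z w / c * (1 - expR (- c * t)).
  apply: cvgM; last exact: cvg_cst.
  apply: cvgM; last exact: cvg_cst.
  by apply: cvgM; [exact: cvg_cst|exact: H2].
have L2 : expR (phi * t) * \int[sigma t]_(x in `]0, 1]) bump z w n x @[n --> \oo] -->
    expR (phi * t) * \int[sigma t]_(x in `]0, 1]) gap_ind z w x.
  by apply: cvgM; [exact: cvg_cst|exact: H1].
apply: (ler_cvg_to L1 L2); apply: nearW => n.
exact: one_jump_bump.
Qed.

(* Dyadic intervals ]z_i,z_{i+1}], on which [1 - x] and [z_i^alpha - 1] are
   comparable. *)
Let z_ (i : nat) : R := 1 - 3 / 4 * (2^-1) ^+ i.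

Let z_ge i : 4^-1 <= z_ i.
Proof.
have : (2^-1 : R) ^+ i <= 1 by rewrite exprn_ile1// invf_le1// ler1n.
by rewrite /z_; lra.
Qed.

Let z_lt1 i : z_ i < 1.
Proof.
have : 0 < (2^-1 : R) ^+ i by rewrite exprn_gt0// invr_gt0.
by rewrite /z_; lra.
Qed.

Let z_S i : 1 - z_ i = 2 * (1 - z_ i.+1).
Proof. by rewrite /z_ exprS; field. Qed.

Let z_mono i j : (i <= j)%N -> z_ i <= z_ j.
Proof.
move=> ij; have : (2^-1 : R) ^+ j <= 2^-1 ^+ i.
  by apply: ler_wiXn2l => //; rewrite ?invr_ge0 ?invf_le1 ?ler1n.
by rewrite /z_; lra.
Qed.

Let z_gt0 i : 0 < z_ i. Proof. by apply: lt_le_trans (z_ge i); rewrite invr_gt0. Qed.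

Let k_ (i : nat) : R := z_ i `^ alpha - 1.

Let k_gt0 i : 0 < k_ i.
Proof.
have : z_ i `^ (- alpha) < 1.
  have na : 0 < - alpha by rewrite oppr_gt0.
  have := gt0_ltr_powR na _ _ (z_lt1 i); rewrite powR1; apply; rewrite nnegrE//.
  exact/ltW/z_gt0.
by rewrite powRN invf_lt1 ?powR_gt0 ?z_gt0// subr_gt0.
Qed.

Let S_ n := \sum_(0 <= i < n) (kap (z_ i) (z_ i.+1) / k_ i).

Let gap_add (x y w v : R) : gap_ind x y v + gap_ind y w v = gap_ind x w v.
Proof. by rewrite /gap_ind; ring. Qed.

Let integrable_gap (x y t : R) : 0 <= t ->
  (sigma t).-integrable `]0%R, 1%R]%classic (EFin \o gap_ind x y).
Proof.
move=> t0; apply: (bounded_integrable mI01 (evolves_lty ev t0) (C:=1)).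
  by apply: measurable_gap; exact: mI01.
by move=> w _; exact: gap_le1.
Qed.

Let sum_gap n t : 0 <= t ->
  \sum_(0 <= i < n) \int[sigma t]_(x in `]0, 1]) gap_ind (z_ i) (z_ i.+1) x =
  \int[sigma t]_(x in `]0, 1]) gap_ind (z_ 0) (z_ n) x.
Proof.
move=> t0; elim: n => [|n IH].
  rewrite big_geq// (@eq_Rintegral _ _ _ _ _ (fun=> 0)).
    by rewrite Rintegral_cst ?mul0r//; exact: mI01.
  by move=> x _; rewrite /gap_ind subrr.
rewrite big_nat_recr//= IH -RintegralD; [|exact: mI01|exact: integrable_gap..].
by apply: eq_Rintegral => x _; rewrite gap_add.
Qed.

Let kap_ge0 i : 0 <= kap (z_ i) (z_ i.+1).
Proof.
apply: Rintegral_ge0 => y /=; rewrite in_itv/= => /andP[y0 _].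
by rewrite mulr_ge0 ?(ltW y0)// gap_ge0// z_mono.
Qed.

(** [one_jump] summed over disjoint intervals; every relaxation factor is bounded below by that of
    [k_ n], the slowest since [k_] is nonincreasing. *)
Let mass_ge n t : 0 <= t ->
  s0 / phi * S_ n * (1 - expR (- (phi * k_ n) * t)) <= expR (phi * t) * moment sigma 0 t.
Proof.
move=> t0; apply: (@le_trans _ _ (expR (phi * t) *
    \int[sigma t]_(x in `]0, 1]) gap_ind (z_ 0) (z_ n) x)); last first.
  rewrite ler_wpM2l ?expR_ge0//; apply: le_Rintegral; [exact: mI01|exact: integrable_gap| |].
    exact: (integrable_powR ev (lexx 0) t0).
  by move=> x _; rewrite powRr0; have := gap_le1 (z_ 0) (z_ n) x; rewrite ler_norml => /andP[].
rewrite -(sum_gap n t0) /S_ !mulr_sumr mulr_suml; apply: ler_sum_nat => i /andP[_ ni].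
have := one_jump (z_gt0 i) (z_lt1 i) (z_mono (leqnSn i)) t0; rewrite -/(k_ i).
apply: le_trans.
have -> : s0 / phi * (kap (z_ i) (z_ i.+1) / k_ i) = s0 * kap (z_ i) (z_ i.+1) / (phi * k_ i).
  by field; rewrite !gt_eqF.
apply: ler_wpM2l.
  by rewrite divr_ge0 ?mulr_ge0// ltW// mulr_gt0.
rewrite lerD2l lerN2 ler_expR ler_wpM2r// lerN2 ler_wpM2l ?(ltW phi_gt0)//.
by rewrite lerD2r le0_ler_powR ?(ltW alpha_lt0)// z_mono// ltnW.
Qed.

(** The factor 8 is 2, from 1 - z_i = 2 (1 - z_{i+1}), times 4, from y >= 1/4; the rest comes from
    [powR_sub1_le]. *)
Let D_ : R := 8 * (- alpha * 4^-1 `^ (alpha - 1)).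

Let D_ge0 : 0 <= D_.
Proof. by rewrite !mulr_ge0 ?powR_ge0// oppr_ge0 ltW. Qed.

Let J_ i : set (measurableTypeR R) := `]z_ i, z_ i.+1]%classic.

Let mJ i : measurable (J_ i). Proof. exact: measurable_itv. Qed.

Let measurable_inv1 (E : set (measurableTypeR R)) : measurable E ->
  E `<=` `]0%R, 1%R[%classic -> measurable_fun E (fun x : measurableTypeR R => (1 - x)^-1 : R).
Proof.
move=> mE sE; apply: subspace_continuous_measurable_fun => //.
apply: continuous_in_subspaceT => x; rewrite inE => /sE.
rewrite /= in_itv/= => /andP[_ x1].
apply: cvgV; first by rewrite subr_eq0 gt_eqF.
by apply: cvgB; [exact: cvg_cst|exact: cvg_id].
Qed.

Let J_sub i : J_ i `<=` `]0%R, 1%R[%classic.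
Proof.
move=> x; rewrite /J_ /= !in_itv/= => /andP[zx xz].
by rewrite (lt_trans (z_gt0 i) zx) (le_lt_trans xz (z_lt1 _)).
Qed.

Let kapE i : (\int[B]_(y in J_ i) y%:E)%E = (kap (z_ i) (z_ i.+1))%:E.
Proof.
have mg := measurable_gap (z_ i) (z_ i.+1) mO.
rewrite /kap /Rintegral fineK; last first.
  apply: integrable_fin_num => //.
  apply: (le_integrable mO _ _ (integrable_id_dislocation hB)).
    by apply/measurable_EFinP; exact: measurable_funM.
  move=> y; rewrite /= in_itv/= => /andP[y0 _].
  by rewrite lee_fin normrM ler_piMl.
rewrite -(setIidr (@J_sub i)) integral_mkcondr; apply: eq_integral => y _.
rewrite patchE /gap_ind; case: ifPn => [|/negP].
  rewrite inE /J_ /= in_itv/= => /andP[-> /=]; rewrite leNgt => /negbTE ->.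
  by rewrite subr0 mul1r.
rewrite inE /J_ /= in_itv/= => /negP; rewrite negb_and -leNgt -ltNge => /orP[yz|zy].
  rewrite !ltNge yz (le_trans yz (z_mono (leqnSn i)))/= subrr mul0r//.
by rewrite (le_lt_trans (z_mono (leqnSn i)) zy) zy subrr mul0r.
Qed.

Let int_J_le i : (\int[B]_(y in J_ i) ((1 - y)^-1)%:E <=
  (D_ * (kap (z_ i) (z_ i.+1) / k_ i))%:E)%E.
Proof.
have Dk0 : 0 <= D_ / k_ i by rewrite divr_ge0 ?(ltW (k_gt0 i)).
have -> : D_ * (kap (z_ i) (z_ i.+1) / k_ i) = D_ / k_ i * kap (z_ i) (z_ i.+1) by ring.
rewrite EFinM -kapE -ge0_integralZl_EFin//; last first.
  by move=> y /J_sub; rewrite /= in_itv/= => /andP[y0 _]; rewrite lee_fin ltW.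
apply: ge0_le_integral => //.
- by move=> y /J_sub; rewrite /= in_itv/= => /andP[_ y1]; rewrite lee_fin invr_ge0 subr_ge0 ltW.
- by apply/measurable_EFinP; apply: measurable_inv1.
- by apply/measurable_EFinP; apply: measurable_funM.
move=> y; rewrite /J_ /= in_itv/= => /andP[zy yz]; rewrite -EFinM lee_fin.
have y4 : 4^-1 <= y by rewrite (le_trans (z_ge i))// ltW.
have k0 := k_gt0 i.
have y1 : 0 < 1 - y by rewrite subr_gt0 (le_lt_trans yz).
rewrite mulrAC ler_pdivlMr// [leLHS]mulrC ler_pdivrMr//.
have := powR_sub1_le (ltW alpha_lt0) (z_ge i) (ltW (z_lt1 i)); rewrite -/(k_ i) z_S.
have p0 : 0 <= - alpha * 4^-1 `^ (alpha - 1) by rewrite mulr_ge0 ?powR_ge0// oppr_ge0 ltW.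
rewrite /D_; move: (- alpha * _) p0 => C C0 h; apply: le_trans h _.
have h1 : 1 - z_ i.+1 <= 1 - y by rewrite lerD2l lerN2.
have h2 : 2 * (1 - z_ i.+1) <= 8 * y * (1 - y).
  have : 4^-1 * (1 - y) <= y * (1 - y) by rewrite ler_wpM2r// ltW.
  by lra.
have := ler_wpM2l C0 h2; lra.
Qed.

Let A_ n : \bar R := (\int[B]_(y in `]z_ 0, z_ n]%classic) ((1 - y)^-1)%:E)%E.

Let A_le n : (A_ n <= (D_ * S_ n)%:E)%E.
Proof.
elim: n => [|n IH].
  by rewrite /A_ /S_ set_itv_ge ?bnd_simp ?ltxx// integral_set0 big_geq// mulr0.
have zU : `]z_ 0, z_ n.+1]%classic = `]z_ 0, z_ n] `|` J_ n :> set (measurableTypeR R).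
  by rewrite /J_ -itv_bndbnd_setU// bnd_simp z_mono.
have sub : `]z_ 0, z_ n.+1]%classic `<=` (`]0%R, 1%R[%classic : set (measurableTypeR R)).
  move=> x; rewrite /= !in_itv/= => /andP[zx xz].
  by rewrite (lt_trans (z_gt0 0) zx) (le_lt_trans xz (z_lt1 _)).
rewrite /A_ zU ge0_integral_setU//.
- rewrite /S_ big_nat_recr//= mulrDr EFinD; apply: leeD; [exact: IH|exact: int_J_le].
- rewrite -zU; apply/measurable_EFinP; apply: measurable_inv1 => //; exact: measurable_itv.
- rewrite -zU => x /sub; rewrite /= in_itv/= => /andP[_ x1].
  by rewrite lee_fin invr_ge0 subr_ge0 ltW.
- apply/disj_setPS => x [/=]; rewrite /J_ /= !in_itv/= => /andP[_ xz] /andP[zx _].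
  by move: (lt_le_trans zx xz); rewrite ltxx.
Qed.

Theorem exp_mass_unbounded :
  (\int[B]_(x in `[2^-1%R, 1%R[%classic) ((1 - x)^-1)%:E = +oo)%E -> 0 < s0 ->
  forall C : R, exists2 T : R, 0 <= T & forall t, T <= t ->
    C <= expR (phi * t) * moment sigma 0 t.
Proof.
move=> hdiv sp C.
have Acvg : A_ n @[n --> \oo] --> +oo%E.
  have mz n : measurable (`]z_ 0, z_ n]%classic : set (measurableTypeR R)).
    exact: measurable_itv.
  have sub n : `]z_ 0, z_ n]%classic `<=` (`]0%R, 1%R[%classic : set (measurableTypeR R)).
    move=> x; rewrite /= !in_itv/= => /andP[zx xz].
    by rewrite (lt_trans (z_gt0 0) zx) (le_lt_trans xz (z_lt1 _)).
  have U : \bigcup_n `]z_ 0, z_ n]%classic = `]z_ 0, 1[%classic :> set (measurableTypeR R).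
    apply/seteqP; split => x /=.
      by move=> [n _] /=; rewrite !in_itv/= => /andP[-> /=] /le_lt_trans; apply; exact: z_lt1.
    rewrite in_itv/= => /andP[zx x1].
    have x10 : 0 < 1 - x by rewrite subr_gt0.
    have c0 : (2^-1 : R) ^+ n @[n --> \oo] --> (0 : R).
      by apply: cvg_expr; rewrite gtr0_norm ?invr_gt0// invf_lt1// ltr1n.
    move/cvgr0_norm_lt : c0 => /(_ _ x10)[k _ hk].
    exists k => //=; rewrite in_itv/= zx/=; have := hk k (leqnn k).
    rewrite ger0_norm ?exprn_ge0 ?invr_ge0// /z_ => h.
    have : 0 <= (2^-1 : R) ^+ k by rewrite exprn_ge0// invr_ge0.
    by lra.
  have := @ge0_nondecreasing_set_cvg_integral _ _ R
    (fun n : nat => `]z_ 0, z_ n]%classic : set (measurableTypeR R))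
    (fun y => ((1 - y)^-1)%:E) B.
  rewrite U => H.
  (* Starting at 1/4, the intervals, open on the left, cover the point 1/2 as well. *)
  have E : (\int[B]_(x in `]z_ 0%N, 1%R[%classic) ((1 - x)^-1)%:E = +oo)%E.
    apply/eqP; rewrite -leye_eq -hdiv; apply: ge0_subset_integral.
    - exact: measurable_itv.
    - exact: measurable_itv.
    - apply/measurable_EFinP; apply: measurable_inv1; first exact: measurable_itv.
      by move=> x; rewrite /= !in_itv/= => /andP[zx ->]; rewrite (lt_trans (z_gt0 0)).
    - move=> x; rewrite /= in_itv/= => /andP[_ x1].
      by rewrite lee_fin invr_ge0 subr_ge0 ltW.
    - move=> x; rewrite /= !in_itv/= => /andP[x2 ->]; rewrite andbT.
      by apply: lt_le_trans x2; rewrite /z_ expr0; lra.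
  rewrite E in H; apply: H.
  - move=> m n mn; apply/subsetPset => x /=; rewrite !in_itv/= => /andP[-> /=].
    by move=> /le_trans; apply; exact: z_mono.
  - exact: mz.
  - by move=> n; apply/measurable_EFinP; exact: measurable_inv1.
  - move=> n x /sub; rewrite /= in_itv/= => /andP[_ x1].
    by rewrite lee_fin invr_ge0 subr_ge0 ltW.
(* [X] solves s0 / phi * X / 2 = |C|, where 1/2 is a lower bound of the relaxation factor for t
   beyond 1/(phi k_n). *)
pose X := 2 * `|C| * phi / s0.
have X0 : 0 <= X by rewrite divr_ge0 ?mulr_ge0// ltW.
have [n hn] : exists n, (((D_ + 1) * (X + 1))%:E <= A_ n)%E.
  move/cvgeyPge : Acvg => /(_ ((D_ + 1) * (X + 1))) [k _ hk].
  by exists k; exact: (hk k (leqnn k)).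
have SX : X <= S_ n.
  have := le_trans hn (A_le n); rewrite lee_fin => h.
  have [//|SX] := leP X (S_ n).
  have : D_ * S_ n <= D_ * X by rewrite ler_wpM2l// ltW.
  have : 0 <= D_ * X by rewrite mulr_ge0.
  by have := D_ge0; lra.
have kn : 0 < phi * k_ n by rewrite mulr_gt0.
exists ((phi * k_ n)^-1); first by rewrite invr_ge0 ltW.
move=> t tT; have t0 : 0 <= t by rewrite (le_trans _ tT)// invr_ge0 ltW.
apply: le_trans (ler_norm C) _; apply: le_trans (mass_ge n t0).
have e2 : expR (- (phi * k_ n) * t) <= 2^-1.
  rewrite mulNr expRN lef_pV2 ?posrE ?expR_gt0//.
  apply: le_trans (expR_ge1Dx _).
  have : 1 <= phi * k_ n * t by rewrite -ler_pdivrMl// mulr1.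
  by lra.
have : `|C| = s0 / phi * X * 2^-1 by rewrite /X; field; rewrite !gt_eqF.
move=> ->; apply: ler_pM => //.
- by rewrite mulr_ge0// divr_ge0// ltW.
- by rewrite ler_wpM2l// divr_ge0// ltW.
- by lra.
Qed.

End one_jump.

(** * Mixtures and the limit law *)

(** The inequalities of [decay_chain] without the bound by 1, which the normalised moments need not
    satisfy before they are mixed. *)
Definition power_chain (R : realType) (f : nat -> R -> R) : Prop :=
  forall k (s t : R), 0 <= s -> s <= t ->
    (t - s) * f k t <= f k.+1 s - f k.+1 t <= (t - s) * f k s.

Section mixture.
Context {R : realType} (a b : R) (rho : borel_measure R) (f : nat -> R -> R).
Hypotheses (a0 : 0 < a) (rho_fin : (rho `]0%R, b]%classic < +oo)%E).
Hypothesis f0 : forall k (t : R), 0 <= t -> 0 <= f k t.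
Hypothesis f_nincr : forall k (s t : R), 0 <= s -> s <= t -> f k t <= f k s.

Let mb : measurable (`]0%R, b]%classic : set (measurableTypeR R)).
Proof. exact: measurable_itv. Qed.

(** If f_{k+1}' = -f_k, then x^{a(k+1)} f_{k+1}(t x^{-a}) has time derivative -x^{ak} f_k(t x^{-a}):
    these weights are the ones that preserve the chain. *)
Definition mixture k (t : R) :=
  \int[rho]_(x in `]0, b]) (x `^ (a * k%:R) * f k (t * x `^ (- a))).

(** [f k] is measurable by monotonicity, once extended to negative times by its value at 0. *)
Lemma measurable_mixand k (t : R) : 0 <= t ->
  measurable_fun (`]0%R, b]%classic : set (measurableTypeR R))
    (fun x : measurableTypeR R => f k (t * x `^ (- a))).
Proof.
move=> t0.
have m1 : measurable_fun (setT : set (measurableTypeR R))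
    (fun s : measurableTypeR R => f k (Num.max s 0)).
  apply: nonincreasing_measurable => // x y xy; apply: f_nincr.
    by rewrite le_max lexx orbT.
  by rewrite ge_max !le_max xy lexx orbT.
have m2 : measurable_fun (`]0%R, b]%classic : set (measurableTypeR R))
    (fun x : measurableTypeR R => t * x `^ (- a) : measurableTypeR R).
  by apply: measurable_funM => //; exact: measurable_powR_on.
have := measurableT_comp m1 m2; congr (measurable_fun _ _).
by apply/funext => x /=; rewrite max_l// mulr_ge0// powR_ge0.
Qed.

Lemma integrable_mixand k (t : R) : 0 <= t ->
  rho.-integrable `]0%R, b]%classic
    (EFin \o (fun x => x `^ (a * k%:R) * f k (t * x `^ (- a)))).
Proof.
move=> t0; apply: (bounded_integrable mb rho_fin (C:=b `^ (a * k%:R) * f k 0)).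
  by apply: measurable_funM; [exact: measurable_powR_on|exact: measurable_mixand].
move=> x /=; rewrite in_itv/= => /andP[x0 xb].
have t' : 0 <= t * x `^ (- a) by rewrite mulr_ge0// powR_ge0.
rewrite ger0_norm; last by rewrite mulr_ge0 ?powR_ge0// f0.
apply: ler_pM; rewrite ?powR_ge0 ?f0//; last exact: f_nincr.
have ak : 0 <= a * k%:R by rewrite mulr_ge0// ltW.
by apply: (ge0_ler_powR ak) => //; rewrite nnegrE ltW// (lt_le_trans x0).
Qed.

Lemma mixture_ge0 k (t : R) : 0 <= t -> 0 <= mixture k t.
Proof.
move=> t0; apply: Rintegral_ge0 => x _; rewrite mulr_ge0 ?powR_ge0// f0//.
by rewrite mulr_ge0// powR_ge0.
Qed.

Lemma mixture_nincr k (s t : R) : 0 <= s -> s <= t -> mixture k t <= mixture k s.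
Proof.
move=> s0 st; have t0 := le_trans s0 st.
apply: (le_Rintegral mb (integrable_mixand k t0) (integrable_mixand k s0)) => x _.
rewrite ler_wpM2l ?powR_ge0// f_nincr ?mulr_ge0 ?powR_ge0//.
by rewrite ler_wpM2r ?powR_ge0.
Qed.

Lemma mixture_chain : power_chain f -> power_chain mixture.
Proof.
move=> cf k s t s0 st; have t0 := le_trans s0 st.
have is1 := integrable_mixand k.+1 s0; have it1 := integrable_mixand k.+1 t0.
have is0 := integrable_mixand k s0; have it0 := integrable_mixand k t0.
have key x : 0 < x ->
   (t - s) * (x `^ (a * k%:R) * f k (t * x `^ (- a))) <=
   x `^ (a * k.+1%:R) * f k.+1 (s * x `^ (- a)) -
   x `^ (a * k.+1%:R) * f k.+1 (t * x `^ (- a)) <=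
   (t - s) * (x `^ (a * k%:R) * f k (s * x `^ (- a))).
  move=> x0.
  have xa : 0 < x `^ (- a) by exact: powR_gt0.
  have s0' : 0 <= s * x `^ (- a) by rewrite mulr_ge0// ltW.
  have st' : s * x `^ (- a) <= t * x `^ (- a) by rewrite ler_wpM2r// ltW.
  have /andP[h1 h2] := cf k _ _ s0' st'.
  have E : x `^ (a * k%:R) = x `^ (a * k.+1%:R) * x `^ (- a).
    rewrite -powRD ?(gt_eqF x0) ?implybT//; congr (_ `^ _).
    by rewrite -natr1 mulrDr mulr1 addrK.
  have := ler_wpM2l (powR_ge0 x (a * k.+1%:R)) h1.
  have := ler_wpM2l (powR_ge0 x (a * k.+1%:R)) h2.
  rewrite E -!mulrBl; set y := x `^ (- a); set z := x `^ _.
  set f1 := f k.+1 _; set f2 := f k.+1 _; set f3 := f k _; set f4 := f k _.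
  by move=> q1 q2; apply/andP; split; lra.
rewrite /mixture -(RintegralB mb is1 it1) -(RintegralZl (t - s) mb it0)
  -(RintegralZl (t - s) mb is0).
apply/andP; split.
- apply: (le_Rintegral mb (integrableZl mb (t - s) it0) (integrableB mb is1 it1)).
  by move=> x /=; rewrite in_itv/= => /andP[/key/andP[]].
- apply: (le_Rintegral mb (integrableB mb is1 it1) (integrableZl mb (t - s) is0)).
  by move=> x /=; rewrite in_itv/= => /andP[/key/andP[]].
Qed.

End mixture.

(** The bound exp(u) >= 1 + u, at u = t - s and u = s - t. *)
Lemma exp_power_chain (R : realType) : power_chain (fun (_ : nat) (t : R) => expR (- t)).
Proof.
move=> _ s t s0 st.
have E : expR (- s) = expR (- t) * expR (t - s) by rewrite -expRD; congr expR; ring.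
have E' : expR (- t) = expR (- s) * expR (- (t - s)) by rewrite -expRD; congr expR; ring.
apply/andP; split.
- have := ler_wpM2l (expR_ge0 (- t)) (expR_ge1Dx (t - s)).
  by rewrite -E; lra.
- have := ler_wpM2l (expR_ge0 (- s)) (expR_ge1Dx (- (t - s))).
  by rewrite -E'; lra.
Qed.

Lemma Rintegral_atom (R : realType) (nu : borel_measure R) (b : R) : 0 < b ->
  \int[nu]_(x in `]0, b]) (x == b)%:R = fine (nu [set b]).
Proof.
move=> b0.
have m1 : measurable ([set b] : set (measurableTypeR R)) by exact: measurable_set1.
have E : (`]0%R, b]%classic : set (measurableTypeR R)) `&` [set b] = [set b].
  by apply/setIidr => x ->; rewrite /= in_itv/= b0 lexx.
rewrite /Rintegral -[in RHS]E setIC -integral_indic//; congr fine.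
apply: eq_integral => x _; rewrite indicE.
by case: eqP => [->|xb]; [rewrite mem_set|rewrite memNset].
Qed.

(** * Support and largest atom of the size-biased limit law *)

Section limit_law.
Context {R : realType} (B tau : borel_measure R) (a : R).
Hypothesis a_gt0 : 0 < a.
Hypothesis B_gt0 : (0 < B `]0%R, 1%R[%classic)%E.
Hypothesis hB : (frag_phi_infty B < +oo)%E.

Definition phi_prod n := \prod_(1 <= k < n.+1) frag_phi B (k%:R * a).

Hypothesis tau_mass : tau `]0%R, +oo[%classic = 1%E.
Hypothesis tau_moment : forall n : nat, (1 <= n)%N ->
  (\int[tau]_(x in `]0%R, +oo[%classic) (x `^ (a * n%:R))%:E = (phi_prod n)%:E)%E.

Let phi := fine (frag_phi_infty B).
Let c := phi `^ a^-1.

Let mO : measurable (`]0%R, 1%R[%classic : set (measurableTypeR R)).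
Proof. exact: measurable_itv. Qed.

Lemma fine_phi_infty_gt0 : 0 < phi.
Proof. by rewrite fine_gt0// (frag_phi_infty_gt0 B_gt0) hB. Qed.
Let phi_gt0 := fine_phi_infty_gt0.

Let c_gt0 : 0 < c. Proof. exact: powR_gt0. Qed.

Lemma root_phi_pow : c `^ a = phi.
Proof. by rewrite -powRrM mulVf ?gt_eqF// powRr1// ltW. Qed.
Let c_pow := root_phi_pow.

Let fphi_int q : 0 < q -> (frag_phi B q)%:E =
  (\int[B]_(x in `]0%R, 1%R[%classic) ((1 - x `^ q) * x)%:E)%E.
Proof.
move=> q0; rewrite fineK//; apply: integrable_fin_num => //.
by apply: integrable_phi => //; exact: ltW.
Qed.

Lemma powR_lt1 (q x : R) : 0 < q -> 0 < x -> x < 1 -> x `^ q < 1.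
Proof.
move=> q0 x0 x1; have := gt0_ltr_powR q0 _ _ x1; rewrite powR1; apply; rewrite nnegrE//.
exact: ltW.
Qed.

Lemma frag_phi_gt0 q : 0 < q -> 0 < frag_phi B q.
Proof.
move=> q0; rewrite -lte_fin fphi_int//; apply: integral_pos => //.
  apply: measurable_funM => //; apply: measurable_funB => //.
  exact: measurable_powR_on.
move=> x; rewrite /= in_itv/= => /andP[x0 x1].
by rewrite mulr_gt0// subr_gt0 powR_lt1.
Qed.

Let ii := integrable_id_dislocation hB.

Lemma phi_infty_subE q : 0 <= q ->
  phi - frag_phi B q = \int[B]_(x in `]0, 1[) (x `^ q * x).
Proof.
move=> q0; rewrite /phi -[fine _]/(\int[B]_(y in `]0, 1[) y).
rewrite -(RintegralB mO ii (integrable_phi hB q0)).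
by apply: eq_Rintegral => x _; ring.
Qed.

Lemma frag_phi_le q : 0 <= q -> frag_phi B q <= phi.
Proof.
move=> q0; rewrite -subr_ge0 phi_infty_subE//; apply: Rintegral_ge0 => x /=.
by rewrite in_itv/= => /andP[x0 _]; rewrite mulr_ge0 ?powR_ge0// ltW.
Qed.

Let ka_gt0 k : 0 < k.+1%:R * a. Proof. by rewrite mulr_gt0. Qed.

Lemma phi_prodS n : phi_prod n.+1 = phi_prod n * frag_phi B (n.+1%:R * a).
Proof. by rewrite /phi_prod big_nat_recr. Qed.

Lemma phi_prod0 : phi_prod 0 = 1.
Proof. by rewrite /phi_prod big_geq. Qed.

Lemma phi_prod_gt0 n : 0 < phi_prod n.
Proof. by elim: n => [|n IH]; rewrite ?phi_prod0// phi_prodS mulr_gt0// frag_phi_gt0. Qed.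

Lemma phi_prod_le n : phi_prod n <= phi ^+ n.
Proof.
elim: n => [|n IH]; first by rewrite phi_prod0 expr0.
rewrite phi_prodS exprSr; apply: ler_pM.
- exact: ltW (phi_prod_gt0 _).
- exact: ltW (frag_phi_gt0 (ka_gt0 _)).
- exact: IH.
- by apply: frag_phi_le; exact: ltW.
Qed.

Let Ic : set (measurableTypeR R) := `]0%R, c]%classic.
Let mIc : measurable Ic. Proof. exact: measurable_itv. Qed.

Let mP : measurable (`]0%R, +oo[%classic : set (measurableTypeR R)).
Proof. exact: measurable_itv. Qed.

(** Markov's inequality at order an: d^{an} tau[d,+oo[ <= phi^n, with phi < d^a. *)
Let tau_tail (d : R) : c < d -> tau `[d, +oo[%classic = 0%E.
Proof.
move=> cd; have d0 : 0 < d by exact: lt_trans cd.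
have da0 : 0 < d `^ a by exact: powR_gt0.
have mD : measurable (`[d, +oo[%classic : set (measurableTypeR R)) by exact: measurable_itv.
have dP : `[d, +oo[%classic `<=` (`]0%R, +oo[%classic : set R).
  by move=> x /=; rewrite !in_itv/= !andbT; exact: lt_le_trans.
have t1 : (tau `[d, +oo[%classic <= 1)%E.
  by rewrite -tau_mass; apply: le_measure; rewrite ?inE.
have fn : tau `[d, +oo[%classic \is a fin_num.
  by rewrite ge0_fin_numE//; apply: le_lt_trans t1 _; rewrite ltry.
have [r r0 E] : exists2 r : R, 0 <= r & tau `[d, +oo[%classic = r%:E.
  by exists (fine (tau `[d, +oo[%classic)); rewrite ?fine_ge0// fineK.
have key n : r <= (phi / d `^ a) ^+ n.
  case: n => [|n]; first by rewrite expr0 -lee_fin -E.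
  have dan : 0 < (d `^ a) ^+ n.+1 by rewrite exprn_gt0.
  have : (((d `^ a) ^+ n.+1)%:E * tau `[d, +oo[%classic <= (phi_prod n.+1)%:E)%E.
    rewrite -tau_moment// -integral_cst//.
    apply: (@le_trans _ _ (\int[tau]_(x in `[d, +oo[%classic) (x `^ (a * n.+1%:R))%:E)%E).
      apply: ge0_le_integral => //.
      - by move=> x _; rewrite lee_fin ltW.
      - by apply/measurable_EFinP; exact: measurable_powR_on.
      - move=> x /=; rewrite in_itv/= andbT => dx.
        rewrite lee_fin powRrM powR_mulrn ?powR_ge0//.
        apply: lerXn2r; rewrite ?nnegrE ?powR_ge0//.
        by apply: (ge0_ler_powR (ltW a_gt0)); rewrite ?nnegrE ?(ltW d0)// (le_trans (ltW d0)).
    apply: ge0_subset_integral => //.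
    - by apply/measurable_EFinP; exact: measurable_powR_on.
    - by move=> x _; rewrite lee_fin powR_ge0.
  rewrite E -EFinM lee_fin expr_div_n ler_pdivlMr// mulrC => /le_trans; apply.
  exact: phi_prod_le.
have H : (phi / d `^ a) ^+ n @[n --> \oo] --> (0 : R).
  apply: cvg_expr; rewrite ger0_norm ?divr_ge0 ?ltW// ltr_pdivrMr// mul1r -c_pow.
  by apply: gt0_ltr_powR; rewrite ?nnegrE ?ltW.
rewrite E; congr (_%:E); apply/le_anti; rewrite r0 andbT.
by apply: (cvgr_to_ge H); apply: nearW.
Qed.

Lemma limit_law_gt : tau `]c, +oo[%classic = 0%E.
Proof.
have mn (n : nat) : measurable (`[c + n.+1%:R^-1, +oo[%classic : set (measurableTypeR R)).
  exact: measurable_itv.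
have N : tau.-negligible (\bigcup_n `[c + n.+1%:R^-1, +oo[%classic).
  apply: negligible_bigcup => n; apply: (proj2 (negligibleP tau (mn n))).
  by apply: tau_tail; rewrite ltrDl.
apply/negligibleP => //; apply: negligibleS N.
move=> x /=; rewrite in_itv/= andbT => cx.
have [n hn] := ltr_add_invr cx.
by exists n => //=; rewrite in_itv/= andbT ltW.
Qed.

Lemma limit_law_mass : tau Ic = 1%E.
Proof.
have C (D : set (measurableTypeR R)) : measurable D -> tau D = (\int[tau]_(x in D) 1)%E.
  by move=> mD; rewrite integral_cst// mul1e.
by rewrite C// -(integral_null_tail limit_law_gt)// -C.
Qed.

Lemma limit_law_moment n : \int[tau]_(x in Ic) x `^ (a * n%:R) = phi_prod n.
Proof.
case: n => [|n].
  under eq_Rintegral do rewrite mulr0 powRr0.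
  by rewrite Rintegral_cst// mul1r limit_law_mass phi_prod0.
rewrite /Rintegral /Ic -(integral_null_tail limit_law_gt) ?tau_moment//.
by apply/measurable_EFinP; exact: measurable_powR_on.
Qed.

Let tau_fin : (tau Ic < +oo)%E. Proof. by rewrite limit_law_mass ltry. Qed.

(** On ]0,c], where [tau] lives, (x^a / phi)^n decreases to the indicator of the point [c]. *)
Lemma limit_law_atom_cvg : phi_prod n / phi ^+ n @[n --> \oo] --> fine (tau [set c]).
Proof.
rewrite -(Rintegral_atom tau c_gt0).
have E n : phi_prod n / phi ^+ n = \int[tau]_(x in Ic) ((x `^ a / phi) ^+ n).
  rewrite -limit_law_moment mulrC -RintegralZl//; last first.
    apply: (bounded_integrable mIc tau_fin (C:=c `^ (a * n%:R))).
      exact: measurable_powR_on.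
    move=> x; rewrite /Ic /= in_itv/= => /andP[x0 xc]; rewrite ger0_norm ?powR_ge0//.
    apply: ge0_ler_powR; rewrite ?nnegrE ?(ltW x0) ?(ltW c_gt0)//.
    by rewrite mulr_ge0// ltW.
  apply: eq_Rintegral => x _.
  by rewrite powRrM powR_mulrn ?powR_ge0// expr_div_n mulrC.
have x01 x : Ic x -> 0 <= x `^ a / phi <= 1.
  rewrite /Ic /= in_itv/= => /andP[x0 xc]; rewrite divr_ge0 ?powR_ge0 ?(ltW phi_gt0)//=.
  rewrite ler_pdivrMr// mul1r -c_pow.
  by apply: (ge0_ler_powR (ltW a_gt0)) => //; rewrite nnegrE ltW.
under eq_fun do rewrite E.
apply: (Rintegral_bounded_cvg mIc tau_fin (C:=1)).
- move=> n; apply: measurable_funX; apply: measurable_funM => //.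
  exact: measurable_powR_on.
- move=> n x /x01/andP[x0 x1]; rewrite ger0_norm ?exprn_ge0//.
  exact: exprn_ile1.
- move=> x /[dup] Ix /x01/andP[x0 x1]; case: eqP => [->|/eqP xc].
    by rewrite c_pow divff ?gt_eqF//; under eq_fun do rewrite expr1n; exact: cvg_cst.
  apply: cvg_expr; rewrite ger0_norm// lt_neqAle x1 andbT.
  move: Ix; rewrite /Ic /= in_itv/= => /andP[y0 yc].
  rewrite lt_eqF// ltr_pdivrMr// mul1r -c_pow.
  by apply: gt0_ltr_powR; rewrite ?nnegrE ?ltW// lt_neqAle xc.
Qed.

(** For q > 1, x^q <= x; for q <= 1 the derivative q z^{q-1} is at least q on ]0,1[. Hence the
    constant min(q,1). *)
Lemma powR_gap (q : R) : 0 < q -> exists2 b : R, 0 < b &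
  forall x : R, 0 < x -> x < 1 -> b * (1 - x) <= 1 - x `^ q.
Proof.
move=> q0; exists (Num.min q 1); first by rewrite lt_min q0 ltr01.
move=> x x0 x1; have [q1|/ltW q1] := leP q 1; last first.
  by rewrite mul1r lerD2l lerN2 ge1r_powR// x0 ltW.
have [||z] := @MVT R (fun x => x `^ q) (fun x => q * x `^ (q - 1)) x 1 x1.
- move=> y; rewrite in_itv/= => /andP[xy _].
  by apply: is_derive1_powR; exact: lt_trans xy.
- apply: derivable_within_continuous => y; rewrite in_itv/= => /andP[xy _].
  by have [] := is_derive1_powR q (lt_le_trans x0 xy).
rewrite in_itv/= powR1 => /andP[xz z1] ->.
rewrite ler_wpM2r ?subr_ge0 ?(ltW x1)// ler_peMr ?(ltW q0)//.
have z0 : 0 < z by exact: lt_trans xz.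
have zz : 0 < z <= 1 by rewrite z0 ltW.
by have := ger_powR zz (_ : q - 1 <= 0); rewrite powRr0 => -> //; rewrite subr_le0.
Qed.

(** The defect phi - phi(ka) is the integral of x^{ka} x: its sum over k is a geometric series under
    the integral, at most 1/(1 - x^a), which is comparable with 1/(1 - x) near 1. *)
Let d_ k := phi - frag_phi B (k%:R * a).

Let geom n x := \sum_(1 <= k < n.+1) x `^ (k%:R * a).

Let geom_le n x : 0 < x -> x < 1 -> geom n x <= (1 - x `^ a)^-1.
Proof.
move=> x0 x1; have xa := powR_lt1 a_gt0 x0 x1.
rewrite -[leRHS]mul1r ler_pdivlMr ?subr_gt0//.
suff -> : geom n x * (1 - x `^ a) = x `^ a - x `^ (n.+1%:R * a).
  by rewrite lerBlDr (le_trans (ltW xa))// lerDl powR_ge0.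
elim: n => [|n IH]; first by rewrite /geom big_geq// mul0r mul1r subrr.
rewrite /geom big_nat_recr//= mulrDl -/(geom n x) IH mulrBr mulr1 -powRD.
  by rewrite -[X in _ * a + X]mul1r -mulrDl natr1; ring.
by rewrite (gt_eqF x0) implybT.
Qed.

Let geom_integral n :
  B.-integrable `]0%R, 1%R[%classic (EFin \o (fun x => geom n x * x)) /\
  \int[B]_(x in `]0, 1[) (geom n x * x) = \sum_(1 <= k < n.+1) d_ k.
Proof.
have i1 k : B.-integrable `]0%R, 1%R[%classic (EFin \o (fun x : R => x `^ (k%:R * a) * x)).
  have ka : 0 <= k%:R * a by rewrite mulr_ge0// ltW.
  have := integrableB mO ii (integrable_phi hB ka).
  by apply: eq_integrable => // x _ /=; rewrite -EFinB; congr (_%:E); ring.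
elim: n => [|n [IH1 IH2]].
  have E : (fun x => geom 0 x * x) = cst 0.
    by apply/funext => x; rewrite /geom big_geq// mul0r.
  rewrite big_geq// E; split; first exact: integrable0.
  by rewrite Rintegral_cst ?mul0r.
have E : (fun x => geom n.+1 x * x) = (fun x => geom n x * x + x `^ (n.+1%:R * a) * x).
  by apply/funext => x; rewrite /geom big_nat_recr//= mulrDl.
rewrite E; split; first exact: (integrableD mO IH1 (i1 n.+1)).
rewrite (RintegralD mO IH1 (i1 n.+1)) IH2 [RHS]big_nat_recr//=; congr (_ + _).
by rewrite -phi_infty_subE// ltW.
Qed.

Let defect_le :
  (\int[B]_(x in `[2^-1%R, 1%R[%classic) ((1 - x)^-1)%:E < +oo)%E ->
  exists K : R, forall n, \sum_(1 <= k < n.+1) d_ k <= K.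
Proof.
move=> hfin; have [b b0 hb] := powR_gap a_gt0.
have mh : measurable (`]0%R, 2^-1%R[%classic : set (measurableTypeR R)).
  exact: measurable_itv.
have mh' : measurable (`[2^-1%R, 1%R[%classic : set (measurableTypeR R)).
  exact: measurable_itv.
have U : `]0%R, 1%R[%classic = `]0%R, 2^-1%R[%classic `|` `[2^-1%R, 1%R[%classic :> set R.
  by rewrite -(@itv_bndbnd_setU _ _ _ (BLeft 2^-1%R))// bnd_simp ?invr_ge0// invf_le1// ler1n.
(* The constant 2/b: 1/(1 - x^a) <= b^{-1}/(1 - x), and 1/(1 - x) <= 2 on ]0,1/2[. *)
pose I1 := (\int[B]_(x in `]0%R, 1%R[%classic) ((2 / b) * x)%:E)%E.
pose I2 := (\int[B]_(x in `[2^-1%R, 1%R[%classic) (b^-1 * (1 - x)^-1)%:E)%E.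
have I1y : (I1 < +oo)%E.
  exact: integral_fune_lt_pinfty (integrableZl mO (2 / b) ii).
have minv : measurable_fun (`[2^-1%R, 1%R[%classic : set (measurableTypeR R))
    (fun x : R => (1 - x)^-1).
  apply: subspace_continuous_measurable_fun => //.
  apply: continuous_in_subspaceT => x; rewrite inE/= in_itv/= => /andP[_ x1].
  apply: cvgV; first by rewrite subr_eq0 gt_eqF.
  by apply: cvgB; [exact: cvg_cst|exact: cvg_id].
have I2y : (I2 < +oo)%E.
  rewrite /I2; under eq_integral do rewrite EFinM.
  rewrite ge0_integralZl_EFin ?invr_ge0 ?(ltW b0)//; last first.
  - exact/measurable_EFinP.
  - by move=> x /=; rewrite in_itv/= => /andP[_ x1]; rewrite lee_fin invr_ge0 subr_ge0 ltW.
  by apply: lte_mul_pinfty => //; rewrite lee_fin invr_ge0 ltW.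
have I10 : (0 <= I1)%E.
  apply: integral_ge0 => x /=; rewrite in_itv/= lee_fin => /andP[x0 _].
  by rewrite mulr_ge0 ?divr_ge0// ltW.
have I20 : (0 <= I2)%E.
  apply: integral_ge0 => x /=; rewrite in_itv/= lee_fin => /andP[_ x1].
  by rewrite mulr_ge0 ?invr_ge0 ?subr_ge0 ?(ltW b0)// ltW.
exists (fine (I1 + I2)%E) => n; have [gi <-] := geom_integral n.
rewrite -lee_fin [leRHS]fineK; last first.
  by rewrite ge0_fin_numE; [exact: lte_add_pinfty|exact: adde_ge0].
rewrite /Rintegral fineK; last exact: integrable_fin_num.
have mg := measurable_int _ gi.
have g0 x : 0 < x -> x < 1 -> 0 <= geom n x * x.
  by move=> x0 x1; rewrite mulr_ge0 ?(ltW x0)// sumr_ge0// => k _; exact: powR_ge0.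
have gb x : 0 < x -> x < 1 -> geom n x <= b^-1 * (1 - x)^-1.
  move=> x0 x1; apply: le_trans (geom_le n x0 x1) _; rewrite -invfM.
  by rewrite lef_pV2 ?posrE ?mulr_gt0 ?subr_gt0 ?powR_lt1//; exact: hb.
rewrite U ge0_integral_setU//=; last 3 first.
- by rewrite -U.
- by move=> x; rewrite /= !in_itv/= lee_fin => -[|]/andP[h1 h2]; apply: g0; lra.
- apply: lt_disjoint => x y; rewrite !in_itv/= => /andP[_ h1] /andP[h2 _].
  exact: lt_le_trans h2.
apply: leeD.
- rewrite /I1.
  apply: (@le_trans _ _ (\int[B]_(x in `]0%R, 2^-1%R[%classic) ((2 / b) * x)%:E)%E).
    apply: ge0_le_integral => //.
    + by move=> x /=; rewrite in_itv/= => /andP[x0 xh]; rewrite lee_fin g0//; lra.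
    + by apply: measurable_funS mg => //; rewrite U; exact: subsetUl.
    + by apply/measurable_EFinP; apply: measurable_funM.
    move=> x /=; rewrite in_itv/= => /andP[x0 xh]; rewrite lee_fin ler_wpM2r ?(ltW x0)//.
    have x1 : x < 1 by lra.
    apply: le_trans (gb x x0 x1) _; rewrite mulrC ler_wpM2r ?invr_ge0 ?(ltW b0)//.
    by rewrite invf_ple ?posrE ?subr_gt0//; lra.
  apply: ge0_subset_integral => //.
  + by apply/measurable_EFinP; apply: measurable_funM.
  + by move=> x /=; rewrite in_itv/= lee_fin => /andP[x0 _]; rewrite mulr_ge0 ?divr_ge0// ltW.
  + by rewrite U; exact: subsetUl.
- apply: ge0_le_integral => //.
  + by move=> x /=; rewrite in_itv/= => /andP[x0 xh]; rewrite lee_fin g0//; lra.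
  + by apply: measurable_funS mg => //; rewrite U; exact: subsetUr.
  + by apply/measurable_EFinP; apply: measurable_funM.
  move=> x /=; rewrite in_itv/= => /andP[xh x1]; rewrite lee_fin.
  have x0 : 0 < x by lra.
  rewrite -[leRHS]mulr1; apply: ler_pM; [|lra|exact: gb|exact: ltW].
  by apply: sumr_ge0 => k _; exact: powR_ge0.
Qed.

(** From phi / phi(ka) = 1 + d_k / phi(ka) <= exp(d_k / phi(a)), the normalised products stay above
    exp(-K / phi(a)), where K bounds the sums of defects. *)
Theorem limit_law_atom_gt0 :
  (\int[B]_(x in `[2^-1%R, 1%R[%classic) ((1 - x)^-1)%:E < +oo)%E ->
  0 < fine (tau [set c]).
Proof.
move=> /defect_le[K hK]; pose f1 := frag_phi B a.
have f1_gt0 : 0 < f1 by exact: frag_phi_gt0.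
have fk k : f1 <= frag_phi B (k.+1%:R * a).
  apply: (le_Rintegral mO (integrable_phi hB (ltW a_gt0)) (integrable_phi hB (ltW (ka_gt0 k)))).
  move=> x /=; rewrite in_itv/= => /andP[x0 x1]; rewrite ler_wpM2r ?(ltW x0)// lerD2l lerN2.
  by apply: ger_powR; rewrite ?x0 ?(ltW x1)// ler_peMl ?(ltW a_gt0)// ler1n.
have key n : expR (- ((\sum_(1 <= k < n.+1) d_ k) / f1)) <= phi_prod n / phi ^+ n.
  elim: n => [|n IH]; first by rewrite big_geq// mul0r oppr0 expR0 phi_prod0 expr0 divr1.
  rewrite big_nat_recr//= mulrDl opprD expRD phi_prodS exprSr invfM mulrACA.
  apply: ler_pM => //; rewrite ?expR_ge0//.
  have fp := frag_phi_gt0 (ka_gt0 n).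
  rewrite expRN -[leRHS]invrK lef_pV2 ?posrE ?expR_gt0 ?invr_gt0 ?divr_gt0// invf_div.
  apply: le_trans (expR_ge1Dx _).
  have -> : phi / frag_phi B (n.+1%:R * a) = 1 + d_ n.+1 / frag_phi B (n.+1%:R * a).
    by rewrite /d_; field; rewrite gt_eqF.
  rewrite lerD2l; apply: ler_wpM2l.
    by rewrite subr_ge0; apply: frag_phi_le; exact: ltW (ka_gt0 n).
  by rewrite lef_pV2 ?posrE; [exact: fk|exact: fp|exact: f1_gt0].
apply: (@lt_le_trans _ _ (expR (- (K / f1)))); first exact: expR_gt0.
apply: (cvgr_to_ge limit_law_atom_cvg); apply: nearW => n; apply: le_trans (key n).
by rewrite ler_expR lerN2 ler_wpM2r ?invr_ge0 ?(ltW f1_gt0).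
Qed.

End limit_law.

(** * The mass ratio *)

(** Uniqueness reaches level 1 only. Level 0 is recovered from the increments of level 1, at the
    price of a strict delay, since it may be discontinuous. *)
Lemma decay_chain_compare (R : realType) (Q P : nat -> R -> R) (s t : R) :
  decay_chain Q -> decay_chain P -> (forall k, Q k 0 = P k 0) ->
  0 <= s -> s < t -> Q 0 t <= P 0 s.
Proof.
move=> cQ cP QP0 s0 st; have t0 : 0 <= t by apply: le_trans s0 (ltW st).
have ts : 0 < t - s by rewrite subr_gt0.
have /andP[q1 _] := (proj2 cQ) 0 s t s0 (ltW st).
have /andP[_ p2] := (proj2 cP) 0 s t s0 (ltW st).
rewrite (decay_chain_unique cQ cP QP0 s0) (decay_chain_unique cQ cP QP0 t0) in q1.
by rewrite -(ler_pM2l ts); exact: le_trans p2.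
Qed.

Lemma Rintegral_exp_rate_cvg (R : realType) (nu : borel_measure R) (b : R) (g : R -> R) :
  0 < b -> (nu `]0%R, b]%classic < +oo)%E ->
  measurable_fun (`]0%R, b]%classic : set (measurableTypeR R)) g ->
  g b = 0 -> (forall x : R, 0 < x -> x < b -> 0 < g x) ->
  \int[nu]_(x in `]0, b]) expR (- (t * g x)) @[t --> +oo] --> fine (nu [set b]).
Proof.
move=> b0 nuy mg gb gx.
have mb : measurable (`]0%R, b]%classic : set (measurableTypeR R)) by exact: measurable_itv.
have g0 x : 0 < x -> x <= b -> 0 <= g x.
  by move=> x0; rewrite le_eqVlt => /predU1P[->|xb]; [rewrite gb|exact/ltW/gx].
rewrite -(Rintegral_atom nu b0).
(* The maximum keeps the integrand below 1 for every t and equals t eventually. *)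
have H : \int[nu]_(x in `]0, b]) expR (- (Num.max t 0 * g x)) @[t --> +oo] -->
    \int[nu]_(x in `]0, b]) (x == b)%:R.
  apply/cvg_pinftyP => u u_oo.
  apply: (Rintegral_bounded_cvg mb nuy (C:=1)).
  - move=> n; apply: measurableT_comp => //; apply: measurableT_comp => //.
    exact: measurable_funM.
  - move=> n x /=; rewrite in_itv/= => /andP[x0 xb]; rewrite ger0_norm ?expR_ge0//.
    by rewrite expR_le1 oppr_le0 mulr_ge0 ?g0// le_max lexx orbT.
  - move=> x /=; rewrite in_itv/= => /andP[x0 xb]; case: eqP => [->|/eqP xb'].
      under eq_fun do rewrite gb mulr0 oppr0 expR0.
      exact: cvg_cst.
    have gp : 0 < g x by apply: gx => //; rewrite lt_neqAle xb'.
    apply: (@cvg_comp _ _ _ (fun n => Num.max (u n) 0 * g x) (fun y => expR (- y)) _ +oo).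
      apply/cvgryPge => A; move/cvgryPge : u_oo => /(_ (A / g x)); apply: filterS => n h.
      by rewrite -ler_pdivrMr// le_max h.
    exact: cvgr_expR.
apply: cvg_trans H; apply: near_eq_cvg; near=> t.
by rewrite max_l//; near: t; apply: nbhs_pinfty_ge; exact: num_real.
Unshelve. all: by end_near. Qed.

Section mass_ratio.
Context {R : realType} (alpha : R) (B : borel_measure R)
  (sigma : R -> borel_measure R) (tau : borel_measure R).
Hypothesis alpha_lt0 : alpha < 0.
Hypothesis B_fin : (\int[B]_(y in `]0%R, 1%R[%classic) (y * (1 - y))%:E < +oo)%E.
Hypothesis B_gt0 : (0 < B `]0%R, 1%R[%classic)%E.
Hypothesis ev : evolves alpha B sigma.
Hypothesis hB : (frag_phi_infty B < +oo)%E.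

Let a := `|alpha|.
Let phi := fine (frag_phi_infty B).
Let s0 := fine (sigma 0 [set 1]).
Let c := phi `^ a^-1.

Hypothesis tau_mass : tau `]0%R, +oo[%classic = 1%E.
Hypothesis tau_moment : forall n : nat, (1 <= n)%N ->
  (\int[tau]_(x in `]0%R, +oo[%classic) (x `^ (a * n%:R))%:E = (phi_prod B a n)%:E)%E.
Hypothesis s0_gt0 : 0 < s0.

Let a_gt0 : 0 < a. Proof. by rewrite normr_gt0 lt_eqF. Qed.
Let aE : alpha = - a. Proof. by rewrite /a ltr0_norm ?opprK. Qed.
Let phi_gt0 : 0 < phi. Proof. exact: fine_phi_infty_gt0. Qed.
Let c_gt0 : 0 < c. Proof. exact: powR_gt0. Qed.
Let c_pow : c `^ a = phi. Proof. exact: root_phi_pow. Qed.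
Let pi_gt0 n : 0 < phi_prod B a n. Proof. exact: phi_prod_gt0. Qed.

Let Ic : set (measurableTypeR R) := `]0%R, c]%classic.
Let mIc : measurable Ic. Proof. exact: measurable_itv. Qed.
Let tau_Ic : tau Ic = 1%E. Proof. exact: limit_law_mass. Qed.
Let tau_fin : (tau Ic < +oo)%E. Proof. by rewrite tau_Ic ltry. Qed.

Let m := moment sigma 0.
Let p := fine (tau [set c]).

Let p_ge0 : 0 <= p. Proof. exact: fine_ge0. Qed.

Let f k t := moment sigma (a * k%:R) t / phi_prod B a k.

Let ak_ge0 k : 0 <= a * k%:R. Proof. by rewrite mulr_ge0// ltW. Qed.

Let f_ge0 k (t : R) : 0 <= t -> 0 <= f k t.
Proof. by move=> t0; rewrite divr_ge0 ?moment_ge0// ltW. Qed.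

Let f_nincr k (s t : R) : 0 <= s -> s <= t -> f k t <= f k s.
Proof.
move=> s0' st; rewrite ler_wpM2r ?invr_ge0 ?(ltW (pi_gt0 k))//.
exact: (moment_nincr alpha_lt0 B_fin ev).
Qed.

Let f_chain : power_chain f.
Proof.
move=> k s t s0' st; rewrite /f phi_prodS.
have qa : a * k.+1%:R + alpha = a * k%:R by rewrite aE -natr1; ring.
have aq : - alpha <= a * k.+1%:R by rewrite aE opprK ler_peMr ?ler1n// ltW.
have := moment_decay alpha_lt0 B_fin ev hB aq s0' st.
rewrite qa [a * k.+1%:R]mulrC.
have F0 : 0 < frag_phi B (k.+1%:R * a) by apply: frag_phi_gt0 => //; rewrite mulr_gt0.
have p0 := pi_gt0 k; set F := frag_phi _ _ in F0 *; set w := phi_prod B a k in p0 *.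
move=> /andP[h1 h2]; have wF : 0 < w * F by rewrite mulr_gt0.
have E x : (t - s) * (x / w) = (t - s) * (F * x) / (w * F).
  by field; rewrite !gt_eqF.
by rewrite !E -mulrBl !ler_pM2r ?invr_gt0// h1 h2.
Qed.

Let Q := mixture a c tau f.
Let e (_ : nat) (t : R) := expR (- t).
Let P := mixture a 1 (sigma 0) e.

Let e_ge0 k (t : R) : 0 <= t -> 0 <= e k t. Proof. by move=> _; exact: expR_ge0. Qed.
Let e_nincr k (s t : R) : 0 <= s -> s <= t -> e k t <= e k s.
Proof. by move=> _ st; rewrite /e ler_expR lerN2. Qed.

(** At time 0 the mixing integral is a moment of [tau], which cancels the normalisation of [f]: the
    bound by 1 is recovered. *)
Let Q0 k : Q k 0 = moment sigma (a * k%:R) 0.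
Proof.
rewrite /Q /mixture; under eq_Rintegral do rewrite mul0r mulrC.
rewrite RintegralZl//; last first.
  apply: (bounded_integrable mIc tau_fin (C:=c `^ (a * k%:R))).
    exact: measurable_powR_on.
  move=> x; rewrite /Ic /= in_itv/= => /andP[x0 xc]; rewrite ger0_norm ?powR_ge0//.
  by apply: ge0_ler_powR; rewrite ?nnegrE ?(ltW x0) ?(ltW c_gt0).
by rewrite limit_law_moment// /f divfK// gt_eqF.
Qed.

Let P0 k : P k 0 = moment sigma (a * k%:R) 0.
Proof. by apply: eq_Rintegral => x _; rewrite mul0r /e oppr0 expR0 mulr1. Qed.

Let sig_fin := evolves_lty ev (lexx 0).

Let Q_chain : decay_chain Q.
Proof.
split; last exact: mixture_chain.
move=> k t t0; rewrite mixture_ge0//= (le_trans (mixture_nincr a_gt0 tau_fin f_ge0 f_nincr k (lexx 0) t0))//.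
by rewrite -/(Q k 0) Q0 (moment_le1 ev).
Qed.

Let P_chain : decay_chain P.
Proof.
split; last by apply: mixture_chain => //; exact: exp_power_chain.
move=> k t t0; rewrite mixture_ge0//= (le_trans (mixture_nincr a_gt0 sig_fin e_ge0 e_nincr k (lexx 0) t0))//.
by rewrite -/(P k 0) P0 (moment_le1 ev).
Qed.

Let QP (s t : R) : 0 <= s -> s < t -> Q 0 t <= P 0 s /\ P 0 t <= Q 0 s.
Proof.
have QP0 k : Q k 0 = P k 0 by exact: etrans (Q0 k) (esym (P0 k)).
by move=> s0' st; split; apply: decay_chain_compare.
Qed.

Let m_ge0 t : 0 <= m t. Proof. exact: moment_ge0. Qed.

(** What remains at time phi t once exp(-phi t) is taken out: [A] of the exponentials under sigma_0,
    [E] of an exponential majorant of m under [tau]. On the domains of integration, the rates vanish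
    only at [c] for [E] and at 1 for [A]. *)
Let E t := \int[tau]_(x in Ic) expR (- (t * (phi * (phi * x `^ (- a) - 1)))).
Let A t := \int[sigma 0]_(x in `]0, 1]) expR (- (t * (phi * (x `^ (- a) - 1)))).

Let rate_gt0 (x b : R) : 0 < x -> x < b -> 1 < b `^ a * x `^ (- a).
Proof.
move=> x0 xb; rewrite powRN -ltr_pdivrMr ?invr_gt0 ?powR_gt0// mul1r invrK.
by apply: gt0_ltr_powR; rewrite ?nnegrE ?ltW// (lt_trans x0).
Qed.

Let A_rate (x t : R) : 0 <= t -> 0 < x -> x <= 1 ->
  0 <= expR (- (t * (phi * (x `^ (- a) - 1)))) <= 1.
Proof.
move=> t0 x0 x1; rewrite expR_ge0 expR_le1 oppr_le0 mulr_ge0 ?mulr_ge0 ?(ltW phi_gt0)//.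
move: x1; rewrite subr_ge0 le_eqVlt => /predU1P[->|x1]; first by rewrite powR1.
by have := rate_gt0 x0 x1; rewrite powR1 mul1r => /ltW.
Qed.

Let A_int (t : R) : 0 <= t -> (sigma 0).-integrable `]0%R, 1%R]%classic
  (EFin \o (fun x => expR (- (t * (phi * (x `^ (- a) - 1)))))).
Proof.
move=> t0; apply: (bounded_integrable mI01 sig_fin (C:=1)).
  apply: measurableT_comp => //; apply: measurableT_comp => //.
  apply: measurable_funM => //; apply: measurable_funM => //; apply: measurable_funB => //.
  exact: measurable_powR_on.
move=> x /=; rewrite in_itv/= => /andP[x0 x1].
by have /andP[h1 h2] := A_rate t0 x0 x1; rewrite ger0_norm.
Qed.

Let P0A (t : R) : 0 <= t -> P 0 (phi * t) = expR (- (phi * t)) * A t.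
Proof.
move=> t0; rewrite /A -(RintegralZl _ mI01 (A_int t0)).
apply: eq_Rintegral => x _; rewrite mulr0 powRr0 mul1r /e -expRD.
by congr expR; ring.
Qed.

Let A_le1 (t : R) : 0 <= t -> A t <= 1.
Proof.
move=> t0; have h := le_trans _ (moment_le1 ev (lexx 0) (lexx 0)); apply: h.
apply: (le_Rintegral mI01 (A_int t0) (integrable_powR ev (lexx 0) (lexx 0))) => x /=.
rewrite in_itv/= => /andP[x0 x1]; rewrite powRr0.
by have /andP[] := A_rate t0 x0 x1.
Qed.

Let A_cvg : A t @[t --> +oo] --> s0.
Proof.
apply: Rintegral_exp_rate_cvg => //.
- apply: measurable_funM => //; apply: measurable_funB => //.
  exact: measurable_powR_on.
- by rewrite powR1 subrr mulr0.
- move=> x x0 x1; rewrite mulr_gt0// subr_gt0.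
  by have := rate_gt0 x0 x1; rewrite powR1 mul1r.
Qed.

Let E_cvg : E t @[t --> +oo] --> p.
Proof.
apply: Rintegral_exp_rate_cvg => //.
- apply: measurable_funM => //; apply: measurable_funB => //; apply: measurable_funM => //.
  exact: measurable_powR_on.
- by rewrite powRN c_pow mulfV ?gt_eqF// subrr mulr0.
- move=> x x0 xc; rewrite mulr_gt0// subr_gt0.
  by have := rate_gt0 x0 xc; rewrite c_pow.
Qed.

Let E_int (t : R) : 0 <= t -> tau.-integrable Ic
  (EFin \o (fun x => expR (- (t * (phi * (phi * x `^ (- a) - 1)))))).
Proof.
move=> t0; apply: (bounded_integrable mIc tau_fin (C:=1)).
  apply: measurableT_comp => //; apply: measurableT_comp => //.
  apply: measurable_funM => //; apply: measurable_funM => //; apply: measurable_funB => //.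
  by apply: measurable_funM => //; exact: measurable_powR_on.
move=> x; rewrite /Ic /= in_itv/= => /andP[x0 xc].
rewrite ger0_norm ?expR_ge0// expR_le1 oppr_le0 mulr_ge0 ?mulr_ge0 ?(ltW phi_gt0)//.
move: xc; rewrite subr_ge0 le_eqVlt => /predU1P[->|xc].
  by rewrite powRN c_pow mulfV ?gt_eqF.
by have := rate_gt0 x0 xc; rewrite c_pow => /ltW.
Qed.

Let kappa t := expR (phi * t) * m t.

Let mf_int (t : R) : 0 <= t ->
  tau.-integrable Ic (EFin \o (fun x => m (phi * t * x `^ (- a)))).
Proof.
move=> t0; have pt : 0 <= phi * t by rewrite mulr_ge0// ltW.
have := integrable_mixand a_gt0 tau_fin f_ge0 f_nincr 0 pt.
apply: eq_integrable => // x _ /=.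
by rewrite /f mulr0 powRr0 mul1r phi_prod0 divr1.
Qed.

Let Q0E (t : R) : Q 0 (phi * t) = \int[tau]_(x in Ic) m (phi * t * x `^ (- a)).
Proof.
by apply: eq_Rintegral => x _; rewrite /f mulr0 powRr0 mul1r phi_prod0 divr1.
Qed.

Let atom_int (k : R) : tau.-integrable Ic (EFin \o (fun x => k * (x == c)%:R)).
Proof.
apply: (bounded_integrable mIc tau_fin (C:=`|k|)).
  apply: measurable_funM => //.
  have -> : (fun x : measurableTypeR R => (x == c)%:R : R) = \1_[set c].
    apply/funext => x; rewrite indicE; case: eqP => [->|xc]; [rewrite mem_set//|rewrite memNset//].
  by apply: measurable_indic; exact: measurable_set1.
by move=> x _; rewrite normrM ler_piMr// ger0_norm//; case: (_ == _).
Qed.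

(** Since c^a = phi, a mixture taken at time phi t has its atom at [c] see exactly m(t). *)
Let m_at_c (t : R) : m (phi * t * c `^ (- a)) = m t.
Proof. by rewrite powRN c_pow mulrAC mulfV ?mul1r// gt_eqF. Qed.

Let Q0_ge (t : R) : 0 <= t -> p * m t <= Q 0 (phi * t).
Proof.
move=> t0; have ai := atom_int (m t).
rewrite Q0E mulrC /p -Rintegral_atom// -RintegralZl//; last first.
  by have := atom_int 1; under eq_fun do rewrite mul1r.
apply: (le_Rintegral mIc ai (mf_int t0)) => x _.
by case: eqP => [->|_]; rewrite ?mulr1 ?mulr0 ?m_at_c.
Qed.

(** Of the mixture, only the atom at [c] is kept; [eta] is the delay required by
    [decay_chain_compare]. *)
Let kappa_le (eta t : R) : 0 < eta -> eta <= t ->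
  p * kappa t <= expR (phi * eta) * A (t - eta).
Proof.
move=> eta0 et; have t0 : 0 <= t by lra.
have s0' : 0 <= phi * (t - eta) by rewrite mulr_ge0 ?subr_ge0// ltW.
have st : phi * (t - eta) < phi * t by rewrite ltr_pM2l//; lra.
have [+ _] := QP s0' st; rewrite P0A ?subr_ge0// => h.
have h2 := ler_wpM2l (expR_ge0 (phi * t)) (le_trans (Q0_ge t0) h).
rewrite /kappa mulrCA; apply: le_trans h2 _; rewrite mulrA -expRD.
by rewrite le_eqVlt; apply/orP; left; apply/eqP; congr (expR _ * _); ring.
Qed.

Let p_kappa_le (t : R) : 1 <= t -> p * kappa t <= expR phi.
Proof.
move=> t1; apply: le_trans (kappa_le ltr01 t1) _.
by rewrite mulr1 ler_piMr ?expR_ge0// A_le1// subr_ge0.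
Qed.

(** A priori bound controlling the mixture below [c]: delay 1 in [kappa_le] for t >= 1, and m <= 1
    before; the constant is the sum of the two. *)
Let m_le_exp : 0 < p -> exists2 C : R, 0 <= C &
  forall t, 0 <= t -> m t <= C * expR (- (phi * t)).
Proof.
move=> p0; exists (expR phi / p + expR phi); first by rewrite addr_ge0 ?divr_ge0 ?expR_ge0.
move=> t t0; rewrite expRN ler_pdivlMr ?expR_gt0// mulrC -/(kappa t).
have [t1|/ltW t1] := leP 1 t.
  rewrite ler_wpDr ?expR_ge0// ler_pdivlMr// mulrC; exact: p_kappa_le.
rewrite ler_wpDl ?divr_ge0 ?expR_ge0// -[leRHS]mulr1; apply: ler_pM; [exact: expR_ge0|exact: m_ge0| |].
- by rewrite ler_expR ler_piMr// ltW.
- exact: (moment_le1 ev).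
Qed.

(** By [m_le_exp], the part of [tau] below [c] contributes at most C (E t - p), which tends to 0. *)
Let kappa_ge : 0 < p -> exists2 C : R, 0 <= C &
  forall eta t : R, 0 < eta -> 0 <= t ->
  expR (- (phi * eta)) * A (t + eta) - C * (E t - p) <= p * kappa t.
Proof.
move=> /m_le_exp[C C0 hC]; exists C => // eta t eta0 t0.
have s0' : 0 <= phi * t by rewrite mulr_ge0 // ltW.
have st : phi * t < phi * (t + eta) by rewrite ltr_pM2l//; lra.
have [_] := QP s0' st; rewrite P0A ?Q0E; last by lra.
move=> h.
have h2 : \int[tau]_(x in Ic) m (phi * t * x `^ (- a)) <=
    m t * p + C * expR (- (phi * t)) * (E t - p).
  have i1 : tau.-integrable Ic (EFin \o (fun x => (x == c)%:R)).
    by have := atom_int 1; apply: eq_integrable => // x _ /=; rewrite mul1r.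
  have i2 := atom_int (m t).
  have i3 := integrableB mIc (E_int t0) i1.
  have i4 := integrableZl mIc (C * expR (- (phi * t))) i3.
  rewrite /p -(Rintegral_atom tau c_gt0) /E -(RintegralB mIc (E_int t0) i1).
  rewrite -(RintegralZl (m t) mIc i1) -(RintegralZl _ mIc i3) -(RintegralD mIc i2 i4).
  apply: (le_Rintegral mIc (mf_int t0) (integrableD mIc i2 i4)) => x.
  rewrite /Ic /= in_itv/= => /andP[x0 xc]; case: eqP => [->|/eqP xc'].
    by rewrite m_at_c powRN c_pow mulfV ?gt_eqF// subrr !mulr0 oppr0 expR0 subrr mulr0 addr0 mulr1.
  rewrite mulr0 add0r subr0 -[leRHS]mulrA -expRD.
  apply: le_trans (hC _ _) _; first by rewrite !mulr_ge0 ?powR_ge0// ltW.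
  rewrite ler_wpM2l// ler_expR le_eqVlt; apply/orP; left; apply/eqP; ring.
have := ler_wpM2l (expR_ge0 (phi * t)) (le_trans h h2).
have -> : expR (phi * t) * (expR (- (phi * (t + eta))) * A (t + eta)) =
    expR (- (phi * eta)) * A (t + eta).
  by rewrite mulrA -expRD; congr (expR _ * _); ring.
have -> : expR (phi * t) * (m t * p + C * expR (- (phi * t)) * (E t - p)) =
    p * kappa t + C * (E t - p).
  rewrite /kappa expRN; field; rewrite gt_eqF ?expR_gt0//.
by rewrite lerBlDr.
Qed.

Let invr_cvg0 : (t : R)^-1 @[t --> +oo] --> (0 : R).
Proof.
apply/cvgr0Pnorm_le => eps eps0; near=> t.
have te : eps^-1 <= t by near: t; apply: nbhs_pinfty_ge; exact: num_real.
have t0 : 0 < t by apply: lt_le_trans te; rewrite invr_gt0.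
by rewrite gtr0_norm ?invr_gt0// invf_ple ?posrE.
Unshelve. all: by end_near. Qed.

Let expR_inv_cvg1 (k : R) : expR (k * t^-1) @[t --> +oo] --> (1 : R).
Proof.
rewrite -[X in _ --> X]expR0; apply: (@continuous_cvg _ _ _ _ _ _ (@expR R)).
  exact: continuous_expR.
by rewrite -[X in _ --> X](mulr0 k); apply: cvgM; [exact: cvg_cst|exact: invr_cvg0].
Qed.

Let kappa_cvg : 0 < p -> p * kappa t @[t --> +oo] --> s0.
Proof.
move=> /kappa_ge[C C0 hC].
have shift (s : R) : `|s| <= 1 -> t + s * t^-1 @[t --> +oo] --> +oo.
  move=> s1; apply/cvgryPge => K; near=> t.
  have t1 : 1 <= t by near: t; apply: nbhs_pinfty_ge; exact: num_real.
  have tK : K + 1 <= t by near: t; apply: nbhs_pinfty_ge; exact: num_real.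
  have : `|s * t^-1| <= 1.
    by rewrite normrM mulr_ile1// normfV ger0_norm ?invf_le1//; lra.
  by rewrite ler_norml => /andP[h _]; lra.
(* The delay is 1/t: positive, as the comparison requires, and vanishing in the limit. *)
apply: (@squeeze_cvgr _ _ _ _
  (fun t => expR (- (phi * t^-1)) * A (t + t^-1) - C * (E t - p))
  (fun t => expR (phi * t^-1) * A (t - t^-1))).
- near=> t; have t1 : 1 <= t by near: t; apply: nbhs_pinfty_ge; exact: num_real.
  have t0 : 0 < t by lra.
  apply/andP; split; first by apply: hC; rewrite ?invr_gt0// ltW.
  apply: kappa_le; rewrite ?invr_gt0//; apply: le_trans t1.
  by rewrite invf_le1.
- rewrite -[X in _ --> X]subr0 -[s0]mul1r; apply: cvgB.
    apply: cvgM.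
      by under eq_fun do rewrite -mulNr; exact: expR_inv_cvg1.
    apply: (cvg_comp _ _ _ A_cvg); have := shift 1; rewrite normr1 => /(_ (lexx _)).
    by under eq_fun do rewrite mul1r.
  rewrite -[X in _ --> X](mulr0 C); apply: cvgM; first exact: cvg_cst.
  rewrite -(subrr p); apply: cvgB; [exact: E_cvg|exact: cvg_cst].
- rewrite -[s0]mul1r; apply: cvgM; first exact: expR_inv_cvg1.
  apply: (cvg_comp _ _ _ A_cvg); have := shift (-1); rewrite normrN1 => /(_ (lexx _)).
  by under eq_fun do rewrite mulN1r.
Unshelve. all: by end_near. Qed.

Let atomE (t : R) : 0 <= t -> fine (sigma t [set 1]) = s0 * expR (- (phi * t)).
Proof.
move=> t0; rewrite (atom_evolution alpha_lt0 B_fin ev t0).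
have fn : frag_phi_infty B \is a fin_num.
  by rewrite ge0_fin_numE// ltW// (frag_phi_infty_gt0 B_gt0).
rewrite -(fineK fn) -/phi -(fineK (atom_fin_num ev (lexx 0))) -/s0 -EFinM /=.
by rewrite mulrC [t * _]mulrC.
Qed.

Let ratioE (t : R) : 0 <= t -> fine (sigma t [set 1]) / m t = s0 / kappa t.
Proof. by move=> t0; rewrite atomE// expRN /kappa invfM mulrA. Qed.

(** The ratio is s0 / kappa(t). If the integral is finite, p > 0 and p kappa tends to s0; if it is
    infinite, kappa tends to infinity and p = 0. *)
Theorem atom_mass_ratio :
  (fine (sigma t [set 1]) / moment sigma 0 t @[t --> +oo] --> p) /\
  (p != 0 <-> (\int[B]_(x in `[2^-1%R, 1%R[%classic) ((1 - x)^-1)%:E < +oo)%E).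
Proof.
have [hfin|] := ltP (\int[B]_(x in `[2^-1%R, 1%R[%classic) ((1 - x)^-1)%:E)%E +oo%E.
  have p0 : 0 < p by apply: (@limit_law_atom_gt0 R B tau a).
  split; last by split => // _; rewrite gt_eqF.
  have H : s0 * p / (p * kappa t) @[t --> +oo] --> s0 * p / s0.
    apply: cvgM; first exact: cvg_cst.
    by apply: cvgV; [rewrite gt_eqF|exact: kappa_cvg].
  rewrite mulrAC mulfV ?mul1r ?gt_eqF// in H.
  apply: cvg_trans H; apply: near_eq_cvg; near=> t.
  have t0 : 0 <= t by near: t; apply: nbhs_pinfty_ge; exact: num_real.
  by rewrite -/(m t) ratioE// invfM mulrA mulfK// gt_eqF.
rewrite leye_eq => /eqP hinf.
have U := exp_mass_unbounded alpha_lt0 B_fin B_gt0 ev hB hinf s0_gt0.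
(* A positive [p] would bound [kappa] by exp(phi) / p on [1,+oo[. *)
have p0 : p = 0.
  apply/eqP; rewrite eq_le p_ge0 andbT leNgt; apply/negP => p0.
  have [T T0 hT] := U ((expR phi + 1) / p).
  have := p_kappa_le (t:=Num.max T 1); rewrite le_max lexx orbT => /(_ isT).
  have := hT (Num.max T 1); rewrite le_max lexx => /(_ isT); rewrite ler_pdivrMr// mulrC.
  by rewrite -/(kappa _) => h1 /(le_trans h1); rewrite gerDl ler10.
split; last by rewrite p0 eqxx.
rewrite p0; apply/cvgr0Pnorm_le => eps eps0.
have [T T0 hT] := U (s0 / eps); near=> t.
have tT : T <= t by near: t; apply: nbhs_pinfty_ge; exact: num_real.
rewrite ratioE ?(le_trans T0)//.
have k0 : 0 < kappa t by apply: lt_le_trans (hT t tT); rewrite divr_gt0.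
rewrite ger0_norm ?divr_ge0 ?(ltW s0_gt0) ?(ltW k0)// ler_pdivrMr// mulrC -ler_pdivrMr//.
exact: hT.
Unshelve. all: by end_near. Qed.

End mass_ratio.

(** * From the size-biased measures back to the solution *)

Lemma size_biased_set1 (R : realType) (nu : borel_measure R) (b : R) : 0 <= b ->
  size_biased nu [set b] = (b%:E * nu [set b])%E.
Proof.
move=> b0; have m1 : measurable ([set b] : set (measurableTypeR R)).
  exact: measurable_set1.
rewrite -integral_cst//; apply: eq_integral => x; rewrite inE => -> /=.
by rewrite max_l.
Qed.

Theorem proposition1p5 (R : realType) (alpha : R) (B mu0 : borel_measure R)
    (mu : R -> borel_measure R)
    (alpha_lt0 : alpha < 0)
    (B_on : measure_on `]0, 1[ B)
    (B_fin : (\int[B]_(y in `]0%R, 1%R[%classic) (y * (1 - y))%:E < +oo)%E)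
    (B_gt0 : (0 < B `]0%R, 1%R[%classic)%E)
    (mu0_on : measure_on `]0, +oo[ mu0)
    (mu0_mass : total_mass mu0 = 1%E)
    (mu0_sup : is_sup_support mu0 1)
    (mu_sol : fragmentation_solution alpha B mu0 mu)
    (mu0_atom : (0 < mu0 [set 1%R])%E) :
  [/\ (0 < frag_phi_infty B)%E,
      (forall t : R, 0 <= t ->
         mu t [set 1] = (expeR (- (t%:E * frag_phi_infty B)) * mu0 [set 1%R])%E) &
      forall (mu_infty : borel_measure R) (beta : R),
        is_mu_infty alpha B mu_infty ->
        0 <= beta < 1 ->
        regularly_varying_at0
          (fun u : R => \int[B]_(x in `]0, (1 - u)]) x) (- beta) ->
        (\int[B]_(x in `]0%R, 1%R[%classic) (`|ln x| * x)%:E < +oo)%E ->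
        (frag_phi_infty B < +oo)%E ->
        let c := fine (frag_phi_infty B) `^ (`|alpha|^-1) in
        let limit := c * fine (mu_infty [set c]) in
        (fine (mu t [set 1]) / fine (total_mass (mu t)) @[t --> +oo] --> limit) /\
        (limit != 0 <->
         (\int[B]_(x in `[2^-1%R, 1%R[%classic) ((1 - x)^-1)%:E < +oo)%E)].
Proof.
pose sigma (t : R) : borel_measure R := size_biased (mu t).
have ev : evolves alpha B sigma.
  split; first exact: (size_biased_le1 mu0_sup mu_sol).
  by move=> g ag; exact: (solution_rderiv B_fin mu0_sup mu_sol ag).
have sigma1 t : sigma t [set 1] = mu t [set 1] 
  by have := size_biased_set1 (mu t) (@ler01 R); rewrite mul1e.
have [_ mu0E _ _ _] := mu_sol.
have mu00 : mu 0 [set 1] = mu0 [set 1] by apply: mu0E; exact: measurable_set1.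
split; first exact: frag_phi_infty_gt0.
  move=> t t0; rewrite -mu00 -!sigma1; exact: (atom_evolution alpha_lt0 B_fin ev t0).
move=> nu beta [nu_on nu_mass nu_moment] _ _ _ hB c limit.
have mP : measurable (`]0%R, +oo[%classic : set (measurableTypeR R)).
  exact: measurable_itv.
pose tau := size_biased nu.
have tauE (g : R -> R) : (forall x : R, 0 < x -> 0 <= g x) ->
    measurable_fun (`]0%R, +oo[%classic : set (measurableTypeR R)) g ->
    (\int[tau]_(x in `]0%R, +oo[%classic) (g x)%:E =
     \int[nu]_(x in `]0%R, +oo[%classic) (g x * x)%:E)%E.
  by move=> _ mg; rewrite integral_size_biased.
have tau_mass : tau `]0%R, +oo[%classic = 1%E.
  have -> : tau `]0%R, +oo[%classic = (\int[tau]_(x in `]0%R, +oo[%classic) 1%:E)%E.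
    by rewrite integral_cst// mul1e.
  by rewrite tauE// -nu_mass; apply: eq_integral => x _; rewrite mul1r.
have tau_moment n : (1 <= n)%N ->
    (\int[tau]_(x in `]0%R, +oo[%classic) (x `^ (`|alpha| * n%:R))%:E =
     (phi_prod B `|alpha| n)%:E)%E.
  move=> n1; rewrite tauE; first exact: nu_moment.
    by move=> x _; exact: powR_ge0.
  exact: measurable_powR_on.
have s0_gt0 : 0 < fine (sigma 0 [set 1]).
  rewrite fine_gt0// sigma1 mu00 mu0_atom/= -mu00 -sigma1.
  by rewrite -ge0_fin_numE// (atom_fin_num ev).
have := atom_mass_ratio alpha_lt0 B_fin B_gt0 ev hB tau_mass tau_moment s0_gt0.
(* The mass of [tau] at [c] is [c] times that of [nu]: this is the factor phi(oo)^{1/|alpha|} of the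
   limit. *)
have -> : fine (tau [set fine (frag_phi_infty B) `^ `|alpha|^-1]) = limit.
  have c0 : 0 < c by rewrite powR_gt0// fine_phi_infty_gt0.
  rewrite /limit -/c (_ : tau [set c] = (c%:E * nu [set c])%E); last first.
    exact: size_biased_set1 (ltW c0).
  (* [fine] sends infinite values to 0, so the two sides agree in those cases too. *)
  by case: (nu [set c]) => [r| |]//=; rewrite ?gt0_muley ?gt0_muleNy ?lte_fin//= mulr0.
move=> [H1 H2]; split; last exact: H2.
apply: cvg_trans H1; apply: near_eq_cvg; near=> t.
have t0 : 0 <= t by near: t; apply: nbhs_pinfty_ge; exact: num_real.
rewrite sigma1 (total_mass_size_biased (solution_gt1 mu0_sup mu_sol t0)); congr (_ / _).
rewrite /moment; under eq_Rintegral do rewrite powRr0.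
by rewrite Rintegral_cst ?mul1r//; exact: measurable_itv.
Unshelve. all: by end_near. Qed.
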